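(* Consider the bilevel problem in expectation form, $f(x,y)=\mathbb E_\xi[F(x,y;\xi)]$, $g(x,y)=\mathbb E_\zeta[G(x,y;\zeta)]$. Assume: (i) $\nabla f$ is $L^f$-Lipschitz in $(x,y)$ and $\|\nabla_2 f(x,y^*(x))\|\le C^f$ for all $x$; (ii) $\nabla g$ and $\nabla^2 g$ are $L_1^g$- and $L_2^g$-Lipschitz in $(x,y)$, and $g(x,\cdot)$ is $\mu$-strongly convex for every $x$; (iii) there are positive constants $\sigma_f,\sigma_{g,1},\sigma_{g,2}$ with $\mathbb E\|\nabla F(x,y;\xi)-\nabla f(x,y)\|^2\le\sigma_f^2$, $\mathbb E\|\nabla G(x,y;\zeta)-\nabla g(x,y)\|^2\le\sigma_{g,1}^2$, $\mathbb E\|\nabla^2G(x,y;\zeta)-\nabla^2g(x,y)\|^2\le\sigma_{g,2}^2$ for all $(x,y)$; (iv) $\nabla F(\cdot;\xi)$, $\nabla G(\cdot;\zeta)$, $\nabla^2G(\cdot;\zeta)$ are $L^f$-, $L_1^g$-, $L_2^g$-Lipschitz in $(x,y)$, respectively; (v) $H$ is bounded below. Take a minibatch size $\tau'$ of order $\epsilon^{-1}$ (with a suitable constant), $b\le\sqrt{\tau'}$, $p=\frac{b}{2\tau'+b}$, and step sizes $\alpha_k=c/(1+\sqrt{(1-p)/(pb)})$, $\beta_k=c_\beta\alpha_k$, $\gamma_k=c_\gamma\alpha_k$ for suitable positive constants $c,c_\beta,c_\gamma$. Then the sample complexity of SPABA (expectation version) for reaching an $\epsilon$-stationary point is $\mathcal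 O(\epsilon^{-1.5})$: there is a number of iterations $K$ for which $\frac1K\sum_{k=0}^{K-1}\mathbb E\|\nabla H(x_k)\|^2\le\epsilon$ while the expected total number of sampled stochastic gradients and Hessian/Jacobian-vector products in these $K$ iterations is $\mathcal O(\epsilon^{-1.5})$.
   Context: Bilevel problem: minimize $H(x)=f(x,y^*(x))$ over $x\in\mathbb{R}^{d_x}$, where $y^*(x)=\arg\min_{y\in\mathbb{R}^{d_y}}g(x,y)$ and $f,g$ are smooth real-valued functions on $\mathbb{R}^{d_x}\times\mathbb{R}^{d_y}$. $\nabla_1,\nabla_2$ are the partial gradients in $x$ and $y$; $\nabla_{12}^2 g$ ($d_x\times d_y$) and $\nabla_{22}^2g$ ($d_y\times d_y$) are blocks of the Hessian. The stochastic derivatives $\nabla F,\nabla G,\nabla^2G$ are unbiased for $\nabla f,\nabla g,\nabla^2g$. Put $z^*(x)=[\nabla_{22}^2g(x,y^*(x))]^{-1}\nabla_2f(x,y^*(x))$. Let $R=C^f/\mu$ and let $\mathrm{Proj}_{\mathbb B(R)}$ be the Euclidean projection onto the closed ball of radius $R$ centered at $0$ in $\mathbb R^{d_y}$. An $\epsilon$-stationary point is a (random) $\bar x$ with $\mathbb E\|\nabla H(\bar x)\|^2\le\epsilon$; $\epsilon\in(0,1]$. SPABA (expectation version). For a finite i.i.d. sample $I$ of copies of $\xi$ and an independent i.i.d. sample $J$ of copies of $\zeta$, and $u=(x,y,z)$, let $$\widehat D_x(u;I,J)=\tfrac1{|I|}\sum_{\xi\in I}\nabla_1F(x,y;\xi)-\tfrac1{|J|}\sum_{\zeta\in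 J}\nabla_{12}^2G(x,y;\zeta)z,\qquad \widehat D_y(u;I,J)=\tfrac1{|J|}\sum_{\zeta\in J}\nabla_2G(x,y;\zeta),$$ $$\widehat D_z(u;I,J)=\tfrac1{|J|}\sum_{\zeta\in J}\nabla_{22}^2G(x,y;\zeta)z-\tfrac1{|I|}\sum_{\xi\in I}\nabla_2F(x,y;\xi).$$ At iteration $k$, with $u_k=(x_k,y_k,z_k)$ and fresh samples independent of the past, for each $\bullet\in\{x,y,z\}$ (with a coin independent of the past and of the samples), $$v_k^\bullet=\begin{cases}\widehat D_\bullet(u_k;I',J'),\ |I'|=|J'|=\tau'&\text{with probability }p,\\ v_{k-1}^\bullet+\widehat D_\bullet(u_k;I,J)-\widehat D_\bullet(u_{k-1};I,J),\ |I|=|J|=b&\text{with probability }1-p.\end{cases}$$ The initial estimators $v_0^\bullet$ are computed with the first branch (minibatch size $\tau'$). Updates: $x_{k+1}=x_k-\alpha_kv_k^x$, $y_{k+1}=y_k-\beta_kv_k^y$, $z_{k+1}=\mathrm{Proj}_{\mathbb B(R)}(z_k-\gamma_kv_k^z)$, with initial $z$-points in $\mathbb B(R)$. Sample count: up to universal constant factors, an iteration costs $\tau'$ with probability $p$ and $b$ with probability $1-p$, i.e. $p\tau'+(1-p)b$ samples in expectation. Convention: $c,c_\beta,c_\gamma$ depend only on $L^f,C^f,L_1^g,L_2^g,\mu,\sigma_f,\sigma_{g,1},\sigma_{g,2}$; the hidden constants depend only on these and on $H(x_0)-\inf H$, $\|y_0-y^*(x_0)\|$, $\|z_0-z^*(x_0)\|$,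 not on $b,\epsilon$. *)

(* Defs.v *)
From HB Require Import structures.
From mathcomp Require Import all_boot all_order all_algebra.
From mathcomp Require Import all_classical all_reals all_analysis.

Set Implicit Arguments.
Unset Strict Implicit.
Unset Printing Implicit Defensive.

Import Order.TTheory GRing.Theory Num.Theory.
Import numFieldNormedType.Exports.

Local Open Scope classical_set_scope.
Local Open Scope ring_scope.

(** * Euclidean analysis on column vectors *)

(* The library norm on matrices is the entrywise maximum; it induces the same
   topology (hence the same derivatives) but not the Euclidean constants. *)
Definition l2norm {R : realType} {n : nat} (v : 'cV[R]_n) : R :=
  Num.sqrt (\sum_i v i 0 ^+ 2).

Definition opnorm {R : realType} {m n : nat} (A : 'M[R]_(m, n)) : R :=
  sup [set l2norm (A *m v) | v in [set v : 'cV[R]_n | l2norm v <= 1]].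

Definition grad {R : realType} {n : nat} (h : 'cV[R]_n -> R) (w : 'cV[R]_n) :
    'cV[R]_n :=
  \col_i 'D_(delta_mx i 0) h w.

Definition hess {R : realType} {n : nat} (h : 'cV[R]_n -> R) (w : 'cV[R]_n) :
    'M[R]_n :=
  \matrix_(i, j) 'D_(delta_mx j 0) (fun v => 'D_(delta_mx i 0) h v) w.

Definition differentiable_everywhere {R : realType} {n : nat}
    (h : 'cV[R]_n -> R) : Prop :=
  forall w, differentiable h w.

Definition twice_differentiable {R : realType} {n : nat}
    (h : 'cV[R]_n -> R) : Prop :=
  differentiable_everywhere h /\ forall w, differentiable (grad h) w.

Definition lipschitz_vec {R : realType} {n m : nat} (L : R)
    (h : 'cV[R]_n -> 'cV[R]_m) : Prop :=
  forall v w, l2norm (h v - h w) <= L * l2norm (v - w).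

Definition lipschitz_mx {R : realType} {n m q : nat} (L : R)
    (h : 'cV[R]_n -> 'M[R]_(m, q)) : Prop :=
  forall v w, opnorm (h v - h w) <= L * l2norm (v - w).

Definition strongly_convex {R : realType} {n : nat} (mu : R)
    (h : 'cV[R]_n -> R) : Prop :=
  forall (v w : 'cV[R]_n) (t : R), 0 <= t <= 1 ->
    h (t *: v + (1 - t) *: w) <=
      t * h v + (1 - t) * h w - mu / 2 * t * (1 - t) * l2norm (v - w) ^+ 2.

(* A minimizer of h over D; the default value 0 is returned when there is none. *)
Definition argmin {R : realType} {n : nat} (D : set 'cV[R]_n)
    (h : 'cV[R]_n -> R) : 'cV[R]_n :=
  xget 0 [set y | D y /\ forall y', D y' -> h y <= h y'].

Definition proj_ball {R : realType} {n : nat} (r : R) (v : 'cV[R]_n) : 'cV[R]_n :=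
  argmin [set w | l2norm w <= r] (fun w => l2norm (w - v)).

(** * The bilevel problem *)

(* Functions of (x, y) are functions of the stacked vector [col_mx x y]. *)
Section blocks.
Context {R : realType} {dx dy : nat}.
Implicit Types (h : 'cV[R]_(dx + dy) -> R) (x : 'cV[R]_dx) (y : 'cV[R]_dy).

Definition grad1 h x y : 'cV[R]_dx := usubmx (grad h (col_mx x y)).
Definition grad2 h x y : 'cV[R]_dy := dsubmx (grad h (col_mx x y)).
Definition hess12 h x y : 'M[R]_(dx, dy) := ursubmx (hess h (col_mx x y)).
Definition hess22 h x y : 'M[R]_dy := drsubmx (hess h (col_mx x y)).

Definition ystar (g : 'cV[R]_(dx + dy) -> R) x : 'cV[R]_dy :=
  argmin setT (fun y => g (col_mx x y)).

Definition objective (f g : 'cV[R]_(dx + dy) -> R) x : R :=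
  f (col_mx x (ystar g x)).

Definition zstar (f g : 'cV[R]_(dx + dy) -> R) x : 'cV[R]_dy :=
  invmx (hess22 g x (ystar g x)) *m grad2 f x (ystar g x).

End blocks.

(** * Stochastic oracles *)

Definition has_mean {R : realType} {d : measure_display} {S : measurableType d}
    (Q : probability S R) (X : S -> R) (m : R) : Prop :=
  Q.-integrable setT (EFin \o X) /\ ('E_Q[X] = m%:E)%E.

Definition has_mean_mx {R : realType} {d : measure_display} {S : measurableType d}
    (Q : probability S R) {m n : nat} (X : S -> 'M[R]_(m, n)) (M : 'M[R]_(m, n)) :
    Prop :=
  forall i j, has_mean Q (fun s => X s i j) (M i j).

Section assumptions.
Context {R : realType} {dx dy : nat}.
Context {d1 d2 : measure_display} {S1 : measurableType d1} {S2 : measurableType d2}.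
Variables (Q1 : probability S1 R) (Q2 : probability S2 R).
Variables (f g : 'cV[R]_(dx + dy) -> R).
Variables (F : S1 -> 'cV[R]_(dx + dy) -> R) (G : S2 -> 'cV[R]_(dx + dy) -> R).
Variables (Lf Cf L1 L2 mu sf s1 s2 : R).

Record oracle_assumption : Prop := OracleAssumption {
  F_differentiable : forall s, differentiable_everywhere (F s);
  G_differentiable : forall s, twice_differentiable (G s);
  F_mean : forall w, has_mean Q1 (fun s => F s w) (f w);
  G_mean : forall w, has_mean Q2 (fun s => G s w) (g w);
  gradF_mean : forall w, has_mean_mx Q1 (fun s => grad (F s) w) (grad f w);
  gradG_mean : forall w, has_mean_mx Q2 (fun s => grad (G s) w) (grad g w);
  hessG_mean : forall w, has_mean_mx Q2 (fun s => hess (G s) w) (hess g w) }.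

Record upper_assumption : Prop := UpperAssumption {
  f_differentiable : differentiable_everywhere f;
  gradf_lipschitz : lipschitz_vec Lf (grad f);
  grad2f_bounded : forall x, l2norm (grad2 f x (ystar g x)) <= Cf }.

Record lower_assumption : Prop := LowerAssumption {
  g_differentiable : twice_differentiable g;
  gradg_lipschitz : lipschitz_vec L1 (grad g);
  hessg_lipschitz : lipschitz_mx L2 (hess g);
  g_strongly_convex :
    forall x : 'cV[R]_dx, strongly_convex mu (fun y : 'cV[R]_dy => g (col_mx x y)) }.

Record variance_assumption : Prop := VarianceAssumption {
  gradF_variance : forall w,
    ('E_Q1[fun s => (l2norm (grad (F s) w - grad f w) ^+ 2)%R] <= (sf ^+ 2)%:E)%E;
  gradG_variance : forall w,
    ('E_Q2[fun s => (l2norm (grad (G s) w - grad g w) ^+ 2)%R] <= (s1 ^+ 2)%:E)%E;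
  hessG_variance : forall w,
    ('E_Q2[fun s => (opnorm (hess (G s) w - hess g w) ^+ 2)%R] <= (s2 ^+ 2)%:E)%E }.

Record oracle_lipschitz : Prop := OracleLipschitz {
  gradF_lipschitz : forall s, lipschitz_vec Lf (grad (F s));
  gradG_lipschitz : forall s, lipschitz_vec L1 (grad (G s));
  hessG_lipschitz : forall s, lipschitz_mx L2 (hess (G s)) }.

Record bilevel_assumptions : Prop := BilevelAssumptions {
  bilevel_oracle : oracle_assumption;
  bilevel_upper : upper_assumption;
  bilevel_lower : lower_assumption;
  bilevel_variance : variance_assumption;
  bilevel_lipschitz : oracle_lipschitz;
  bilevel_bounded_below : has_lbound (range (objective f g)) }.

End assumptions.

(** * Randomness *)

(* Independence of a family of systems of events (here: sigma-algebras). *)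
Definition mutually_independent {R : realType} {d : measure_display}
    {Omega : measurableType d} (P : probability Omega R) {I : Type}
    (sys : I -> set (set Omega)) : Prop :=
  forall (n : nat) (i : 'I_n -> I) (E : 'I_n -> set Omega),
    injective i -> (forall j, sys (i j) (E j)) ->
    P (\bigcap_j E j) = (\prod_(j < n) P (E j))%E.

Section randomness.
Context {R : realType} {d d1 d2 : measure_display}.
Context {Omega : measurableType d} {S1 : measurableType d1} {S2 : measurableType d2}.

(* [coin k] is the triple of coins deciding the branch of v^x, v^y and v^z at
   iteration k.  Its joint law is left free below, so that the three estimators may
   share one coin or use independent ones.  The samples I', J' of iteration k are
   [big_xi k i] and [big_zeta k i] for i < tau', the samples I, J are
   [small_xi k i] and [small_zeta k i] for i < b. *)
Record randomness := Randomness {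
  coin : nat -> {mfun Omega >-> (bool * bool * bool)%type};
  big_xi : nat -> nat -> {mfun Omega >-> S1};
  big_zeta : nat -> nat -> {mfun Omega >-> S2};
  small_xi : nat -> nat -> {mfun Omega >-> S1};
  small_zeta : nat -> nat -> {mfun Omega >-> S2} }.

Inductive draw :=
  | Coin of nat
  | BigXi of nat & nat
  | BigZeta of nat & nat
  | SmallXi of nat & nat
  | SmallZeta of nat & nat.

Variable r : randomness.

Definition draw_events (i : draw) : set (set Omega) :=
  match i with
  | Coin k => preimage_set_system setT (coin r k) measurable
  | BigXi k i => preimage_set_system setT (big_xi r k i) measurable
  | BigZeta k i => preimage_set_system setT (big_zeta r k i) measurable
  | SmallXi k i => preimage_set_system setT (small_xi r k i) measurable
  | SmallZeta k i => preimage_set_system setT (small_zeta r k i) measurable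
  end.

Record sampling (P : probability Omega R) (Q1 : probability S1 R)
    (Q2 : probability S2 R) (p : R) : Prop := Sampling {
  coin_x_law : forall k, P (coin r k @^-1` [set c : bool * bool * bool | c.1.1]) = p%:E;
  coin_y_law : forall k, P (coin r k @^-1` [set c : bool * bool * bool | c.1.2]) = p%:E;
  coin_z_law : forall k, P (coin r k @^-1` [set c : bool * bool * bool | c.2]) = p%:E;
  big_xi_law : forall k i A, measurable A -> P (big_xi r k i @^-1` A) = Q1 A;
  big_zeta_law : forall k i A, measurable A -> P (big_zeta r k i @^-1` A) = Q2 A;
  small_xi_law : forall k i A, measurable A -> P (small_xi r k i @^-1` A) = Q1 A;
  small_zeta_law : forall k i A, measurable A -> P (small_zeta r k i @^-1` A) = Q2 A;
  draws_independent : mutually_independent P draw_events }.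

End randomness.

Arguments randomness {d d1 d2} Omega S1 S2.

(** * SPABA, expectation version *)

(* Used both for the points u = (x, y, z) and for the estimators (v^x, v^y, v^z). *)
Record iterate (R : realType) (dx dy : nat) := Iterate {
  comp_x : 'cV[R]_dx;
  comp_y : 'cV[R]_dy;
  comp_z : 'cV[R]_dy }.

Section spaba.
Context {R : realType} {dx dy : nat} {d d1 d2 : measure_display}.
Context {Omega : measurableType d} {S1 : measurableType d1} {S2 : measurableType d2}.
Variables (F : S1 -> 'cV[R]_(dx + dy) -> R) (G : S2 -> 'cV[R]_(dx + dy) -> R).

Definition sample_mean {S : Type} {n : nat} (I : seq S) (h : S -> 'cV[R]_n) :
    'cV[R]_n :=
  (size I)%:R^-1 *: \sum_(s <- I) h s.

Definition Dhat (u : iterate R dx dy) (I : seq S1) (J : seq S2) : iterate R dx dy :=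
  let: Iterate x y z := u in
  Iterate
    (sample_mean I (fun s => grad1 (F s) x y)
       - sample_mean J (fun s => hess12 (G s) x y *m z))
    (sample_mean J (fun s => grad2 (G s) x y))
    (sample_mean J (fun s => hess22 (G s) x y *m z)
       - sample_mean I (fun s => grad2 (F s) x y)).

Variables (radius alpha beta gamma : R) (tau b : nat).
Variables (r : randomness Omega S1 S2) (u0 : iterate R dx dy).

Definition big_Dhat (k : nat) (w : Omega) (u : iterate R dx dy) : iterate R dx dy :=
  Dhat u (mkseq (fun i => big_xi r k i w) tau) (mkseq (fun i => big_zeta r k i w) tau).

Definition small_Dhat (k : nat) (w : Omega) (u : iterate R dx dy) : iterate R dx dy :=
  Dhat u (mkseq (fun i => small_xi r k i w) b) (mkseq (fun i => small_zeta r k i w) b).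

Definition update (u v : iterate R dx dy) : iterate R dx dy :=
  Iterate (comp_x u - alpha *: comp_x v)
          (comp_y u - beta *: comp_y v)
          (proj_ball radius (comp_z u - gamma *: comp_z v)).

Definition estimate (k : nat) (w : Omega) (uprev vprev u : iterate R dx dy) :
    iterate R dx dy :=
  let B := big_Dhat k w u in
  let D := small_Dhat k w u in
  let D' := small_Dhat k w uprev in
  let c := coin r k w in
  Iterate (if c.1.1 then comp_x B else comp_x vprev + comp_x D - comp_x D')
          (if c.1.2 then comp_y B else comp_y vprev + comp_y D - comp_y D')
          (if c.2 then comp_z B else comp_z vprev + comp_z D - comp_z D').

(* The pair (u_k, v_k). *)
Fixpoint spaba (k : nat) (w : Omega) : iterate R dx dy * iterate R dx dy :=
  match k with
  | 0 => (u0, big_Dhat 0 w u0)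
  | k'.+1 =>
      let: (u, v) := spaba k' w in
      let u' := update u v in
      (u', estimate k'.+1 w u v u')
  end.

Definition spaba_x (k : nat) (w : Omega) : 'cV[R]_dx := comp_x (spaba k w).1.

(* Samples drawn at iteration k, counted separately for the three estimators. *)
Definition sample_cost (k : nat) (w : Omega) : nat :=
  let cost (c : bool) := if (k == 0)%N || c then tau else b in
  (cost (coin r k w).1.1 + cost (coin r k w).1.2 + cost (coin r k w).2)%N.

End spaba.

(* Main.v *)
From HB Require Import structures.
From mathcomp Require Import all_boot all_order all_algebra.
From mathcomp Require Import all_classical all_reals all_analysis.
From mathcomp Require Import measurable_realfun ring lra.
Require Import Defs.

Set Implicit Arguments.
Unset Strict Implicit.
Unset Printing Implicit Defensive.

Import Order.TTheory GRing.Theory Num.Theory.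
Import numFieldNormedType.Exports.

Local Open Scope classical_set_scope.
Local Open Scope ring_scope.

(** The proof combines a deterministic analysis of one step with a bound on the
error of the recursive estimators, and balances the two.

Hypergradient.  Write D_x, D_y, D_z for the exact directions whose stochastic
versions drive the three updates.  Then grad H (x) = D_x (x, ystar x, zstar x)
[grad_objective], and this needs no implicit function theorem.  As grad2 g vanishes
at (x, ystar x) for every x, the number <zstar x, grad2 g (x', ystar x') -
grad2 g (x, ystar x)> is zero; expanding it to first order and adding it to the expansion of
f (x', ystar x') - f (x, ystar x) removes the displacement of ystar, by symmetry of the Hessian
and by the linear equation that defines zstar.  Only a remainder quadratic in x' - x is
left, because ystar is Lipschitz [objective_quad].  The same remainder gives the descent
inequality for H.

One step.  Strong convexity makes the y- and z-updates contract towards ystar x and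
zstar x, while moving x shifts these targets by at most a multiple of alpha |v^x|.  A
potential, namely H plus multiples of |y - ystar|^2 and |z - zstar|^2, therefore decreases by
(alpha / 2) |grad H|^2 and by a multiple of
alpha (|v^x|^2 + |y - ystar|^2 + |z - zstar|^2), up to a multiple of alpha times the squared
error of the estimators [potential_step].  The second part of the decrease pays for
the squared length of the step [dist2_step].

Estimators.  With probability p the error is reset to that of a fresh batch of size
tau; otherwise the increments of the estimator and of the exact direction differ by a
centred batch mean, which adds at most (C / b) |u_{k+1} - u_k|^2 to the mean squared
error [errE_rec].  Conditioning on the past is replaced by working on the
sigma-algebra generated by the past draws: a draw outside it can be integrated out by
Tonelli's theorem [fresh_draw].  This calls for joint measurability of the oracles at
random points, which follows from measurability in the sample and Lipschitz continuity
in the point [caratheodory].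

Balance. Adding lam times the squared error with lam = la * alpha / p gives a sum that
telescopes [lyapunov_sum], whence (alpha / 2) times the sum over k < K of E |grad H
(x_k)|^2 is at most phi + K * la * alpha * csigma / tau [expected_gradient_sum], where
phi does not depend on eps or b [initial_error]. With tau of order 1 / eps the last term
is at most a quarter of K * alpha * eps, so K of order phi / (alpha * eps) suffices. For
p = b / (2 tau + b) the ratio (1 - p) / (p b) is 2 tau / b^2, so alpha is of order b /
sqrt tau, while an iteration costs O(b) samples on average. Hence K iterations cost O(K
b) = O(sqrt tau / eps) = O(eps^(-3/2)), and the initial batches only O(tau) = O(1 / eps)
[total_cost]. *)

(** * Draws outside the history are independent of it *)

Section history.
Context {R : realType} {d : measure_display} {Omega : measurableType d}.
Context (P : probability Omega R) {I : Type} (sys : I -> set (set Omega)).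
Hypothesis sys_sigma : forall i, sigma_algebra setT (sys i).
Hypothesis sys_meas : forall i, sys i `<=` measurable.
Hypothesis sys_ind : mutually_independent P sys.

Let J := {classic I}.

(** The intersections of finitely many events of the draws in [D].  They form a
pi-system, unlike the union of the [sys i], which is what uniqueness of measures
requires. *)
Definition cylinders (D : set I) : set (set Omega) :=
  [set A | exists (l : seq J) (E : J -> set Omega),
     [/\ forall i, i \in l -> D i, forall i, sys i (E i),
         forall i, i \notin l -> E i = setT
       & A = \bigcap_i E i]].

(** The sample space itself, with the sigma-algebra generated by the draws in [D]:
that a random variable is a function of the draws in [D] is expressed as measurability
on [history D]. *)
Definition history (D : set I) : measurableType (cylinders D).-sigma :=
  g_sigma_algebraType (cylinders D).

Let sysT i : sys i setT.
Proof.
by case: (sys_sigma i) => h0 hC _; rewrite -(setD0 setT); exact: hC.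
Qed.

Let sysI i A B : sys i A -> sys i B -> sys i (A `&` B).
Proof.
move=> sA sB; have := sigma_algebra_id (sys_sigma i) => e.
rewrite -e; apply: (@measurableI _ (g_sigma_algebraType (sys i)));
by rewrite /measurable /= e.
Qed.

Lemma cylinders_setI D : setI_closed (cylinders D).
Proof.
move=> _ _ [l [E [lD sE El ->]]] [l' [E' [lD' sE' El' ->]]].
exists (l ++ l'), (fun i => E i `&` E' i); split.
- by move=> i; rewrite mem_cat => /orP[/lD|/lD'].
- by move=> i; exact: sysI.
- move=> i; rewrite mem_cat negb_or => /andP[il il'].
  by rewrite El// El'// setTI.
- by rewrite bigcapI.
Qed.

Lemma cylindersT D : cylinders D setT.
Proof.
by exists [::], (fun=> setT); split=> //; rewrite bigcapT.
Qed.

Lemma sub_cylinders i D A : D i -> sys i A -> cylinders D A.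
Proof.
move=> Di sA; exists [:: (i : J)], (fun j : J => if j == i then A else setT); split.
- by move=> j; rewrite inE => /eqP ->.
- by move=> j; case: eqVneq => [->//|_]; exact: sysT.
- by move=> j; rewrite inE => /negPf ->.
- apply/seteqP; split=> w.
    by move=> Aw j _; case: ifP.
  by move=> /(_ i Logic.I); rewrite eqxx.
Qed.

Lemma cylindersS D D' : D `<=` D' -> cylinders D `<=` cylinders D'.
Proof.
by move=> DD' _ [l [E [lD sE El ->]]]; exists l, E; split=> // i /lD/DD'.
Qed.

Let cyl_bigcap (l : seq J) (E : J -> set Omega) :
  (forall i, i \notin l -> E i = setT) ->
  \bigcap_i E i = \bigcap_(j in [set: 'I_(size (undup l))]) E (tnth (in_tuple (undup l)) j).
Proof.
move=> El; apply/seteqP; split=> w h.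
  by move=> j _; exact: h.
move=> i _; have [il|/El->//] := boolP (i \in l).
have il' : i \in undup l by rewrite mem_undup.
have si : (index i (undup l) < size (undup l))%N by rewrite index_mem.
have := h (Ordinal si) Logic.I.
by rewrite (tnth_nth (i : J))/= nth_index.
Qed.

Let cyl_prob (l : seq J) (E : J -> set Omega) :
  (forall i, sys i (E i)) -> (forall i, i \notin l -> E i = setT) ->
  P (\bigcap_i E i) = (\prod_(i <- undup l) P (E i))%E.
Proof.
move=> sE El; have inj : injective (tnth (in_tuple (undup l))).
  by apply/tuple_uniqP; exact: undup_uniq.
by rewrite (cyl_bigcap El) (sys_ind inj (fun j => sE _)) [RHS]big_tnth.
Qed.

Lemma cylinders_indep D i A B : ~ D i -> cylinders D A -> sys i B ->
  P (A `&` B) = (P A * P B)%E.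
Proof.
move=> nDi [l [E [lD sE El ->]]] sB.
have il : (i : J) \notin l by apply/negP => /lD.
pose E' (j : J) := if j == i then B else E j.
have sE' j : sys j (E' j) by rewrite /E'; case: eqVneq => [->|].
have El' j : j \notin ((i : J) :: l) -> E' j = setT.
  by rewrite inE negb_or /E' => /andP[/negPf-> /El].
have -> : \bigcap_i E i `&` B = \bigcap_i E' i.
  apply/seteqP; split=> w.
    by move=> [Ew Bw] j _; rewrite /E'; case: ifP => _ //; exact: Ew.
  move=> h; split; last by have := h i Logic.I; rewrite /E' eqxx.
  move=> j _; have := h j Logic.I; rewrite /E'; case: eqVneq => // -> _.
  by rewrite El.
rewrite (cyl_prob sE' El') (cyl_prob sE El) /= (negPf il) big_cons /E' eqxx muleC.
congr (_ * _)%E; apply: eq_big_seq => j; rewrite mem_undup => jl.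
by case: eqVneq => // ji; move: il; rewrite -ji jl.
Qed.

Lemma measurable_cylinders D : cylinders D `<=` measurable.
Proof.
move=> _ [l [E [lD sE El ->]]]; rewrite (cyl_bigcap El).
by apply: fin_bigcap_measurable => // j _; exact: (sys_meas (sE _)).
Qed.

Lemma history_measurable D (A : set Omega) :
  measurable (A : set (history D)) -> measurable A.
Proof.
move=> mA.
apply: (smallest_sub (@sigma_algebra_measurable _ Omega) (@measurable_cylinders D)).
exact: mA.
Qed.

Lemma measurable_fun_history D : measurable_fun setT (id : Omega -> history D).
Proof. by move=> _ A mA; rewrite setTI; exact: history_measurable mA. Qed.

Lemma measurable_historyS D D' (DD' : D `<=` D') d' (T : measurableType d')
    (f : Omega -> T) :
  measurable_fun setT (f : history D -> T) -> measurable_fun setT (f : history D' -> T).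
Proof.
move=> mf _ A mA; have := mf measurableT A mA.
rewrite !setTI.
apply: smallest_sub; first exact: smallest_sigma_algebra.
by move=> B /(cylindersS DD') hB; exact: sub_gen_smallest.
Qed.

Lemma measurable_history D d' (T : measurableType d') (f : Omega -> T) :
  measurable_fun setT (f : history D -> T) -> measurable_fun setT f.
Proof.
by move=> mf _ A mA; have := mf measurableT A mA; rewrite !setTI => /history_measurable.
Qed.

(** On a cylinder [A] this is the product rule for the family enlarged by [B].
Both sides are finite measures in [A] that agree on a generating pi-system, hence on
the whole of [history D]. *)
Lemma history_indep D i (A B : set Omega) : ~ D i ->
  measurable (A : set (history D)) -> sys i B ->
  P (A `&` B) = (P A * P B)%E.
Proof.
move=> nDi mA sB.
have mB : measurable B by exact: sys_meas sB.
have p0 : 0 <= fine (P B) by exact: fine_ge0.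
pose j := id : Omega -> history D.
have mj : measurable_fun setT j by exact: measurable_fun_history.
pose j' : {mfun Omega >-> history D} := HB.pack j (isMeasurableFun.Build _ _ _ _ j mj).
pose m1 : {measure set (history D) -> \bar R} := pushforward (mrestr P mB) j'.
pose m2 : {measure set (history D) -> \bar R} := mscale (NngNum p0) (distribution P j').
have pB : (fine (P B))%:E = P B by rewrite fineK// fin_num_measure.
have := @g_sigma_algebra_measure_unique _ R (history D) (cylinders D).
move=> /(_ _ (fun=> setT) _ _ (m1 mj) m2) H.
have m1E X : m1 mj X = P (X `&` B) by [].
have m2E X : m2 X = (P X * P B)%E by rewrite -pB muleC.
rewrite -m1E -m2E; apply: H => //.
- by move=> X hX; exact: sub_gen_smallest.
- by move=> _; exact: cylindersT.
- by rewrite bigcup_const.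
- exact: cylinders_setI.
- by move=> X cX; rewrite m1E m2E; exact: cylinders_indep cX sB.
- by move=> _; rewrite m1E setTI -ge0_fin_numE// fin_num_measure.
Qed.

(** By independence the joint law of the past and of [X] is a product measure, so
Tonelli's theorem integrates [X] out with the past frozen.  This plays the role of
conditioning on the past. *)
Lemma fresh_draw D i d' (S : measurableType d') (Q : probability S R)
    (X : Omega -> S) (phi : history D * S -> \bar R) : ~ D i ->
  measurable_fun setT X ->
  (forall A, measurable A -> sys i (X @^-1` A)) ->
  (forall A, measurable A -> P (X @^-1` A) = Q A) ->
  measurable_fun [set: history D * S] phi -> (forall t, 0 <= phi t)%E ->
  (\int[P]_w phi (w, X w) = \int[P]_w \int[Q]_s phi (w, s))%E.
Proof.
move=> nDi mX sX lX mphi phi0.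
pose j := id : Omega -> history D.
have mj : measurable_fun setT j by exact: measurable_fun_history.
pose j' : {mfun Omega >-> history D} := HB.pack j (isMeasurableFun.Build _ _ _ _ j mj).
pose PD : probability (history D) R := distribution P j'.
pose h := (fun w => (j w, X w)) : Omega -> history D * S.
have mh : measurable_fun setT h by exact: measurable_fun_pair.
pose h' : {mfun Omega >-> (history D * S)%type} :=
  HB.pack h (isMeasurableFun.Build _ _ _ _ h mh).
pose m' : probability (history D * S)%type R := distribution P h'.
have E : forall A, measurable A -> (PD \x Q)%E A = m' A.
  apply: product_measure_unique => A B mA mB.
  rewrite /m' /PD /distribution /= /pushforward.
  by rewrite -lX//; apply: (history_indep nDi mA); exact: sX.
transitivity (\int[m']_t phi t)%E.
  by rewrite ge0_integral_pushforward.
transitivity (\int[(PD \x Q)%E]_t phi t)%E.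
  by apply: eq_measure_integral => A mA _; exact/esym/E.
rewrite fubini_tonelli1// ge0_integral_pushforward//.
  exact: measurable_fun_fubini_tonelli_F.
by move=> y _; exact: integral_ge0.
Qed.

End history.

(** * Euclidean norm and operator norm *)

Section euclid.
Context {R : realType}.
Implicit Types (n m : nat).

Definition dot {n} (u v : 'cV[R]_n) : R := \sum_i u i 0 * v i 0.

Lemma dotC n (u v : 'cV[R]_n) : dot u v = dot v u.
Proof. by apply: eq_bigr => i _; rewrite mulrC. Qed.

Lemma dotDl n (u v w : 'cV[R]_n) : dot (u + v) w = dot u w + dot v w.
Proof. by rewrite -big_split; apply: eq_bigr => i _; rewrite mxE mulrDl. Qed.

Lemma dotZl n a (u v : 'cV[R]_n) : dot (a *: u) v = a * dot u v.
Proof. by rewrite mulr_sumr; apply: eq_bigr => i _; rewrite mxE mulrA. Qed.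

Lemma dotNl n (u v : 'cV[R]_n) : dot (- u) v = - dot u v.
Proof. by rewrite -scaleN1r dotZl mulN1r. Qed.

Lemma dotBl n (u v w : 'cV[R]_n) : dot (u - v) w = dot u w - dot v w.
Proof. by rewrite dotDl dotNl. Qed.

Lemma dot0l n (u : 'cV[R]_n) : dot 0 u = 0.
Proof. by rewrite -(scale0r 0) dotZl mul0r. Qed.

Lemma dotDr n (u v w : 'cV[R]_n) : dot u (v + w) = dot u v + dot u w.
Proof. by rewrite dotC dotDl !(dotC _ u). Qed.

Lemma dotZr n a (u v : 'cV[R]_n) : dot u (a *: v) = a * dot u v.
Proof. by rewrite dotC dotZl dotC. Qed.

Lemma dotNr n (u v : 'cV[R]_n) : dot u (- v) = - dot u v.
Proof. by rewrite dotC dotNl dotC. Qed.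

Lemma dotBr n (u v w : 'cV[R]_n) : dot u (v - w) = dot u v - dot u w.
Proof. by rewrite dotDr dotNr. Qed.

Lemma dot0r n (u : 'cV[R]_n) : dot u 0 = 0.
Proof. by rewrite dotC dot0l. Qed.

Lemma dot_ge0 n (u : 'cV[R]_n) : 0 <= dot u u.
Proof. by apply: sumr_ge0 => i _; rewrite -expr2 sqr_ge0. Qed.

Lemma l2sq n (u : 'cV[R]_n) : l2norm u ^+ 2 = dot u u.
Proof.
rewrite /l2norm sqr_sqrtr; first by apply: eq_bigr => i _; rewrite expr2.
by apply: sumr_ge0 => i _; rewrite sqr_ge0.
Qed.

Lemma l2_ge0 n (u : 'cV[R]_n) : 0 <= l2norm u.
Proof. exact: sqrtr_ge0. Qed.
#[local] Hint Resolve l2_ge0 : core.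

Lemma l2_0 n : l2norm (0 : 'cV[R]_n) = 0.
Proof. by apply/eqP; rewrite -sqrf_eq0 l2sq dot0l. Qed.

Lemma dot_eq0 n (u : 'cV[R]_n) : dot u u = 0 -> u = 0.
Proof.
move=> /eqP; rewrite psumr_eq0 => [/allP h|i _]; last by rewrite -expr2 sqr_ge0.
apply/matrixP => i j; rewrite (ord1 j) mxE.
have := h i (mem_index_enum i) => /=.
by rewrite mulf_eq0 orbb => /eqP.
Qed.

Lemma l2_eq0 n (u : 'cV[R]_n) : l2norm u = 0 -> u = 0.
Proof. by move=> h; apply: dot_eq0; rewrite -l2sq h expr0n. Qed.

Lemma l2Z n a (u : 'cV[R]_n) : l2norm (a *: u) = `|a| * l2norm u.
Proof.
apply/eqP; rewrite -(@eqrXn2 _ 2) ?mulr_ge0//.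
by rewrite exprMn !l2sq dotZl dotZr mulrA -expr2 real_normK// num_real.
Qed.

Lemma l2N n (u : 'cV[R]_n) : l2norm (- u) = l2norm u.
Proof. by rewrite -scaleN1r l2Z normrN1 mul1r. Qed.

Lemma l2C n (u v : 'cV[R]_n) : l2norm (u - v) = l2norm (v - u).
Proof. by rewrite -opprB l2N. Qed.

Lemma l2sqD n (u v : 'cV[R]_n) :
  l2norm (u + v) ^+ 2 = l2norm u ^+ 2 + 2 * dot u v + l2norm v ^+ 2.
Proof. by rewrite !l2sq dotDl !dotDr (dotC v u); ring. Qed.

Lemma l2sqB n (u v : 'cV[R]_n) :
  l2norm (u - v) ^+ 2 = l2norm u ^+ 2 - 2 * dot u v + l2norm v ^+ 2.
Proof. by rewrite l2sqD dotNr l2N; ring. Qed.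

Lemma cauchy_schwarz n (u v : 'cV[R]_n) : dot u v <= l2norm u * l2norm v.
Proof.
have [/eqP v0|v0] := boolP (l2norm v == 0).
  by rewrite v0 mulr0 (l2_eq0 v0) dot0r.
have vp : 0 < l2norm v by rewrite lt_def v0 l2_ge0.
have h := dot_ge0 (l2norm v *: u - l2norm u *: v).
have : 0 <= l2norm (l2norm v *: u - l2norm u *: v) ^+ 2 by rewrite sqr_ge0.
rewrite l2sqB !l2Z !ger0_norm// dotZl dotZr => {}h.
have [/eqP u0|u0] := boolP (l2norm u == 0).
  by rewrite u0 mul0r (l2_eq0 u0) dot0l.
have up : 0 < l2norm u by rewrite lt_def u0 l2_ge0.
have puv : 0 < l2norm u * l2norm v by rewrite mulr_gt0.
rewrite -(ler_pM2l puv); nra.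
Qed.

Lemma dot_le_norm n (u v : 'cV[R]_n) : `|dot u v| <= l2norm u * l2norm v.
Proof.
rewrite ler_norml cauchy_schwarz andbT lerNl -dotNl.
by rewrite (le_trans (cauchy_schwarz _ _))// l2N.
Qed.

Lemma l2D n (u v : 'cV[R]_n) : l2norm (u + v) <= l2norm u + l2norm v.
Proof.
rewrite -ler_sqr ?nnegrE ?addr_ge0//.
by rewrite l2sqD; have := cauchy_schwarz u v; nra.
Qed.

Lemma l2B n (u v : 'cV[R]_n) : l2norm (u - v) <= l2norm u + l2norm v.
Proof. by rewrite (le_trans (l2D _ _))// l2N. Qed.

(** Expand |a u - v|^2 >= 0 and divide by [a]. *)
Lemma l2sqD_young n (a : R) (u v : 'cV[R]_n) : 0 < a ->
  l2norm (u + v) ^+ 2 <= (1 + a) * l2norm u ^+ 2 + (1 + a^-1) * l2norm v ^+ 2.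
Proof.
move=> a0.
have h : 0 <= l2norm (a *: u - v) ^+ 2 by rewrite sqr_ge0.
rewrite l2sqB l2Z dotZl exprMn real_normK ?num_real// in h.
rewrite l2sqD -subr_ge0.
have -> : (1 + a) * l2norm u ^+ 2 + (1 + a^-1) * l2norm v ^+ 2 -
   (l2norm u ^+ 2 + 2 * dot u v + l2norm v ^+ 2) =
   a^-1 * (a ^+ 2 * l2norm u ^+ 2 - 2 * (a * dot u v) + l2norm v ^+ 2).
  by field; rewrite gt_eqF.
by rewrite mulr_ge0// invr_ge0 ltW.
Qed.

Lemma l2sqD2 n (u v : 'cV[R]_n) :
  l2norm (u + v) ^+ 2 <= 2 * (l2norm u ^+ 2 + l2norm v ^+ 2).
Proof. by have := @l2sqD_young n 1 u v ltr01; rewrite invr1 mulrDr. Qed.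

Lemma dot_delta n (u : 'cV[R]_n) i : dot (delta_mx i 0) u = u i 0.
Proof.
rewrite /dot (bigD1 i)//= mxE !eqxx mul1r big1 ?addr0// => j ji.
by rewrite mxE (negPf ji) mul0r.
Qed.

Lemma l2_delta n (i : 'I_n) : l2norm (delta_mx i 0 : 'cV[R]_n) = 1.
Proof.
apply/eqP; rewrite -(@eqrXn2 _ 2)// l2sq dot_delta mxE !eqxx expr1n //.
Qed.

Lemma l2_coord n (u : 'cV[R]_n) i : `|u i 0| <= l2norm u.
Proof. by rewrite -dot_delta (le_trans (dot_le_norm _ _))// l2_delta mul1r. Qed.

Lemma l2_le_sum n (u : 'cV[R]_n) : l2norm u <= \sum_i `|u i 0|.
Proof.
have s0 : 0 <= \sum_i `|u i 0| by apply: sumr_ge0.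
rewrite -ler_sqr ?nnegrE// l2sq expr2 /dot mulr_suml.
apply: ler_sum => i _.
rewrite (le_trans (ler_norm _))// normrM ler_wpM2l//.
by rewrite (bigD1 i)//= lerDl sumr_ge0.
Qed.

(** The vector [u] itself is the worst test vector. *)
Lemma l2_le_dual n (u : 'cV[R]_n) (c : R) : 0 <= c ->
  (forall a : 'cV[R]_n, dot a u <= c * l2norm a) -> l2norm u <= c.
Proof.
move=> c0 /(_ u); rewrite -l2sq => h.
have [/eqP->//|u0] := boolP (l2norm u == 0).
have up : 0 < l2norm u by rewrite lt_def u0 l2_ge0.
by rewrite -(ler_pM2r up) -expr2.
Qed.

Lemma dot_col m n (u u' : 'cV[R]_m) (v v' : 'cV[R]_n) :
  dot (col_mx u v) (col_mx u' v') = dot u u' + dot v v'.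
Proof.
rewrite /dot big_split_ord /=; congr (_ + _); apply: eq_bigr => i _.
  by rewrite !col_mxEu.
by rewrite !col_mxEd.
Qed.

Lemma l2sq_col m n (u : 'cV[R]_m) (v : 'cV[R]_n) :
  l2norm (col_mx u v) ^+ 2 = l2norm u ^+ 2 + l2norm v ^+ 2.
Proof. by rewrite !l2sq dot_col. Qed.

Lemma l2_col m n (u : 'cV[R]_m) (v : 'cV[R]_n) :
  l2norm (col_mx u v) <= l2norm u + l2norm v.
Proof.
rewrite -ler_sqr ?nnegrE ?addr_ge0// l2sq_col sqrrD.
by rewrite lerD2r lerDl mulrn_wge0// mulr_ge0.
Qed.

Lemma l2_0col m n (u : 'cV[R]_m) : l2norm (col_mx (0 : 'cV[R]_n) u) = l2norm u.
Proof.
apply/eqP; rewrite -(@eqrXn2 _ 2)// l2sq_col l2_0 expr0n add0r //.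
Qed.

Lemma l2_usub m n (u : 'cV[R]_(m + n)) : l2norm (usubmx u) <= l2norm u.
Proof.
rewrite -ler_sqr ?nnegrE// -[in leRHS](vsubmxK u) l2sq_col lerDl sqr_ge0 //.
Qed.

Lemma l2_dsub m n (u : 'cV[R]_(m + n)) : l2norm (dsubmx u) <= l2norm u.
Proof.
rewrite -ler_sqr ?nnegrE// -[in leRHS](vsubmxK u) l2sq_col lerDr sqr_ge0 //.
Qed.

Lemma opnorm_set_bounded m n (A : 'M[R]_(m, n)) :
  exists c, forall v : 'cV[R]_n, l2norm (A *m v) <= c * l2norm v.
Proof.
exists (\sum_i l2norm (row i A)^T) => v.
rewrite (le_trans (l2_le_sum _))// mulr_suml; apply: ler_sum => i _.
have -> : (A *m v) i 0 = dot (row i A)^T v.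
  by rewrite mxE; apply: eq_bigr => j _; rewrite !mxE.
exact: dot_le_norm.
Qed.

(** Without it the [sup] in [opnorm] could be a default value, and bounds on
[opnorm] would say nothing about matrices. *)
Lemma opnorm_has_sup m n (A : 'M[R]_(m, n)) :
  has_sup [set l2norm (A *m v) | v in [set v : 'cV[R]_n | l2norm v <= 1]].
Proof.
split; first by exists (l2norm (A *m 0)), 0 => //=; rewrite l2_0 ler01.
have [c hc] := opnorm_set_bounded A.
exists `|c| => _ /= [v v1 <-]; rewrite (le_trans (hc v))//.
rewrite (le_trans (ler_norm _))// normrM (ger0_norm (l2_ge0 _)).
by rewrite ler_piMr.
Qed.

Lemma opnorm_ge0 m n (A : 'M[R]_(m, n)) : 0 <= opnorm A.
Proof.
have [_ hb] := opnorm_has_sup A.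
apply: (le_trans _ (ub_le_sup hb (x := l2norm (A *m 0)) _)) => //.
by exists 0 => //=; rewrite l2_0 ler01.
Qed.

Lemma opnormP m n (A : 'M[R]_(m, n)) v : l2norm (A *m v) <= opnorm A * l2norm v.
Proof.
have [/eqP v0|v0] := boolP (l2norm v == 0).
  by rewrite (l2_eq0 v0) mulmx0 !l2_0 mulr0.
have vp : 0 < l2norm v by rewrite lt_def v0 l2_ge0.
rewrite -ler_pdivrMr//.
have -> : l2norm (A *m v) / l2norm v = l2norm (A *m ((l2norm v)^-1 *: v)).
  by rewrite -scalemxAr l2Z ger0_norm ?invr_ge0// mulrC.
have [_ hb] := opnorm_has_sup A; apply: ub_le_sup => //.
exists ((l2norm v)^-1 *: v) => //=.
by rewrite l2Z ger0_norm ?invr_ge0// mulVf.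
Qed.

Lemma opnorm_entry m n (A : 'M[R]_(m, n)) i j : `|A i j| <= opnorm A.
Proof.
have -> : A i j = (A *m (delta_mx j 0 : 'cV[R]_n)) i 0 by rewrite -colE mxE.
by rewrite (le_trans (l2_coord _ _))// (le_trans (opnormP _ _))// l2_delta mulr1.
Qed.

(** Extracts first-order information from an inequality valid for all small steps:
divide by the step, then let it tend to 0. *)
Lemma ler_limit0 (a b c : R) : (forall t, 0 < t <= 1 -> a <= b + c * t) -> a <= b.
Proof.
move=> h; apply/ler_addgt0Pr => e e0.
have c0 : 0 < `|c| + 1 by rewrite ltr_wpDl.
pose t := Num.min 1 (e / (`|c| + 1)).
have t0 : 0 < t by rewrite lt_min ltr01 divr_gt0.
have t1 : t <= 1 by rewrite ge_min lexx.
have te : t * (`|c| + 1) <= e.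
  by rewrite -ler_pdivlMr// ge_min lexx orbT.
have := h t; rewrite t0 t1 => /(_ isT) h'; rewrite (le_trans h')// lerD2l.
rewrite (le_trans _ te)// mulrC ler_wpM2l ?(ltW t0)//.
by rewrite (le_trans (ler_norm c))// lerDl.
Qed.

End euclid.
#[global] Hint Extern 0 (is_true (0 <= l2norm _)) => exact: l2_ge0 : core.

(** * Measurability of vector-valued maps *)

Section vector_measurability.
Context {R : realType}.

(** Measurability is taken coordinatewise, so that blocks, sums and norms reduce to
real-valued functions. *)
Definition vmeas {d} {T : measurableType d} {n} (f : T -> 'cV[R]_n) : Prop :=
  forall i, measurable_fun setT (fun t => f t i 0).

Section basic.
Context {d} {T : measurableType d}.

Lemma vmeas_cst n (c : 'cV[R]_n) : vmeas (fun _ : T => c).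
Proof. by move=> i; exact: measurable_cst. Qed.

Lemma vmeasD n (f g : T -> 'cV[R]_n) : vmeas f -> vmeas g ->
  vmeas (fun t => f t + g t).
Proof.
move=> hf hg i; under eq_fun do rewrite mxE.
exact: measurable_funD.
Qed.

Lemma vmeasZ n (a : R) (f : T -> 'cV[R]_n) : vmeas f -> vmeas (fun t => a *: f t).
Proof.
move=> hf i; under eq_fun do rewrite mxE.
exact: measurable_funM.
Qed.

Lemma vmeasN n (f : T -> 'cV[R]_n) : vmeas f -> vmeas (fun t => - f t).
Proof. by move=> hf; under eq_fun do rewrite -scaleN1r; exact: vmeasZ. Qed.

Lemma vmeasB n (f g : T -> 'cV[R]_n) : vmeas f -> vmeas g ->
  vmeas (fun t => f t - g t).
Proof. by move=> hf hg; apply: vmeasD => //; exact: vmeasN. Qed.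

Lemma vmeas_sum n (J : Type) (r : seq J) (f : J -> T -> 'cV[R]_n) :
  (forall j, vmeas (f j)) -> vmeas (fun t => \sum_(j <- r) f j t).
Proof.
move=> hf i; under eq_fun do rewrite summxE.
by apply: measurable_sum => j; exact: hf.
Qed.

Lemma vmeas_col m n (f : T -> 'cV[R]_m) (g : T -> 'cV[R]_n) : vmeas f -> vmeas g ->
  vmeas (fun t => col_mx (f t) (g t)).
Proof.
move=> hf hg i; case: (split_ordP i) => j ->.
  by under eq_fun do rewrite col_mxEu; exact: hf.
by under eq_fun do rewrite col_mxEd; exact: hg.
Qed.

Lemma vmeas_usub m n (f : T -> 'cV[R]_(m + n)) : vmeas f ->
  vmeas (fun t => usubmx (f t)).
Proof. by move=> hf i; under eq_fun do rewrite mxE; exact: hf. Qed.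

Lemma vmeas_dsub m n (f : T -> 'cV[R]_(m + n)) : vmeas f ->
  vmeas (fun t => dsubmx (f t)).
Proof. by move=> hf i; under eq_fun do rewrite mxE; exact: hf. Qed.

Lemma vmeas_mulmx m n (A : T -> 'M[R]_(m, n)) (f : T -> 'cV[R]_n) :
  (forall i j, measurable_fun setT (fun t => A t i j)) -> vmeas f ->
  vmeas (fun t => A t *m f t).
Proof.
move=> hA hf i; under eq_fun do rewrite mxE.
by apply: measurable_sum => j; exact: measurable_funM.
Qed.

Lemma vmeas_if n (c : T -> bool) (f g : T -> 'cV[R]_n) : measurable_fun setT c ->
  vmeas f -> vmeas g -> vmeas (fun t => if c t then f t else g t).
Proof.
move=> hc hf hg i.
have -> : (fun t => (if c t then f t else g t) i 0) =
    (fun t => if c t then f t i 0 else g t i 0).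
  by apply/funext => t; case: (c t).
exact: measurable_fun_ifT.
Qed.

Lemma measurable_dot n (f g : T -> 'cV[R]_n) : vmeas f -> vmeas g ->
  measurable_fun setT (fun t => dot (f t) (g t)).
Proof. by move=> hf hg; apply: measurable_sum => i; exact: measurable_funM. Qed.

Lemma measurable_l2sq n (f : T -> 'cV[R]_n) : vmeas f ->
  measurable_fun setT (fun t => l2norm (f t) ^+ 2).
Proof. by move=> hf; under eq_fun do rewrite l2sq; exact: measurable_dot. Qed.

End basic.

Lemma vmeas_comp d (T : measurableType d) d' (T' : measurableType d') n
    (h : T' -> T) (f : T -> 'cV[R]_n) :
  measurable_fun setT h -> vmeas f -> vmeas (fun t => f (h t)).
Proof. by move=> hh hf i; exact: measurableT_comp (hf i) hh. Qed.

(** Rounding to the grid of mesh 1 / (k + 1): a map with countably many values. *)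
Let grid m (k : nat) (u : 'cV[R]_m) : 'cV[R]_m :=
  \col_i ((Num.floor (k.+1%:R * u i 0))%:~R / k.+1%:R).

Let grid_near m k (u : 'cV[R]_m) : l2norm (grid k u - u) <= m%:R / k.+1%:R.
Proof.
have k0 : 0 < k.+1%:R :> R by rewrite ltr0n.
rewrite (le_trans (l2_le_sum _))//.
apply: (@le_trans _ _ (\sum_(i < m) k.+1%:R^-1)); last first.
  by rewrite sumr_const card_ord -[_^-1 *+ _]mulr_natl.
apply: ler_sum => i _; rewrite !mxE.
rewrite -(ler_pM2r k0) mulVf ?gt_eqF// -[X in _ * X](ger0_norm (ltW k0)) -normrM.
rewrite mulrBl divfK ?gt_eqF// (mulrC (u i 0)).
have := floor_itv (k.+1%:R * u i 0).
rewrite rmorphD /= => /andP[h1 h2]; rewrite ler_norml; lra.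
Qed.

(** A random function evaluated at a random point.  When [U] is rounded to a grid,
each of the countably many cells carries the measurable function [phi a (X t)] for a
fixed [a]; local Lipschitz continuity in the point makes these approximations converge
pointwise. *)
Lemma caratheodory d (T : measurableType d) d' (S : measurableType d') m
    (phi : 'cV[R]_m -> S -> R) (U : T -> 'cV[R]_m) (X : T -> S) :
  (forall u, measurable_fun setT (phi u)) ->
  (forall s u, exists K, forall v, l2norm (v - u) <= 1 ->
     `|phi v s - phi u s| <= K * l2norm (v - u)) ->
  vmeas U -> measurable_fun setT X ->
  measurable_fun setT (fun t => phi (U t) (X t)).
Proof.
move=> mphi cphi mU mX.
apply: (@measurable_fun_cvg _ _ _ _ (fun k t => phi (grid k (U t)) (X t))) => //.
- move=> k _ B mB; rewrite setTI.
  (* the part of the preimage of B where U lies in the cell a *)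
  pose A (a : {ffun 'I_m -> int}) : set T :=
    (\bigcap_(i in [set: 'I_m])
       [set t | (a i)%:~R <= k.+1%:R * U t i 0 < (a i + 1)%:~R]) `&`
    [set t | B (phi (\col_i ((a i)%:~R / k.+1%:R)) (X t))].
  rewrite [X in measurable X](_ : _ = \bigcup_a A a).
    apply: countable_bigcupT_measurable; first exact: countableP.
    move=> a; apply: measurableI.
      apply: fin_bigcap_measurable => // i _.
      have mUi : measurable_fun setT (fun t => k.+1%:R * U t i 0).
        exact: measurable_funM.
      have := mUi measurableT `[(a i)%:~R, (a i + 1)%:~R[%classic (measurable_itv _).
      rewrite setTI; congr measurable; apply/seteqP; split => t /=;
      by rewrite in_itv.
    have := measurableT_comp (mphi (\col_i ((a i)%:~R / k.+1%:R))) mX.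
    by move=> /(_ measurableT B mB); rewrite setTI.
  apply/seteqP; split => t /=.
    move=> Bt; exists [ffun i => Num.floor (k.+1%:R * U t i 0)] => //; split.
      by move=> i _ /=; rewrite ffunE; exact: floor_itv.
    move: Bt; congr (B (phi _ _)).
    by apply/matrixP => i j; rewrite !mxE ffunE.
  move=> [a _ [h Bt]]; move: Bt; congr (B (phi _ _)).
  apply/matrixP => i j; rewrite !mxE; congr (_%:~R / _).
  exact/esym/floor_def/h.
- move=> t _; apply/cvgrPdist_le => e e0.
  have [K hK] := cphi (X t) (U t).
  pose c : R := m%:R * (1 + `|K| / e).
  have c0 : 0 <= c by rewrite mulr_ge0// addr_ge0// divr_ge0// ltW.
  exists (Num.truncn c) => // k /= Nk.
  have ck : c <= k.+1%:R.
    rewrite (le_trans (ltW (truncnS_gt _)))// ler_nat ltnS.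
    exact: Nk.
  have k0 : 0 < k.+1%:R :> R by rewrite ltr0n.
  have g := grid_near k (U t).
  have hc : m%:R * (1 + `|K| / e) <= k.+1%:R by exact: ck.
  rewrite distrC (le_trans (hK _ _))//.
    rewrite (le_trans g)// ler_pdivrMr// mul1r (le_trans _ hc)//.
    by rewrite ler_peMr// lerDl divr_ge0// ltW.
  apply: (@le_trans _ _ (`|K| * (m%:R / k.+1%:R))).
    by rewrite (le_trans (ler_wpM2r _ (ler_norm K)))// ler_wpM2l.
  rewrite mulrA ler_pdivrMr//.
  have -> : `|K| * m%:R = e * (m%:R * (`|K| / e)) by field; rewrite gt_eqF.
  by rewrite ler_pM2l// (le_trans _ hc)// ler_wpM2l// lerDr.
Qed.

Lemma measurable_loclip d (T : measurableType d) m (phi : 'cV[R]_m -> R)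
    (U : T -> 'cV[R]_m) :
  (forall u, exists K, forall v, l2norm (v - u) <= 1 ->
     `|phi v - phi u| <= K * l2norm (v - u)) ->
  vmeas U -> measurable_fun setT (fun t => phi (U t)).
Proof.
move=> cphi mU.
apply: (@caratheodory _ _ _ T _ (fun u _ => phi u) U id) => //.
Qed.

Lemma vmeas_lipschitz d (T : measurableType d) m n (h : 'cV[R]_m -> 'cV[R]_n) L
    (U : T -> 'cV[R]_m) : lipschitz_vec L h -> vmeas U -> vmeas (fun t => h (U t)).
Proof.
move=> hL mU i; apply: (measurable_loclip (phi := fun u => h u i 0)) => // u.
exists L => v _; apply: le_trans (hL v u).
by have := l2_coord (h v - h u) i; rewrite !mxE.
Qed.

End vector_measurability.

(** * Integrals, means and second moments *)

Section integral_tools.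
Context {R : realType} {d} {T : measurableType d} (Q : probability T R).
Local Open Scope ereal_scope.

(** The integral of a nonnegative function is a supremum over the simple functions
below it, and this set grows with the function. *)
Lemma integral_mono (f g : T -> \bar R) : (forall t, 0 <= f t) ->
  (forall t, f t <= g t) -> \int[Q]_t f t <= \int[Q]_t g t.
Proof.
move=> f0 fg; have g0 t : 0 <= g t by exact: le_trans (fg t).
rewrite !ge0_integralTE//; apply: ge_ereal_sup => _ /= [h hf <-].
by apply: ereal_sup_ubound => /=; exists h => // t; exact: le_trans (fg t).
Qed.

Lemma integral_cst1 (c : R) : \int[Q]_t c%:E = c%:E.
Proof. by rewrite integral_cst//= probability_setT mule1. Qed.

Lemma ge0_integralD_fin (f g : T -> R) : (forall t, (0 <= f t)%R) ->
  (forall t, (0 <= g t)%R) -> measurable_fun setT f -> measurable_fun setT g ->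
  \int[Q]_t (f t + g t)%:E = \int[Q]_t (f t)%:E + \int[Q]_t (g t)%:E.
Proof.
move=> f0 g0 mf mg; rewrite -ge0_integralD//.
- by move=> t _; rewrite lee_fin.
- exact/measurable_EFinP.
- by move=> t _; rewrite lee_fin.
- exact/measurable_EFinP.
Qed.

Lemma ge0_integralZl_fin (k : R) (f : T -> R) : (0 <= k)%R ->
  (forall t, (0 <= f t)%R) -> measurable_fun setT f ->
  \int[Q]_t (k * f t)%:E = k%:E * \int[Q]_t (f t)%:E.
Proof.
move=> k0 f0 mf; rewrite -ge0_integralZl//.
- exact/measurable_EFinP.
- by move=> t _; rewrite lee_fin.
Qed.

Lemma integral_ite (e : T -> bool) (p a b : R) : measurable_fun setT e ->
  Q (e @^-1` [set true]) = p%:E -> (0 <= a)%R -> (0 <= b)%R ->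
  \int[Q]_t (if e t then a else b)%:E = (p * a + (1 - p) * b)%:E.
Proof.
move=> me pe a0 b0; set E := e @^-1` [set true] in pe.
have mE : measurable E by rewrite -[E]setTI; exact: me.
have E1 : Q (~` E) = (1 - p)%:E by rewrite probability_setC// pe.
transitivity (\int[Q]_t (a * \1_E t + b * \1_(~` E) t)%:E).
  apply: eq_integral => t _; rewrite !indicE; case: ifPn => et.
    by rewrite mem_set//= memNset ?mulr1 ?mulr0 ?addr0//; exact.
  rewrite memNset ?mem_set//= ?mulr1 ?mulr0 ?add0r//; exact/negP.
rewrite ge0_integralD_fin//; last 4 first.
- by move=> t; rewrite mulr_ge0.
- by move=> t; rewrite mulr_ge0.
- by apply: measurable_funM => //; exact: measurable_indic.
- by apply: measurable_funM => //; apply: measurable_indic; exact: measurableC.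
have mi A : measurable A -> measurable_fun setT (\1_A : T -> R).
  by move=> mA; exact: measurable_indic.
have mEC := measurableC mE.
rewrite !ge0_integralZl_fin//.
rewrite !integral_indic//.
rewrite !setIT; transitivity (a%:E * p%:E + b%:E * (1 - p)%:E).
  by congr (_ * _ + _ * _).
by rewrite -!EFinM -EFinD mulrC (mulrC b).
Qed.

Lemma has_mean_measurable (X : T -> R) m : has_mean Q X m -> measurable_fun setT X.
Proof. by move=> [/integrableP[/measurable_EFinP]]. Qed.

Lemma has_mean_vmeas n (h : T -> 'cV[R]_n) m : has_mean_mx Q h m -> vmeas h.
Proof. by move=> hm i; exact: has_mean_measurable (hm i 0%R). Qed.

Lemma has_mean_int (X : T -> R) m : has_mean Q X m -> \int[Q]_t (X t)%:E = m%:E.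
Proof. by move=> [_]; rewrite unlock. Qed.

Lemma has_meanE (X : T -> R) m : Q.-integrable setT (EFin \o X) ->
  \int[Q]_t (X t)%:E = m%:E -> has_mean Q X m.
Proof. by move=> h1 h2; split=> //; rewrite unlock. Qed.

Lemma has_mean_lin (X Y : T -> R) m m' (a b : R) : has_mean Q X m ->
  has_mean Q Y m' -> has_mean Q (fun t => a * X t + b * Y t)%R (a * m + b * m')%R.
Proof.
move=> hX hY; have [iX _] := hX; have [iY _] := hY.
have iaX := integrableZl measurableT a iX.
have ibY := integrableZl measurableT b iY.
apply: has_meanE.
  by have := integrableD measurableT iaX ibY.
transitivity (\int[Q]_t (a%:E * (X t)%:E + b%:E * (Y t)%:E)) => //.
rewrite integralD// !integralZl//.
by rewrite (has_mean_int hX) (has_mean_int hY).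
Qed.

Lemma has_mean_cst (c : R) : has_mean Q (fun=> c) c.
Proof.
apply: has_meanE; last exact: integral_cst1.
exact: finite_measure_integrable_cst.
Qed.

Lemma has_mean_sum (J : Type) (r : seq J) (X : J -> T -> R) (m : J -> R) :
  (forall j, has_mean Q (X j) (m j)) ->
  has_mean Q (fun t => \sum_(j <- r) X j t)%R (\sum_(j <- r) m j)%R.
Proof.
move=> h; elim: r => [|j r ih].
  by under eq_fun do rewrite big_nil; rewrite big_nil; exact: has_mean_cst.
under eq_fun do rewrite big_cons; rewrite big_cons.
have := has_mean_lin 1%R 1%R (h j) ih; rewrite !mul1r.
by under eq_fun do rewrite !mul1r.
Qed.

(** The cross term 2 <M, h> has mean zero. *)
Lemma second_moment n (M : 'cV[R]_n) (h : T -> 'cV[R]_n) (q : R) :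
  has_mean_mx Q h 0%R -> \int[Q]_t (l2norm (h t) ^+ 2)%:E <= q%:E ->
  \int[Q]_t (l2norm (M + h t) ^+ 2)%:E <= (l2norm M ^+ 2 + q)%:E.
Proof.
move=> hm hq.
have mh := has_mean_vmeas hm.
have ih : Q.-integrable setT (fun t => (l2norm (h t) ^+ 2)%:E).
  apply/integrableP; split; first exact/measurable_EFinP/measurable_l2sq.
  under eq_integral do rewrite gee0_abs ?lee_fin ?sqr_ge0//.
  by rewrite (le_lt_trans hq)// ltry.
have hd : has_mean Q (fun t => \sum_(i <- index_enum 'I_n) (M i 0 * h t i 0)%R)%R
    (\sum_(i <- index_enum 'I_n) 0%R)%R.
  apply: has_mean_sum => i; have := has_mean_lin (M i 0%R) 0%R (hm i 0%R) (has_mean_cst 0%R).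
  rewrite mxE !mulr0 addr0.
  by under eq_fun do rewrite addr0.
rewrite big1// in hd.
have hd2 := has_mean_lin 1%R 2%R (has_mean_cst (l2norm M ^+ 2)) hd.
rewrite mulr0 addr0 mul1r in hd2.
have {}hd2 : has_mean Q (fun t => l2norm M ^+ 2 + 2 * dot M (h t))%R
    (l2norm M ^+ 2)%R by exact: hd2.
under eq_integral do rewrite l2sqD EFinD.
have [hi _] := hd2.
rewrite integralD//= EFinD; apply: leeD => //.
by rewrite -(has_mean_int hd2).
Qed.

End integral_tools.

(** * Variance of batches of fresh draws *)

Section fresh.
Context {R : realType} {d : measure_display} {Omega : measurableType d}.
Context (P : probability Omega R) {I : Type} (sys : I -> set (set Omega)).
Hypothesis sys_sigma : forall i, sigma_algebra setT (sys i).
Hypothesis sys_meas : forall i, sys i `<=` measurable.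
Hypothesis sys_ind : mutually_independent P sys.

Local Notation history := (history sys).

Record is_draw {d'} {S : measurableType d'} (Q : probability S R) (i : I)
    (X : Omega -> S) : Prop := IsDraw {
  draw_events_sys : forall A, measurable A -> sys i (X @^-1` A);
  draw_law : forall A, measurable A -> P (X @^-1` A) = Q A }.

Lemma draw_measurable d' (S : measurableType d') (Q : probability S R) i X D :
  is_draw Q i X -> D i -> measurable_fun setT (X : history D -> S).
Proof.
move=> [sX _] Di _ A mA; rewrite setTI.
by apply: sub_gen_smallest; apply: (@sub_cylinders _ _ _ sys sys_sigma i D) => //; exact: sX.
Qed.

Lemma draw_measurableT d' (S : measurableType d') (Q : probability S R) i X :
  is_draw Q i X -> measurable_fun setT X.
Proof.
by move=> [sX _] _ A mA; rewrite setTI; apply: (sys_meas (i := i)); exact: sX.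
Qed.

Lemma vmeas_historyS D D' (DD' : D `<=` D') n (f : Omega -> 'cV[R]_n) :
  vmeas (f : history D -> _) -> vmeas (f : history D' -> _).
Proof. by move=> hf i; exact: (measurable_historyS DD') (hf i). Qed.

Lemma vmeas_history D n (f : Omega -> 'cV[R]_n) :
  vmeas (f : history D -> _) -> vmeas f.
Proof. by move=> hf i; exact: (measurable_history sys_meas) (hf i). Qed.

Section step.
Context {d'} {S : measurableType d'} (Q : probability S R) (n : nat).
Variables (D : set I) (N : Omega -> S -> 'cV[R]_n) (q : Omega -> R).
Hypothesis mN : vmeas (fun t : history D * S => N t.1 t.2).
Hypothesis N0 : forall w, has_mean_mx Q (N w) 0.
Hypothesis Nq : forall w, (\int[Q]_s (l2norm (N w s) ^+ 2)%:E <= (q w)%:E)%E.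
Hypothesis mq : measurable_fun setT (q : history D -> R).

Lemma fresh_bound_ge0 w : 0 <= q w.
Proof.
rewrite -lee_fin (le_trans _ (Nq w))//; apply: integral_ge0 => s _.
by rewrite lee_fin sqr_ge0.
Qed.

(** With the past frozen the noise [N w (X w)] is centred, and [second_moment]
applies inside the integral.  [D] is the history that determines the law of the noise,
[D'] the larger one on which [M] may depend. *)
Lemma fresh_step D' i X (M : Omega -> 'cV[R]_n) : D `<=` D' -> ~ D' i ->
  is_draw Q i X -> vmeas (M : history D' -> _) ->
  (\int[P]_w (l2norm (M w + N w (X w)) ^+ 2)%:E <=
   \int[P]_w (l2norm (M w) ^+ 2)%:E + \int[P]_w (q w)%:E)%E.
Proof.
move=> DD' nDi dX mM.
have mD : measurable_fun setT (id : history D' -> history D).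
  exact: (measurable_historyS (T := history D) (f := id) DD' (@measurable_id _ (history D) setT)).
have mh : measurable_fun setT (fun t : history D' * S => ((t.1 : history D), t.2)).
  apply: measurable_fun_pair; last exact: measurable_snd.
  exact: measurableT_comp mD measurable_fst.
have mN' : vmeas (fun t : history D' * S => N t.1 t.2).
  exact: (vmeas_comp mh mN).
have mM' : vmeas (fun t : history D' * S => M t.1).
  exact: (vmeas_comp measurable_fst mM).
have mphi : measurable_fun setT
    (fun t : history D' * S => (l2norm (M t.1 + N t.1 t.2) ^+ 2)%:E).
  by apply/measurable_EFinP/measurable_l2sq; exact: vmeasD.
have [sX lX] := dX.
rewrite (fresh_draw sys_sigma sys_meas sys_ind nDi (draw_measurableT dX) sX lX mphi); last first.
  by move=> t; rewrite lee_fin sqr_ge0.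
have mMM : measurable_fun setT (fun w => l2norm (M w) ^+ 2).
  by apply: measurable_l2sq; exact: vmeas_history mM.
rewrite -ge0_integralD_fin//.
- apply: integral_mono => w.
    by apply: integral_ge0 => s _; rewrite lee_fin sqr_ge0.
  exact: (second_moment (M w) (N0 w) (Nq w)).
- by move=> w; exact: sqr_ge0.
- exact: fresh_bound_ge0.
- exact: (measurable_history sys_meas mq).
Qed.

Lemma vmeas_fresh D' i X : D `<=` D' -> D' i -> is_draw Q i X ->
  vmeas (fun w : history D' => N w (X w)).
Proof.
move=> DD' Di dX.
have mh : measurable_fun setT (fun w : history D' => ((w : history D), X w)).
  apply: measurable_fun_pair.
    exact: (measurable_historyS (T := history D) (f := id) DD' (@measurable_id _ (history D) setT)).
  exact: draw_measurable dX Di.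
exact: (vmeas_comp mh mN).
Qed.

Lemma vmeas_batch D' (idx : nat -> I) (X : nat -> Omega -> S) k :
  D `<=` D' -> (forall j, D' (idx j)) -> (forall j, is_draw Q (idx j) (X j)) ->
  vmeas (fun w : history D' => \sum_(j < k) N w (X j w)).
Proof.
move=> DD' D'i dX; apply: vmeas_sum => j.
exact: (vmeas_fresh DD' (D'i j) (dX j)).
Qed.

(** The draws are added one at a time, each of them being fresh with respect to
the history enlarged by the previous ones. *)
Lemma fresh_batch D' (idx : nat -> I) (X : nat -> Omega -> S)
    (M : Omega -> 'cV[R]_n) k : D `<=` D' ->
  (forall j, ~ D' (idx j)) -> injective idx ->
  (forall j, is_draw Q (idx j) (X j)) -> vmeas (M : history D' -> _) ->
  (\int[P]_w (l2norm (M w + \sum_(j < k) N w (X j w)) ^+ 2)%:E <=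
   \int[P]_w (l2norm (M w) ^+ 2)%:E + k%:R%:E * \int[P]_w (q w)%:E)%E.
Proof.
move=> DD' nD' inj dX mM; elim: k => [|k ih].
  rewrite mul0e adde0; under eq_integral do rewrite big_ord0 addr0.
  by [].
pose Dk := D' `|` [set i | exists2 j, (j < k)%N & i = idx j].
have D'k : D' `<=` Dk by move=> i ?; left.
have nDk : ~ Dk (idx k).
  by move=> [/nD'//|[j jk /inj kj]]; move: jk; rewrite kj ltnn.
have mMk : vmeas (fun w : history Dk => M w + \sum_(j < k) N w (X j w)).
  apply: vmeasD; first exact: vmeas_historyS mM.
  apply: vmeas_sum => j; apply: (vmeas_fresh _ _ (dX j)).
    exact: subset_trans D'k.
  by right; exists j.
have := fresh_step (subset_trans DD' D'k) nDk (dX k) mMk.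
under eq_integral do rewrite -addrA -(big_ord_recr k (fun j => N _ (X j _))) /=.
set q' := (\int[P]_w (q w)%:E)%E in ih *.
move=> h; rewrite (le_trans h)// -natr1 EFinD.
rewrite ge0_muleDl//.
by rewrite mul1e [leRHS]addeA leeD2r.
Qed.

End step.

(** The coin is integrated out last: the two branches may depend on all the other
draws, including the samples of the same iteration. *)
Lemma coin_split d' (S : measurableType d') (Q : probability S R) D i X
    (e : S -> bool) p (A B : Omega -> R) : ~ D i -> is_draw Q i X ->
  measurable_fun setT e -> P ((e \o X) @^-1` [set true]) = p%:E -> 0 <= p <= 1 ->
  measurable_fun setT (A : history D -> R) -> measurable_fun setT (B : history D -> R) ->
  (forall w, 0 <= A w) -> (forall w, 0 <= B w) ->
  (\int[P]_w (if e (X w) then A w else B w)%:E =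
   p%:E * \int[P]_w (A w)%:E + (1 - p)%:E * \int[P]_w (B w)%:E)%E.
Proof.
move=> nDi dX me pe /andP[p0 p1] mA mB A0 B0.
have [sX lX] := dX.
have q0 : 0 <= 1 - p by rewrite subr_ge0.
pose phi (t : history D * S) := (if e t.2 then A t.1 else B t.1)%:E.
have mphi : measurable_fun setT phi.
  apply/measurable_EFinP; apply: measurable_fun_ifT.
  - exact: measurableT_comp me measurable_snd.
  - exact: measurableT_comp mA measurable_fst.
  - exact: measurableT_comp mB measurable_fst.
rewrite (fresh_draw sys_sigma sys_meas sys_ind nDi (draw_measurableT dX) sX lX mphi); last first.
  by move=> t; rewrite /phi lee_fin; case: ifP.
have pQ : Q (e @^-1` [set true]) = p%:E.
  rewrite -pe -lX//; rewrite -[X in measurable X]setTI; exact: me.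
under eq_integral do rewrite (integral_ite me pQ (A0 _) (B0 _)).
have mA' := measurable_history sys_meas mA.
have mB' := measurable_history sys_meas mB.
rewrite ge0_integralD_fin ?ge0_integralZl_fin//.
- by move=> w; exact: mulr_ge0.
- by move=> w; exact: mulr_ge0.
- exact: measurable_funM.
- exact: measurable_funM.
Qed.

End fresh.

(** * Taylor bounds and symmetry of the Hessian *)

Section calculus.
Context {R : realType} {n : nat}.
Implicit Types (h : 'cV[R]_n -> R) (w k : 'cV[R]_n).

Lemma diff_dot h w k : differentiable h w -> 'd h w k = dot (grad h w) k.
Proof.
move=> dh.
have {1}-> : k = \sum_i k i 0 *: (delta_mx i 0 : 'cV[R]_n).
  apply/matrixP => i j; rewrite (ord1 j) summxE (bigD1 i)//= big1 => [|l li].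
    by rewrite addr0 !mxE !eqxx mulr1.
  by rewrite !mxE eq_sym (negPf li) mulr0.
rewrite linear_sum; apply: eq_bigr => i _.
by rewrite linearZ /= -deriveE// mxE mulrC.
Qed.

Lemma is_derive_line h w k (t : R) : differentiable h (w + t *: k) ->
  is_derive t 1 (fun s => h (w + s *: k)) (dot (grad h (w + t *: k)) k).
Proof.
move=> dh.
have e : (fun s => s^-1 *: (((fun s => h (w + s *: k)) \o shift t) (s *: 1) -
     h (w + t *: k))) =
   (fun s => s^-1 *: ((h \o shift (w + t *: k)) (s *: k) - h (w + t *: k))).
  apply/funext => s /=; congr (_ *: (h _ - _)).
  by rewrite [s *: 1]mulr1 scalerDl addrCA addrA addrC.
rewrite -diff_dot// -deriveE//; split.
  rewrite /derivable e; exact: diff_derivable.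
by rewrite /derive e.
Qed.

Lemma line_mvt (phi dphi : R -> R) : (forall t : R, is_derive t 1 phi (dphi t)) ->
  exists2 t, 0 <= t <= 1 & phi 1 - phi 0 = dphi t.
Proof.
move=> dp.
have cp : {within `[0, 1], continuous phi}.
  apply: derivable_within_continuous => t _; exact: (@ex_derive _ _ _ _ _ _ _ (dp t)).
have [t t01 e] := @MVT R phi dphi 0 1 ltr01 (fun t _ => dp t) cp.
exists t; last by rewrite e subr0 mulr1.
by move: t01; rewrite in_itv/= => /andP[? ?]; rewrite !ltW.
Qed.

Lemma grad_mvt h w k : differentiable_everywhere h ->
  exists2 t, 0 <= t <= 1 & h (w + k) - h w = dot (grad h (w + t *: k)) k.
Proof.
move=> dh; have [t t01] := line_mvt (fun t => is_derive_line (w := w) (k := k) (dh _)).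
by rewrite scale1r scale0r addr0 => e; exists t.
Qed.

(** The intermediate point depends on the direction [a]: the mean value theorem
holds for scalar functions only, which is why Taylor bounds on the gradient are
stated after pairing with a test vector. *)
Lemma hess_mvt h w k : twice_differentiable h -> forall a : 'cV[R]_n,
  exists2 t, 0 <= t <= 1 &
    dot a (grad h (w + k) - grad h w) = dot a (hess h (w + t *: k) *m k).
Proof.
move=> [dh d2h] a.
pose D i (v : 'cV[R]_n) := 'D_(delta_mx i 0) h v.
have dD i v : differentiable (D i) v.
  have -> : D i = (fun u => grad h u i 0).
    by apply/funext => u; rewrite mxE.
  apply: (@differentiable_comp _ _ _ _ (grad h) (fun M : 'cV[R]_n => M i 0)) => //.
  exact: differentiable_coord.
pose phi t := \sum_i a i 0 * D i (w + t *: k).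
have dphi (t : R) : is_derive t 1 phi (dot a (hess h (w + t *: k) *m k)).
  have -> : phi = \sum_i (a i 0 *: (fun t => D i (w + t *: k)) : R -> R).
    by apply/funext => s; rewrite /phi fct_sumE.
  have -> : dot a (hess h (w + t *: k) *m k) =
      \sum_i a i 0 *: dot (grad (D i) (w + t *: k)) k.
    apply: eq_bigr => i _; congr (_ * _); rewrite mxE; apply: eq_bigr => j _.
    by rewrite !mxE.
  apply: is_derive_sum => i; apply: is_deriveZ; exact: is_derive_line.
have [t t01 e] := line_mvt dphi; exists t => //.
rewrite -e /phi scale1r scale0r addr0 dotBr.
by congr (_ - _); apply: eq_bigr => i _; rewrite mxE.
Qed.

Lemma taylor1 h (L : R) w k : 0 <= L -> differentiable_everywhere h ->
  lipschitz_vec L (grad h) ->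
  `|h (w + k) - h w - dot (grad h w) k| <= L * l2norm k ^+ 2.
Proof.
move=> L0 dh hL; have [t /andP[t0 t1] ->] := grad_mvt w k dh.
rewrite -dotBl (le_trans (dot_le_norm _ _))// expr2 mulrA ler_wpM2r//.
rewrite (le_trans (hL _ _))// [w + _]addrC addrK l2Z ger0_norm//.
by rewrite ler_wpM2l// ler_piMl.
Qed.

Lemma taylor2 h (L : R) (a : 'cV[R]_n) w k : 0 <= L -> twice_differentiable h ->
  lipschitz_mx L (hess h) ->
  `|dot a (grad h (w + k) - grad h w - hess h w *m k)| <=
    L * l2norm a * l2norm k ^+ 2.
Proof.
move=> L0 dh hL; have [t /andP[t0 t1]] := hess_mvt w k dh a.
move=> e; rewrite [dot a (_ - _ *m _)]dotBr e -dotBr -mulmxBl.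
rewrite (le_trans (dot_le_norm _ _))// [leLHS]mulrC mulrAC ler_wpM2r//.
rewrite (le_trans (opnormP _ _))// expr2 mulrA ler_wpM2r//.
rewrite (le_trans (hL _ _))// [w + _]addrC addrK l2Z ger0_norm//.
by rewrite ler_wpM2l// ler_piMl.
Qed.

(** Compare, along t k, the expansion of the gradient with its Lipschitz bound,
and let t tend to 0. *)
Lemma hess_dot_le h (L L' : R) w (a k : 'cV[R]_n) : 0 <= L' -> twice_differentiable h ->
  lipschitz_vec L (grad h) -> lipschitz_mx L' (hess h) ->
  dot a (hess h w *m k) <= L * l2norm a * l2norm k.
Proof.
move=> L0 dh hL hL'.
apply: (@ler_limit0 _ _ _ (L' * l2norm a * l2norm k ^+ 2)) => t /andP[t0 t1].
have := taylor2 a w (t *: k) L0 dh hL'.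
rewrite dotBr -scalemxAr dotZr l2Z (gtr0_norm t0) => h1.
have h2 := dot_le_norm a (grad h (w + t *: k) - grad h w).
have := hL (w + t *: k) w; rewrite [w + _]addrC addrK l2Z (gtr0_norm t0) => h3.
rewrite addrC in h3.
have h4 := ler_wpM2l (l2_ge0 a) h3.
have {}h2 := le_trans h2 h4.
move: h1 h2; rewrite !ler_norml => /andP[h1 _] /andP[_ h2].
rewrite -(ler_pM2l t0); move: h1 h2; set X := dot a (_ - _); nra.
Qed.

Lemma hess_bound h (L L' : R) w k : 0 <= L -> 0 <= L' -> twice_differentiable h ->
  lipschitz_vec L (grad h) -> lipschitz_mx L' (hess h) ->
  l2norm (hess h w *m k) <= L * l2norm k.
Proof.
move=> L0 L'0 dh hL hL'; apply: l2_le_dual; first by rewrite mulr_ge0.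
by move=> a; rewrite mulrAC; exact: hess_dot_le hL hL'.
Qed.

(** Schwarz's theorem: the second difference of [h] along t u and t v is symmetric
in [u] and [v], and equals t^2 <u, hess h w v> up to O(t^3). *)
Lemma hess_sym h (L : R) w (a k : 'cV[R]_n) : 0 <= L -> twice_differentiable h ->
  lipschitz_mx L (hess h) -> dot a (hess h w *m k) = dot k (hess h w *m a).
Proof.
move=> L0 dh hL.
suff H u v : dot u (hess h w *m v) <= dot v (hess h w *m u).
  by apply/eqP; rewrite eq_le !H.
(* bounds on the two Taylor remainders of the gradient, at t (s u + v) and at t s u *)
pose c (u v : 'cV[R]_n) := L * l2norm u * (l2norm u + l2norm v) ^+ 2 +
  L * l2norm u * l2norm u ^+ 2.
pose q (t : R) (u v : 'cV[R]_n) :=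
  h (w + t *: u + t *: v) - h (w + t *: u) - (h (w + t *: v) - h w).
have qC t (x y : 'cV[R]_n) : q t x y = q t y x.
  by rewrite /q -!addrA [t *: x + t *: y]addrC; ring.
have qE t (x y : 'cV[R]_n) : 0 < t -> `|q t x y - t ^+ 2 * dot x (hess h w *m y)| <= c x y * t ^+ 3.
  move=> t0.
  pose phi (s : R) := h (w + t *: y + s *: (t *: x)) - h (w + s *: (t *: x)).
  pose dphi (s : R) := dot (grad h (w + t *: y + s *: (t *: x))) (t *: x) -
     dot (grad h (w + s *: (t *: x))) (t *: x).
  have [dh1 _] := dh.
  have dp (s : R) : is_derive s 1 phi (dphi s).
    by apply: is_deriveB; exact: is_derive_line.
  have [s /andP[s0 s1]] := line_mvt dp.
  have -> : phi 1 - phi 0 = q t x y.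
    by rewrite /phi /q !scale1r !scale0r !addr0 [w + t *: y + _]addrAC; ring.
  move=> ->; rewrite /dphi -dotBl dotZr dotC.
  set W := w + s *: (t *: x).
  have -> : w + t *: y + s *: (t *: x) = w + (s *: (t *: x) + t *: y).
    by rewrite -addrA [t *: y + _]addrC.
  have h1 := taylor2 x w (s *: (t *: x) + t *: y) L0 dh hL.
  have h2 := taylor2 x w (s *: (t *: x)) L0 dh hL.
  have -> : t * dot x (grad h (w + (s *: (t *: x) + t *: y)) - grad h W) -
      t ^+ 2 * dot x (hess h w *m y) =
    t * (dot x (grad h (w + (s *: (t *: x) + t *: y)) - grad h w -
         hess h w *m (s *: (t *: x) + t *: y)) -
       dot x (grad h W - grad h w - hess h w *m (s *: (t *: x)))).
    by rewrite mulmxDr -!scalemxAr !(dotNr, dotDr, dotZr); ring.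
  rewrite normrM gtr0_norm// exprS mulrCA ler_pM2l//.
  rewrite (le_trans (ler_normB _ _))// (le_trans (lerD h1 h2))//.
  have n1 : l2norm (s *: (t *: x)) <= t * l2norm x.
    rewrite !l2Z (ger0_norm s0) (gtr0_norm t0) ler_piMl// mulr_ge0// ltW//.
  have n2 : l2norm (s *: (t *: x) + t *: y) <= t * (l2norm x + l2norm y).
    by rewrite (le_trans (l2D _ _))// mulrDr lerD// l2Z gtr0_norm.
  have Lx : 0 <= L * l2norm x by rewrite mulr_ge0.
  have e1 : l2norm (s *: (t *: x) + t *: y) ^+ 2 <= (t * (l2norm x + l2norm y)) ^+ 2.
    by rewrite lerXn2r ?nnegrE// mulr_ge0 ?addr_ge0// ltW.
  have e2 : l2norm (s *: (t *: x)) ^+ 2 <= (t * l2norm x) ^+ 2.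
    by rewrite lerXn2r ?nnegrE// mulr_ge0// ltW.
  rewrite (le_trans (lerD (ler_wpM2l Lx e1) (ler_wpM2l Lx e2)))//.
  by rewrite le_eqVlt; apply/orP; left; apply/eqP; rewrite /c; ring.
apply: (@ler_limit0 _ _ _ (c u v + c v u)) => t /andP[t0 _].
have t2 : 0 < t ^+ 2 by rewrite exprn_gt0.
have h1 := qE t u v t0; have := qE t v u t0; rewrite -(qC t u v) => h2.
rewrite -(ler_pM2l t2).
move: h1 h2; rewrite !ler_norml => /andP[h1 h1'] /andP[h2 h2'].
have -> : t ^+ 2 * (dot v (hess h w *m u) + (c u v + c v u) * t) =
  t ^+ 2 * dot v (hess h w *m u) + c u v * t ^+ 3 + c v u * t ^+ 3 by ring.
lra.
Qed.

End calculus.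

(** * Functions with a quadratic first-order remainder *)

Section quadratic_approximation.
Context {R : realType} {n : nat}.
Variables (h : 'cV[R]_n -> R) (dh : 'cV[R]_n -> 'cV[R]_n) (L : R).
Hypothesis L0 : 0 <= L.
Hypothesis hT : forall y k, `|h (y + k) - h y - dot (dh y) k| <= L * l2norm k ^+ 2.

Lemma quad_ub y k : h (y + k) <= h y + dot (dh y) k + L * l2norm k ^+ 2.
Proof. by have := hT y k; rewrite ler_norml => /andP[_]; lra. Qed.

Lemma quad_lb y k : h y + dot (dh y) k - L * l2norm k ^+ 2 <= h (y + k).
Proof. by have := hT y k; rewrite ler_norml => /andP[+ _]; lra. Qed.

Lemma quad_loclip u : exists K, forall v, l2norm (v - u) <= 1 ->
  `|h v - h u| <= K * l2norm (v - u).
Proof.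
exists (l2norm (dh u) + L) => v vu.
have := hT u (v - u); rewrite [u + _]addrC subrK => h1.
have h2 := dot_le_norm (dh u) (v - u).
have -> : h v - h u = (h v - h u - dot (dh u) (v - u)) + dot (dh u) (v - u).
  by rewrite subrK.
rewrite (le_trans (ler_normD _ _))// (le_trans (lerD h1 h2))// mulrDl addrC.
by rewrite lerD2l ler_wpM2l// expr2 ler_piMl.
Qed.

(** A quadratic remainder determines all the partial derivatives. *)
Lemma quad_grad y : grad h y = dh y.
Proof.
apply/matrixP => i j; rewrite (ord1 j) mxE -dot_delta dotC.
set v := delta_mx i 0; apply: cvg_lim => //.
apply/cvgrPdist_le => e e0.
pose c := L * l2norm v ^+ 2 + 1.
have c0 : 0 < c by rewrite ltr_wpDl// mulr_ge0// sqr_ge0.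
exists (e / c) => /=; first by rewrite divr_gt0.
move=> t /=; rewrite sub0r normrN => te t0.
have t0' : 0 < `|t| by rewrite normr_gt0.
have := hT y (t *: v); rewrite l2Z dotZr exprMn real_normK ?num_real// => h1.
rewrite [t *: v + _]addrC.
have -> : dot (dh y) v - t^-1 *: (h (y + t *: v) - h y) =
  - (t^-1 * (h (y + t *: v) - h y - t * dot (dh y) v)).
  by rewrite /GRing.scale/=; field.
rewrite normrN normrM normfV -(ler_pM2l t0') mulrA mulfV ?gt_eqF// mul1r.
rewrite (le_trans h1)//.
have -> : t ^+ 2 = `|t| ^+ 2 by rewrite real_normK ?num_real.
rewrite expr2 mulrCA -mulrA ler_pM2l//.
have : `|t| * c <= e by rewrite -ler_pdivlMr// ltW.
by rewrite /c mulrDr mulr1; have := normr_ge0 t; lra.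
Qed.

(** Step from the minimizer in the direction of minus the gradient. *)
Lemma min_grad0 y : (forall y', h y <= h y') -> dh y = 0.
Proof.
move=> ymin; apply: dot_eq0; apply/eqP; rewrite eq_le dot_ge0 andbT.
apply: (@ler_limit0 _ _ _ (L * l2norm (dh y) ^+ 2)) => t /andP[t0 _].
have := quad_ub y (- t *: dh y); rewrite dotZr l2Z normrN (gtr0_norm t0).
move=> h1; have := le_trans (ymin _) h1.
rewrite add0r -(ler_pM2l t0 (dot _ _)); set d := dot _ _; set l := l2norm _; lra.
Qed.

Variable mu : R.
Hypothesis mu0 : 0 < mu.
Hypothesis sc : strongly_convex mu h.

(** Strong convexity on the segment from [w] to [v], to first order at [w]. *)
Lemma sc_first_order v w :
  h w + dot (dh w) (v - w) + mu / 2 * l2norm (v - w) ^+ 2 <= h v.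
Proof.
set k := v - w.
apply: (@ler_limit0 _ _ _ ((L + mu / 2) * l2norm k ^+ 2)) => t /andP[t0 t1].
have := @sc v w t; rewrite (ltW t0) t1 => /(_ isT).
have -> : t *: v + (1 - t) *: w = w + t *: k.
  by rewrite /k scalerBl scale1r scalerBr addrCA addrA addrC.
have := quad_lb w (t *: k); rewrite dotZr l2Z (gtr0_norm t0) => h1 h2.
have := le_trans h1 h2; rewrite -/k => h3.
rewrite -(ler_pM2l t0); move: h3; set d := dot _ _; set l := l2norm _; nra.
Qed.

Lemma sc_monotone v w :
  mu * l2norm (v - w) ^+ 2 <= dot (dh v - dh w) (v - w).
Proof.
have h1 := sc_first_order v w; have h2 := sc_first_order w v.
rewrite dotBl; have -> : dot (dh v) (v - w) = - dot (dh v) (w - v).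
  by rewrite -dotNr opprB.
rewrite (l2C w) in h2; lra.
Qed.

Let ht (r : 'rV[R]_n) := h r^T.

Let ht_continuous : continuous ht.
Proof.
move=> r; apply/(@cvgrPdist_le _ _ _ (nbhs r) (nbhs_filter r)) => e e0.
have [K hK] := quad_loclip r^T.
pose c := (n%:R + 1) * (1 + `|K| / e).
have n1 : 0 < n%:R + 1 :> R by rewrite ltr_wpDl.
have c1 : 0 <= `|K| / e by rewrite divr_ge0// ltW.
have c0 : 0 < c by rewrite mulr_gt0// ltr_pwDl.
apply/nbhs_ballP; exists (c^-1) => /=; first by rewrite invr_gt0.
move=> v [_ rv].
have d : l2norm (v^T - r^T) <= (1 + `|K| / e)^-1.
  rewrite (le_trans (l2_le_sum _))//.
  apply: (@le_trans _ _ (\sum_(i < n) c^-1)).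
    apply: ler_sum => i _; rewrite !mxE distrC ltW//; exact: rv.
  rewrite sumr_const card_ord /c invfM -[X in X <= _]mulr_natl mulrA.
  rewrite ler_piMl ?invr_ge0 ?addr_ge0//.
  by rewrite ler_pdivrMr// mul1r lerDl.
have d1 : l2norm (v^T - r^T) <= 1.
  by rewrite (le_trans d)// invf_le1 ?lerDl// ltr_pwDl.
rewrite distrC (le_trans (hK _ d1))//.
rewrite (le_trans (ler_wpM2r _ (ler_norm K)))//.
rewrite (le_trans (ler_wpM2l _ d))//.
rewrite ler_pdivrMr ?ltr_pwDl// mulrDr mulr1.
have -> : e * (`|K| / e) = `|K| by field; rewrite gt_eqF.
by rewrite lerDr ltW.
Qed.

(** Outside a large cube strong convexity forces h y >= h 0, so a minimum over that
compact cube is global. *)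
Lemma sc_min_exists : exists y, forall y', h y <= h y'.
Proof.
(* beyond this radius the quadratic term of sc_first_order dominates the linear one *)
pose M := 2 * l2norm (dh 0) / mu + 1.
have M0 : 0 <= M by rewrite addr_ge0// divr_ge0 ?mulr_ge0// ltW.
pose A : set 'rV[R]_n := [set v | forall i, `[- M, M]%classic (v ord0 i)].
have A0 : A 0 by move=> i /=; rewrite mxE in_itv/= oppr_le0 M0.
have cA : compact A.
  apply: (@rV_compact _ _ (fun=> `[(- M), M]%classic)).
  by move=> _; exact: segment_compact.
have [] := @EVT_min_rV R n ht A _ cA.
- by exists 0.
- exact: continuous_subspaceT ht_continuous.
move=> r rA rmin; exists r^T => y.
have [yA|yA] := pselect (A y^T).
  by have := rmin y^T; rewrite /ht trmxK; apply; rewrite inE.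
apply: (@le_trans _ _ (h 0)).
  by have := rmin 0; rewrite /ht trmx0; apply; rewrite inE.
have My : M < l2norm y.
  rewrite ltNge; apply/negP => yM; apply: yA => i /=.
  by rewrite mxE in_itv/= -ler_norml (le_trans (l2_coord _ _)).
have h1 := sc_first_order y 0; rewrite subr0 in h1.
have h2 := dot_le_norm (dh 0) y; move: h2; rewrite ler_norml => /andP[h2 _].
have h3 : 2 * l2norm (dh 0) <= mu * l2norm y.
  rewrite -ler_pdivrMl// mulrC (le_trans _ (ltW My))// /M lerDl //.
have := ler_wpM2r (l2_ge0 y) h3.
have := l2_ge0 y; nra.
Qed.

End quadratic_approximation.

(** * The lower-level problem and the hypergradient *)

Section vector_identities.
Context {R : realType} {m n : nat}.
Implicit Types (a c : 'cV[R]_m) (B : 'M[R]_(m, n)) (z : 'cV[R]_n).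

(** Keeps the coefficient [B] in front of z - z', which is bounded, and the
difference of the coefficients in front of the bounded vector z'. *)
Lemma dir_sub_tele a c B B' z z' :
  (a - B *m z) - (c - B' *m z') = (a - c) - (B *m z' - B' *m z') - B *m (z - z').
Proof.
rewrite mulmxBr; move: (B *m z) (B *m z') (B' *m z') => u v w.
by apply/matrixP => i j; rewrite !mxE; ring.
Qed.

Lemma dir_sub_tele' a c B B' z z' :
  (a - B *m z) - (c - B' *m z') = (a - c) - (B *m z - B' *m z) - B' *m (z - z').
Proof.
rewrite mulmxBr; move: (B *m z) (B' *m z) (B' *m z') => u v w.
by apply/matrixP => i j; rewrite !mxE; ring.
Qed.

Lemma res_sub_tele a c B B' z z' : B' *m z' = c ->
  B *m z - a - B *m (z - z') = (B *m z' - B' *m z') - (a - c).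
Proof.
move=> ->; rewrite mulmxBr; move: (B *m z) (B *m z') => u v.
by apply/matrixP => i j; rewrite !mxE; ring.
Qed.

End vector_identities.

Section hessian_blocks.
Context {R : realType} {dx dy : nat}.
Implicit Types (h : 'cV[R]_(dx + dy) -> R) (x : 'cV[R]_dx) (y z : 'cV[R]_dy).

Lemma col_mxD x x' y y' : col_mx (x + x') (y + y') = col_mx x y + col_mx x' y'.
Proof. by rewrite add_col_mx. Qed.

Lemma col_mxB x x' y y' : col_mx (x - x') (y - y') = col_mx x y - col_mx x' y'.
Proof. by rewrite opp_col_mx add_col_mx. Qed.

Lemma col_mx0Z (t : R) z : col_mx (0 : 'cV[R]_dx) (t *: z) = t *: col_mx 0 z.
Proof. by rewrite scale_col_mx scaler0. Qed.

(** The blocks of the full Hessian applied to (0, z) are the two Hessian-vector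
products that the algorithm uses. *)
Lemma hess12E h x y z :
  hess12 h x y *m z = usubmx (hess h (col_mx x y) *m col_mx 0 z).
Proof.
by rewrite -[hess h _]submxK mul_block_col !mulmx0 !add0r col_mxKu.
Qed.

Lemma hess22E h x y z :
  hess22 h x y *m z = dsubmx (hess h (col_mx x y) *m col_mx 0 z).
Proof.
by rewrite -[hess h _]submxK mul_block_col !mulmx0 !add0r col_mxKd.
Qed.

Lemma grad1B h h' x y x' y' : grad1 h x y - grad1 h' x' y' =
  usubmx (grad h (col_mx x y) - grad h' (col_mx x' y')).
Proof. by rewrite linearB. Qed.

Lemma grad2B h h' x y x' y' : grad2 h x y - grad2 h' x' y' =
  dsubmx (grad h (col_mx x y) - grad h' (col_mx x' y')).
Proof. by rewrite linearB. Qed.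

Lemma hess12B h h' x y x' y' z : hess12 h x y *m z - hess12 h' x' y' *m z =
  usubmx ((hess h (col_mx x y) - hess h' (col_mx x' y')) *m col_mx 0 z).
Proof. by rewrite mulmxBl [RHS]linearB; congr (_ - _); exact: hess12E. Qed.

Lemma hess22B h h' x y x' y' z : hess22 h x y *m z - hess22 h' x' y' *m z =
  dsubmx ((hess h (col_mx x y) - hess h' (col_mx x' y')) *m col_mx 0 z).
Proof. by rewrite mulmxBl [RHS]linearB; congr (_ - _); exact: hess22E. Qed.

Lemma l2_colB x x' y y' :
  l2norm (col_mx x y - col_mx x' y') <= l2norm (x - x') + l2norm (y - y').
Proof. by rewrite -col_mxB; exact: l2_col. Qed.

Lemma grad1_lip h L x y x' y' : lipschitz_vec L (grad h) -> 0 <= L ->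
  l2norm (grad1 h x y - grad1 h x' y') <= L * (l2norm (x - x') + l2norm (y - y')).
Proof.
move=> hL L0; rewrite grad1B (le_trans (l2_usub _))// (le_trans (hL _ _))//.
by rewrite ler_wpM2l// l2_colB.
Qed.

Lemma grad2_lip h L x y x' y' : lipschitz_vec L (grad h) -> 0 <= L ->
  l2norm (grad2 h x y - grad2 h x' y') <= L * (l2norm (x - x') + l2norm (y - y')).
Proof.
move=> hL L0; rewrite grad2B (le_trans (l2_dsub _))// (le_trans (hL _ _))//.
by rewrite ler_wpM2l// l2_colB.
Qed.

Lemma hess12_lip h L x y x' y' z : lipschitz_mx L (hess h) -> 0 <= L ->
  l2norm (hess12 h x y *m z - hess12 h x' y' *m z) <=
  L * (l2norm (x - x') + l2norm (y - y')) * l2norm z.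
Proof.
move=> hL L0; rewrite hess12B (le_trans (l2_usub _))// (le_trans (opnormP _ _))//.
rewrite l2_0col ler_wpM2r// (le_trans (hL _ _))//.
by rewrite ler_wpM2l// l2_colB.
Qed.

Lemma hess22_lip h L x y x' y' z : lipschitz_mx L (hess h) -> 0 <= L ->
  l2norm (hess22 h x y *m z - hess22 h x' y' *m z) <=
  L * (l2norm (x - x') + l2norm (y - y')) * l2norm z.
Proof.
move=> hL L0; rewrite hess22B (le_trans (l2_dsub _))// (le_trans (opnormP _ _))//.
rewrite l2_0col ler_wpM2r// (le_trans (hL _ _))//.
by rewrite ler_wpM2l// l2_colB.
Qed.

Lemma grad1_lipy h L x y y' : lipschitz_vec L (grad h) -> 0 <= L ->
  l2norm (grad1 h x y - grad1 h x y') <= L * l2norm (y - y').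
Proof.
by move=> hL L0; have := grad1_lip x y x y' hL L0; rewrite (subrr x) l2_0 add0r.
Qed.

Lemma grad2_lipy h L x y y' : lipschitz_vec L (grad h) -> 0 <= L ->
  l2norm (grad2 h x y - grad2 h x y') <= L * l2norm (y - y').
Proof.
by move=> hL L0; have := grad2_lip x y x y' hL L0; rewrite (subrr x) l2_0 add0r.
Qed.

Lemma hess12_lipy h L x y y' z : lipschitz_mx L (hess h) -> 0 <= L ->
  l2norm (hess12 h x y *m z - hess12 h x y' *m z) <= L * l2norm (y - y') * l2norm z.
Proof.
by move=> hL L0; have := hess12_lip x y x y' z hL L0; rewrite (subrr x) l2_0 add0r.
Qed.

Lemma hess22_lipy h L x y y' z : lipschitz_mx L (hess h) -> 0 <= L ->
  l2norm (hess22 h x y *m z - hess22 h x y' *m z) <= L * l2norm (y - y') * l2norm z.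
Proof.
by move=> hL L0; have := hess22_lip x y x y' z hL L0; rewrite (subrr x) l2_0 add0r.
Qed.

Section bounded.
Variables (h : 'cV[R]_(dx + dy) -> R) (L L' : R).
Hypotheses (L0 : 0 <= L) (L'0 : 0 <= L') (dh : twice_differentiable h).
Hypotheses (hL : lipschitz_vec L (grad h)) (hL' : lipschitz_mx L' (hess h)).

Lemma hess12_bound x y z : l2norm (hess12 h x y *m z) <= L * l2norm z.
Proof.
rewrite hess12E (le_trans (l2_usub _))// -(l2_0col dx z).
exact: (hess_bound _ _ _ _ dh hL hL').
Qed.

Lemma hess22_bound x y z : l2norm (hess22 h x y *m z) <= L * l2norm z.
Proof.
rewrite hess22E (le_trans (l2_dsub _))// -(l2_0col dx z).
exact: (hess_bound _ _ _ _ dh hL hL').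
Qed.

End bounded.
End hessian_blocks.

Section lower_problem.
Context {R : realType} {dx dy : nat}.
Variables (f g : 'cV[R]_(dx + dy) -> R) (Lf Cf L1 L2 mu : R).
Hypotheses (Lf0 : 0 <= Lf) (Cf0 : 0 <= Cf) (L10 : 0 <= L1) (L20 : 0 <= L2).
Hypothesis (mu0 : 0 < mu).
Hypothesis Af : upper_assumption f g Lf Cf.
Hypothesis Ag : lower_assumption g L1 L2 mu.
Implicit Types (x : 'cV[R]_dx) (y z : 'cV[R]_dy).

Let df := f_differentiable Af.
Let fL := gradf_lipschitz Af.
Let dg := g_differentiable Ag.
Let gL := gradg_lipschitz Ag.
Let hL := hessg_lipschitz Ag.

Local Notation ys := (ystar g).
Local Notation zs := (zstar f g).

(** The radius of the ball onto which z is projected; [zstar_bound] is the reason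
for this radius. *)
Definition Rz : R := Cf / mu.
(** Lipschitz constants of ystar and zstar: [ystar_lip], [zstar_lip]. *)
Definition Ly : R := L1 / mu.
Definition Lz : R := (Lf + L2 * Rz) * (1 + Ly) / mu.

Lemma Rz0 : 0 <= Rz. Proof. by rewrite divr_ge0// ltW. Qed.
Lemma Ly0 : 0 <= Ly. Proof. by rewrite divr_ge0// ltW. Qed.
Lemma cR0 : 0 <= Lf + L2 * Rz.
Proof. by rewrite addr_ge0// mulr_ge0// Rz0. Qed.

Lemma Lz0 : 0 <= Lz.
Proof.
have := Rz0; have := Ly0 => ? ?.
by apply: divr_ge0; [apply: mulr_ge0; apply: addr_ge0 => //; exact: mulr_ge0|exact: ltW].
Qed.
#[local] Hint Resolve Rz0 Ly0 Lz0 : core.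

Lemma lower_quad x y k :
  `|g (col_mx x (y + k)) - g (col_mx x y) - dot (grad2 g x y) k| <= L1 * l2norm k ^+ 2.
Proof.
have := taylor1 (col_mx x y) (col_mx 0 k) L10 (proj1 dg) gL.
by rewrite -col_mxD addr0 -[grad g _]vsubmxK dot_col dot0r add0r l2_0col.
Qed.

Lemma lower_monotone x v w :
  mu * l2norm (v - w) ^+ 2 <= dot (grad2 g x v - grad2 g x w) (v - w).
Proof.
exact: (sc_monotone (h := fun y => g (col_mx x y)) (lower_quad x)
  (g_strongly_convex Ag x)).
Qed.

(** The default value in the definition of [argmin] is not taken, as a strongly
convex function has a minimizer. *)
Lemma ystar_min x y : g (col_mx x (ys x)) <= g (col_mx x y).
Proof.
have [y0 hy0] := sc_min_exists L10 (h := fun y => g (col_mx x y))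
  (lower_quad x) mu0 (g_strongly_convex Ag x).
have : [set y | setT y /\ forall y', setT y' -> g (col_mx x y) <= g (col_mx x y')] (ys x).
  by apply: (xgetPex 0); exists y0; split.
by move=> [_ h]; exact: h.
Qed.

Lemma grad2_ystar x : grad2 g x (ys x) = 0.
Proof.
apply: (min_grad0 (h := fun y => g (col_mx x y)) (dh := grad2 g x) (L := L1)).
  exact: lower_quad.
exact: ystar_min.
Qed.

(** Strong monotonicity of [grad2 g x] between the minimizers for [x] and [x'], and
the Lipschitz bound on [grad2 g] when [x] is replaced by [x']. *)
Lemma ystar_lip x x' : l2norm (ys x - ys x') <= Ly * l2norm (x - x').
Proof.
set d := ys x - ys x'.
have h1 := lower_monotone x (ys x) (ys x').
rewrite grad2_ystar sub0r -/d in h1.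
have h2 := cauchy_schwarz (- grad2 g x (ys x')) d.
have h3 := grad2_lip x (ys x') x' (ys x') gL L10.
rewrite grad2_ystar subr0 subrr l2_0 addr0 in h3.
rewrite l2N in h2.
have h4 := ler_wpM2r (l2_ge0 d) h3.
have {h1 h2 h3 h4} h : mu * l2norm d ^+ 2 <= L1 * l2norm (x - x') * l2norm d by lra.
have [/eqP->|dn] := boolP (l2norm d == 0); first by rewrite mulr_ge0.
have dp : 0 < l2norm d by rewrite lt_def dn l2_ge0.
rewrite /Ly mulrAC ler_pdivlMr// mulrC -(ler_pM2r dp).
by rewrite -mulrA -expr2.
Qed.

(** Strong monotonicity of [grad2 g x] between y + t z and y, divided by t^2. *)
Lemma hess22_coercive x y z : mu * l2norm z ^+ 2 <= dot z (hess22 g x y *m z).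
Proof.
apply: (@ler_limit0 _ _ _ (L2 * l2norm z * l2norm z ^+ 2)) => t /andP[t0 _].
have := taylor2 (col_mx 0 z) (col_mx x y) (col_mx 0 (t *: z)) L20 dg hL.
rewrite -col_mxD addr0 !l2_0col l2Z (gtr0_norm t0).
have -> : dot (col_mx 0 z)
   (grad g (col_mx x (y + t *: z)) - grad g (col_mx x y) -
    hess g (col_mx x y) *m col_mx 0 (t *: z)) =
   dot z (grad2 g x (y + t *: z) - grad2 g x y) - t * dot z (hess22 g x y *m z).
  rewrite -[_ - _ *m _]vsubmxK dot_col dot0l add0r -dotZr -dotBr; congr (dot _ _).
  by rewrite linearB grad2B hess22E col_mx0Z -scalemxAr linearZ.
rewrite ler_norml => /andP[_ h1].
have h2 := lower_monotone x (y + t *: z) y.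
rewrite [y + _ - y]addrC addKr dotZr l2Z (gtr0_norm t0) dotC in h2.
have {}h2 : mu * t * l2norm z ^+ 2 <= dot z (grad2 g x (y + t *: z) - grad2 g x y).
  by rewrite -(ler_pM2l t0); move: h2; set D := dot _ _; set l := l2norm _; lra.
rewrite -(ler_pM2l t0); move: h1 h2.
by set D := dot _ (_ - _); set D' := dot _ _; set l := l2norm _; lra.
Qed.

Lemma hess22_norm_ge x y z : mu * l2norm z <= l2norm (hess22 g x y *m z).
Proof.
have [/eqP e|zn] := boolP (l2norm z == 0); first by rewrite e mulr0.
have zp : 0 < l2norm z by rewrite lt_def zn l2_ge0.
rewrite -(ler_pM2r zp) -mulrA -expr2 (le_trans (hess22_coercive x y z))//.
by rewrite mulrC; exact: cauchy_schwarz.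
Qed.

(** Coercivity makes the kernel trivial. *)
Lemma hess22_unit x y : hess22 g x y \in unitmx.
Proof.
rewrite -unitmx_tr -row_free_unit -kermx_eq0.
apply/eqP/row_matrixP => i; rewrite row0.
set v := row i _.
have v0 : hess22 g x y *m v^T = 0.
  apply: trmx_inj; rewrite trmx_mul trmxK trmx0 /v -row_mul mulmx_ker row0 //.
have := hess22_norm_ge x y v^T; rewrite v0 l2_0.
rewrite -(mulr0 mu) ler_pM2l// => h.
have : v^T = 0 by apply: l2_eq0; apply/eqP; rewrite eq_le h l2_ge0.
by move=> /(congr1 trmx); rewrite trmxK trmx0.
Qed.

Lemma zstarE x : hess22 g x (ys x) *m zs x = grad2 f x (ys x).
Proof. by rewrite /zstar mulKVmx// hess22_unit. Qed.

Lemma zstar_bound x : l2norm (zs x) <= Rz.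
Proof.
have := hess22_norm_ge x (ys x) (zs x); rewrite (zstarE x) => h.
rewrite /Rz ler_pdivlMr// mulrC (le_trans h)//; exact: grad2f_bounded Af x.
Qed.

(** Subtract the linear systems that define zstar at [x] and at [x'], and use that
hess22 expands norms by at least [mu]. *)
Lemma zstar_lip x x' : l2norm (zs x - zs x') <= Lz * l2norm (x - x').
Proof.
rewrite /Lz mulrAC ler_pdivlMr// mulrC.
rewrite (le_trans (hess22_norm_ge x (ys x) _))// mulmxBr.
rewrite [X in l2norm (X - _)](zstarE x).
have -> : grad2 f x (ys x) - hess22 g x (ys x) *m zs x' =
  (grad2 f x (ys x) - grad2 f x' (ys x')) -
  (hess22 g x (ys x) *m zs x' - hess22 g x' (ys x') *m zs x').
  by rewrite -(zstarE x') opprB addrA subrK.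
rewrite (le_trans (l2B _ _))//.
have h1 := grad2_lip x (ys x) x' (ys x') fL Lf0.
have h2 := hess22_lip x (ys x) x' (ys x') (zs x') hL L20.
rewrite (le_trans (lerD h1 h2))//.
have h3 := ystar_lip x x'; have h4 := zstar_bound x'.
set nx := l2norm (x - x') in h3 *; set ny := l2norm (ys x - _) in h3 *.
have n0 : 0 <= nx + ny by rewrite addr_ge0// l2_ge0.
have h5 : L2 * (nx + ny) * l2norm (zs x') <= L2 * (nx + ny) * Rz.
  by rewrite ler_wpM2l// mulr_ge0.
rewrite (le_trans (lerD (lexx _) h5))//.
have -> : Lf * (nx + ny) + L2 * (nx + ny) * Rz = (Lf + L2 * Rz) * (nx + ny) by ring.
rewrite -mulrA ler_wpM2l ?cR0//.
by rewrite mulrDl mul1r lerD2l.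
Qed.

(** The exact directions for x and z; the one for y is [grad2 g]. *)
Definition dirx x y z := grad1 f x y - hess12 g x y *m z.
Definition dirz x y z := hess22 g x y *m z - grad2 f x y.

Definition gradH x := dirx x (ys x) (zs x).
(** The constant of the quadratic remainder of [objective]. *)
Definition CH : R := (Lf + L2 * Rz) * (1 + Ly ^+ 2).

Lemma CH0 : 0 <= CH.
Proof. by apply: mulr_ge0; [exact: cR0|rewrite addr_ge0// sqr_ge0]. Qed.

(** Add to the expansion of [f] along (k, ystar (x + k) - ystar x) the expansion of
<zstar x, grad2 g>, which vanishes at both ends.  By symmetry of the Hessian and by the
equation of zstar, the terms in ystar (x + k) - ystar x cancel; both remainders are
quadratic in [k] because ystar is Lipschitz. *)
Lemma objective_quad x k :
  `|objective f g (x + k) - objective f g x - dot (gradH x) k| <= CH * l2norm k ^+ 2.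
Proof.
set y := ys x; set z := zs x; pose D := ys (x + k) - y.
pose K := col_mx k D; pose w := col_mx x y.
have wK : w + K = col_mx (x + k) (ys (x + k)).
  by rewrite /w /K -col_mxD /D [y + _]addrC subrK.
have hf := taylor1 w K Lf0 df fL.
have hg := taylor2 (col_mx 0 z) w K L20 dg hL.
(* grad2 g vanishes at w and at w + K *)
have e0 : dot (col_mx 0 z) (grad g (w + K) - grad g w - hess g w *m K) =
    - dot (col_mx 0 z) (hess g w *m K).
  rewrite dotBr; suff -> : dot (col_mx 0 z) (grad g (w + K) - grad g w) = 0.
    by rewrite sub0r.
  rewrite wK -[_ - _]vsubmxK dot_col dot0l add0r -grad2B !grad2_ystar subr0.
  by rewrite dot0r.
have e1 : dot (col_mx 0 z) (hess g w *m K) =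
    dot k (hess12 g x y *m z) + dot D (grad2 f x y).
  rewrite (hess_sym _ _ _ L20 dg hL) -[hess g w *m _]vsubmxK dot_col.
  by rewrite -(hess12E g x y z) -(hess22E g x y z) (zstarE x).
have e2 : dot (grad f w) K = dot (grad1 f x y) k + dot (grad2 f x y) D.
  by rewrite -[grad f w]vsubmxK dot_col.
rewrite e0 normrN e1 in hg; rewrite wK e2 in hf.
have nz : l2norm (col_mx 0 z : 'cV_(dx + dy)) <= Rz by rewrite l2_0col zstar_bound.
have hD : l2norm D <= Ly * l2norm k.
  have e : x + k - x = k by rewrite addrC addKr.
  by have := ystar_lip (x + k) x; rewrite e.
have nK : l2norm K ^+ 2 <= (1 + Ly ^+ 2) * l2norm k ^+ 2.
  rewrite l2sq_col mulrDl mul1r lerD2l -exprMn lerXn2r ?nnegrE//.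
  by rewrite mulr_ge0// Ly0.
have hg' : `|dot k (hess12 g x y *m z) + dot D (grad2 f x y)| <= L2 * Rz * l2norm K ^+ 2.
  rewrite (le_trans hg)// ler_wpM2r ?sqr_ge0// ler_wpM2l//.
have -> : objective f g (x + k) - objective f g x - dot (gradH x) k =
  (f (col_mx (x + k) (ys (x + k))) - f w -
     (dot (grad1 f x y) k + dot (grad2 f x y) D)) +
  (dot k (hess12 g x y *m z) + dot D (grad2 f x y)).
  rewrite /gradH /dirx dotBl -/y -/z (dotC D) (dotC k) /objective -/y -/w; ring.
rewrite (le_trans (ler_normD _ _))// (le_trans (lerD hf hg'))//.
by rewrite -mulrDl /CH -mulrA ler_wpM2l// cR0.
Qed.

Lemma grad_objective x : grad (objective f g) x = gradH x.
Proof. exact: (quad_grad CH0 (dh := gradH) objective_quad). Qed.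

Lemma objective_loclip u : exists K, forall v, l2norm (v - u) <= 1 ->
  `|objective f g v - objective f g u| <= K * l2norm (v - u).
Proof. exact: (quad_loclip CH0 (dh := gradH) objective_quad). Qed.

Lemma dirx_err x y z : l2norm (dirx x y z - gradH x) <=
  (Lf + L2 * Rz) * l2norm (y - ys x) + L1 * l2norm (z - zs x).
Proof.
have -> : dirx x y z - gradH x = (grad1 f x y - grad1 f x (ys x)) -
   (hess12 g x y *m zs x - hess12 g x (ys x) *m zs x) -
   hess12 g x y *m (z - zs x).
  exact: dir_sub_tele.
rewrite (le_trans (l2B _ _))// lerD//; last first.
  exact: (hess12_bound L10 L20 dg gL hL).
rewrite (le_trans (l2B _ _))// mulrDl lerD//.
  exact: (grad1_lipy _ _ _ fL Lf0).
have h := hess12_lipy x y (ys x) (zs x) hL L20.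
rewrite (le_trans h)// mulrAC ler_wpM2r// ler_wpM2l//; exact: zstar_bound.
Qed.

(** The direction for z vanishes at (ystar, zstar), so it is the linear map hess22
applied to z - zstar, up to an error caused by y alone. *)
Lemma dirz_err x y z : l2norm (dirz x y z - hess22 g x y *m (z - zs x)) <=
  (Lf + L2 * Rz) * l2norm (y - ys x).
Proof.
have -> : dirz x y z - hess22 g x y *m (z - zs x) =
   (hess22 g x y *m zs x - hess22 g x (ys x) *m zs x) -
   (grad2 f x y - grad2 f x (ys x)).
  exact: res_sub_tele (zstarE x).
rewrite (le_trans (l2B _ _))// addrC mulrDl lerD//.
  exact: (grad2_lipy _ _ _ fL Lf0).
have h := hess22_lipy x y (ys x) (zs x) hL L20.
rewrite (le_trans h)// mulrAC ler_wpM2r// ler_wpM2l//; exact: zstar_bound.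
Qed.

Lemma diry_err x y : l2norm (grad2 g x y) <= L1 * l2norm (y - ys x).
Proof.
by have := grad2_lipy x y (ys x) gL L10; rewrite grad2_ystar subr0.
Qed.

Lemma gradH_lip : exists L, lipschitz_vec L gradH.
Proof.
exists ((Lf + L2 * Rz) * (1 + Ly) + L1 * Lz) => x x'.
have -> : gradH x - gradH x' = (grad1 f x (ys x) - grad1 f x' (ys x')) -
   (hess12 g x (ys x) *m zs x - hess12 g x' (ys x') *m zs x) -
   hess12 g x' (ys x') *m (zs x - zs x').
  exact: dir_sub_tele'.
set n := l2norm (x - x').
have hy : n + l2norm (ys x - ys x') <= (1 + Ly) * n.
  by rewrite mulrDl mul1r lerD2l ystar_lip.
rewrite mulrDl (le_trans (l2B _ _))// lerD//; last first.
  rewrite (le_trans (hess12_bound L10 L20 dg gL hL _ _ _))// -mulrA ler_wpM2l//.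
  exact: zstar_lip.
rewrite (le_trans (l2B _ _))// -mulrA mulrDl lerD//.
  by rewrite (le_trans (grad1_lip _ _ _ _ fL Lf0))// ler_wpM2l.
rewrite (le_trans (hess12_lip _ _ _ _ _ hL L20))//.
have -> : L2 * Rz * ((1 + Ly) * n) = L2 * ((1 + Ly) * n) * Rz by ring.
have n0 : 0 <= n + l2norm (ys x - ys x') by rewrite addr_ge0// l2_ge0.
have hz := zstar_bound x.
rewrite (le_trans (ler_wpM2l _ hz)) ?mulr_ge0// ler_wpM2r ?Rz0//.
by rewrite ler_wpM2l.
Qed.

End lower_problem.

(** * Projection, tracking and decrease of the potential *)

Section projection.
Context {R : realType} {n : nat}.
Variable r : R.
Hypothesis r0 : 0 <= r.
Implicit Types v w : 'cV[R]_n.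

(** Outside the ball the minimizer is the rescaled vector, by the triangle
inequality. *)
Lemma proj_ballP v : l2norm (proj_ball r v) <= r /\
  forall w, l2norm w <= r -> l2norm (proj_ball r v - v) <= l2norm (w - v).
Proof.
suff [w0 hw0] : exists w0 : 'cV[R]_n, l2norm w0 <= r /\
    forall w, l2norm w <= r -> l2norm (w0 - v) <= l2norm (w - v).
  exact: (xgetPex 0 (ex_intro (fun w0 => [set w | l2norm w <= r] w0 /\
    forall w, [set w | l2norm w <= r] w -> l2norm (w0 - v) <= l2norm (w - v)) w0 hw0)).
have [vr|rv] := leP (l2norm v) r.
  by exists v; split=> // w _; rewrite subrr l2_0.
have v0 : 0 < l2norm v by exact: le_lt_trans rv.
exists ((r / l2norm v) *: v); split.
  by rewrite l2Z ger0_norm ?divr_ge0// divfK// gt_eqF.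
move=> w wr; rewrite -[X in _ - X]scale1r -scalerBl l2Z.
have e : r / l2norm v - 1 = - ((l2norm v - r) / l2norm v).
  by field; rewrite gt_eqF.
rewrite e normrN ger0_norm ?divr_ge0 ?subr_ge0 ?(ltW rv)// divfK ?gt_eqF//.
rewrite lerBlDr (le_trans _ (lerD (lexx _) wr))//.
by have := l2B w (w - v); rewrite subKr addrC.
Qed.

Lemma proj_ball_in v : l2norm (proj_ball r v) <= r.
Proof. by have [] := proj_ballP v. Qed.

(** The obtuse angle criterion: compare the projection with the points of the
segment that joins it to [w]. *)
Lemma proj_ball_dot v w : l2norm w <= r ->
  dot (v - proj_ball r v) (w - proj_ball r v) <= 0.
Proof.
move=> wr; have [pr pmin] := proj_ballP v.
set p := proj_ball r v in pr pmin *.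
apply: (@ler_limit0 _ _ _ (l2norm (w - p) ^+ 2 / 2)) => t /andP[t0 t1].
rewrite add0r -(ler_pM2l t0).
have hr : l2norm (p + t *: (w - p)) <= r.
  have -> : p + t *: (w - p) = (1 - t) *: p + t *: w.
    by rewrite scalerBl scale1r scalerBr addrCA addrC -addrA addrCA.
  rewrite (le_trans (l2D _ _))// !l2Z (ger0_norm (ltW t0)) ger0_norm ?subr_ge0//.
  have h1 : (1 - t) * l2norm p <= (1 - t) * r by rewrite ler_wpM2l// subr_ge0.
  have h2 : t * l2norm w <= t * r by rewrite ler_wpM2l// ltW.
  by rewrite (le_trans (lerD h1 h2))// -mulrDl subrK mul1r.
have : l2norm (p - v) ^+ 2 <= l2norm (p + t *: (w - p) - v) ^+ 2.
  by rewrite lerXn2r ?nnegrE//; exact: pmin.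
have -> : p + t *: (w - p) - v = t *: (w - p) - (v - p).
  by move: (t *: _) => s; rewrite opprB [p + s]addrC addrA.
rewrite [l2norm (_ - (v - p)) ^+ 2]l2sqB l2Z dotZl exprMn (gtr0_norm t0) (l2C p)
  (dotC (w - p)).
by set d := dot _ _; set l := l2norm _; set l' := l2norm _; lra.
Qed.

(** Add the obtuse angle inequalities at the two projections. *)
Lemma proj_ball_lip : lipschitz_vec 1 (@proj_ball R n r).
Proof.
move=> v w; rewrite mul1r.
have h1 := @proj_ball_dot v _ (proj_ball_in w).
have h2 := @proj_ball_dot w _ (proj_ball_in v).
move: (proj_ball r v) (proj_ball r w) h1 h2 => p q h1 h2.
have h : l2norm (p - q) ^+ 2 <= dot (v - w) (p - q).
  have -> : v - w = (v - p) + (p - q) - (w - q).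
    by rewrite addrA subrK opprB addrA subrK.
  rewrite dotBl dotDl l2sq; rewrite -[q - p]opprB dotNr in h1; lra.
have := cauchy_schwarz (v - w) (p - q) => h3.
have [/eqP->//|dn] := boolP (l2norm (p - q) == 0).
have dp : 0 < l2norm (p - q) by rewrite lt_def dn l2_ge0.
by rewrite -(ler_pM2r dp) -expr2 (le_trans h).
Qed.

Lemma proj_ball_id v : l2norm v <= r -> proj_ball r v = v.
Proof.
move=> vr; have [_ /(_ v vr)] := proj_ballP v; rewrite subrr l2_0 => h.
apply/eqP; rewrite -subr_eq0; apply/eqP/l2_eq0/eqP.
by rewrite eq_le h l2_ge0.
Qed.

Lemma proj_ball_closer v w : l2norm w <= r ->
  l2norm (proj_ball r v - w) <= l2norm (v - w).
Proof. by move=> wr; have := proj_ball_lip v w; rewrite (proj_ball_id wr) mul1r. Qed.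

End projection.

Section tracking.
Context {R : realType} {n : nat}.
Implicit Types (c d e u g : 'cV[R]_n) (D q t : R).

(** A gradient step shrinks the distance [d] to the solution when [b] is at most
mu / L^2: the square of the step is then absorbed by half of the cross term. *)
Lemma gradient_contraction (b mu L : R) d g : 0 <= b -> b * L ^+ 2 <= mu ->
  mu * l2norm d ^+ 2 <= dot g d -> l2norm g <= L * l2norm d ->
  l2norm (d - b *: g) ^+ 2 <= (1 - b * mu) * l2norm d ^+ 2.
Proof.
move=> b0 bL h1 h2; rewrite l2sqB l2Z dotZr (ger0_norm b0) exprMn (dotC d).
have h3 : l2norm g ^+ 2 <= L ^+ 2 * l2norm d ^+ 2.
  by rewrite -exprMn lerXn2r ?nnegrE// (le_trans _ h2).
have h4 : b * l2norm g ^+ 2 <= mu * l2norm d ^+ 2.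
  rewrite (le_trans (ler_wpM2l b0 h3))// mulrA ler_wpM2r ?sqr_ge0//.
have h5 := ler_wpM2l b0 h1; have h6 := ler_wpM2l b0 h4.
by move: h5 h6; set l := l2norm d; set m := l2norm g; set dd := dot _ _; lra.
Qed.

(** A noisy step [u] spends half of the contraction rate [t]; this is Young's
inequality with weight t / 2. *)
Lemma tracking_noise t D c u : 0 < t <= 1 -> 0 <= D -> l2norm c ^+ 2 <= (1 - t) * D ->
  l2norm (c - u) ^+ 2 <= (1 - t / 2) * D + 3 / t * l2norm u ^+ 2.
Proof.
move=> /andP[t0 t1] D0 hc.
have t2 : 0 < t / 2 by rewrite divr_gt0.
rewrite (le_trans (l2sqD_young c (- u) t2))// l2N lerD//.
  rewrite (le_trans (ler_wpM2l _ hc)) ?addr_ge0 ?(ltW t2)//.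
  rewrite mulrA ler_wpM2r//; nra.
rewrite ler_wpM2r ?sqr_ge0// ler_pdivlMr// mulrDl mul1r.
have -> : (t / 2)^-1 * t = 2 by field; rewrite gt_eqF.
lra.
Qed.

(** A moving target spends another quarter of the rate [t]; this is Young's
inequality with weight t / 4. *)
Lemma tracking_drift t D q c u : 0 < t <= 1 -> 0 <= D -> 0 <= q ->
  l2norm c ^+ 2 <= (1 - t / 2) * D + q ->
  l2norm (c + u) ^+ 2 <= (1 - t / 4) * D + 2 * q + 5 / t * l2norm u ^+ 2.
Proof.
move=> /andP[t0 t1] D0 q0 hc.
have t2 : 0 < t / 4 by rewrite divr_gt0.
rewrite (le_trans (l2sqD_young c u t2))// lerD//.
  rewrite (le_trans (ler_wpM2l _ hc)) ?addr_ge0 ?(ltW t2)//; nra.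
rewrite ler_wpM2r ?sqr_ge0// ler_pdivlMr// mulrDl mul1r.
have -> : (t / 4)^-1 * t = 4 by field; rewrite gt_eqF.
lra.
Qed.

End tracking.

Section descent.
Context {R : realType} {dx dy : nat}.
Variables (f g : 'cV[R]_(dx + dy) -> R) (Lf Cf L1 L2 mu : R).
Hypotheses (Lf0 : 0 <= Lf) (Cf0 : 0 <= Cf) (L10 : 0 <= L1) (L20 : 0 <= L2).
Hypothesis (mu0 : 0 < mu).

Local Notation Rz := (Rz Cf mu).
Local Notation Ly := (Ly L1 mu).
Local Notation Lz := (Lz Lf Cf L1 L2 mu).
Local Notation CH := (CH Lf Cf L1 L2 mu).
Local Notation K1 := (Lf + L2 * Rz).

(** The weights are chosen backwards.  [wz] makes the contraction of z - zstar absorb what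
z - zstar contributes to the descent of the objective, with 1 to spare; [wy] does it for
y - ystar, which also disturbs z.  [cbeta] and [cgamma], which speed up the inner
updates, are so large that the drift of ystar and zstar caused by the x-step costs only a
fraction of alpha |v^x|^2.  [cnoise] collects the coefficients of the estimation errors
and [cmove] those of the squared length of a step. *)
Definition wz : R := 4 * (2 * L1 ^+ 2 + 1) / mu.
Definition wy : R := 4 * (2 * K1 ^+ 2 + 12 / mu * wz * K1 ^+ 2 + 1) / mu.
Definition cbeta : R := 1 + 40 * Ly ^+ 2 / mu * wy.
Definition cgamma : R := 1 + 40 * Lz ^+ 2 / mu * wz.
Definition cnoise : R := 1 + 6 / mu * wy + 12 / mu * wz.
Definition cmove : R := 1 + cbeta ^+ 2 * (2 + 2 * L1 ^+ 2) +
  cgamma ^+ 2 * (2 + 4 * K1 ^+ 2 + 4 * L1 ^+ 2).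

Lemma wz0 : 0 <= wz.
Proof. by apply: divr_ge0; [rewrite mulr_ge0// addr_ge0// mulr_ge0// sqr_ge0|exact: ltW]. Qed.

Lemma wy0 : 0 <= wy.
Proof.
apply: divr_ge0; last exact: ltW.
have h : 0 <= 12 / mu by rewrite divr_ge0// ltW.
apply: mulr_ge0 => //; apply: addr_ge0 => //; apply: addr_ge0.
  by rewrite mulr_ge0// sqr_ge0.
by apply: mulr_ge0; [exact: mulr_ge0 h wz0|exact: sqr_ge0].
Qed.

Lemma cbeta1 : 1 <= cbeta.
Proof.
by rewrite lerDl mulr_ge0 ?wy0// divr_ge0 ?(ltW mu0)// mulr_ge0// sqr_ge0.
Qed.

Lemma cgamma1 : 1 <= cgamma.
Proof.
by rewrite lerDl mulr_ge0 ?wz0// divr_ge0 ?(ltW mu0)// mulr_ge0// sqr_ge0.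
Qed.

Lemma cnoise1 : 1 <= cnoise.
Proof.
by rewrite /cnoise -addrA lerDl addr_ge0// mulr_ge0 ?wy0 ?wz0// divr_ge0// ltW.
Qed.

Lemma cmove1 : 1 <= cmove.
Proof.
rewrite /cmove -addrA lerDl addr_ge0// mulr_ge0 ?sqr_ge0//.
  by rewrite addr_ge0// mulr_ge0// sqr_ge0.
by rewrite !addr_ge0// mulr_ge0// sqr_ge0.
Qed.

(** The inner gradient steps contract, and the quadratic term of the objective is
dominated by the linear one. *)
Definition step_cond (alpha : R) : Prop :=
  [/\ 0 < alpha, CH * alpha <= 8^-1,
      cbeta * alpha * L1 ^+ 2 <= mu /\ cbeta * alpha * mu <= 1
    & cgamma * alpha * L1 ^+ 2 <= mu /\ cgamma * alpha * mu <= 1].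

Hypothesis Af : upper_assumption f g Lf Cf.
Hypothesis Ag : lower_assumption g L1 L2 mu.

Definition errE (u v : iterate R dx dy) : R :=
  l2norm (comp_x v - dirx f g (comp_x u) (comp_y u) (comp_z u)) ^+ 2 +
  l2norm (comp_y v - grad2 g (comp_x u) (comp_y u)) ^+ 2 +
  l2norm (comp_z v - dirz f g (comp_x u) (comp_y u) (comp_z u)) ^+ 2.

Definition devY (u : iterate R dx dy) : R := l2norm (comp_y u - ystar g (comp_x u)) ^+ 2.
Definition devZ (u : iterate R dx dy) : R := l2norm (comp_z u - zstar f g (comp_x u)) ^+ 2.

Definition dist2 (u u' : iterate R dx dy) : R :=
  l2norm (comp_x u' - comp_x u) ^+ 2 + l2norm (comp_y u' - comp_y u) ^+ 2 +
  l2norm (comp_z u' - comp_z u) ^+ 2.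

Definition potential (u : iterate R dx dy) : R :=
  objective f g (comp_x u) + wy / cbeta * devY u + wz / cgamma * devZ u.

(** The part of the decrease of the potential that is left to pay for the movement of
the iterates. *)
Definition slack (u v : iterate R dx dy) : R :=
  l2norm (comp_x v) ^+ 2 + devY u + devZ u.

Section one_step.
Variables (alpha : R) (u v : iterate R dx dy).
Hypothesis ha : step_cond alpha.
Hypothesis hz : l2norm (comp_z u) <= Rz.

Let beta := cbeta * alpha.
Let gamma := cgamma * alpha.
Let u' := update (Cf / mu) alpha beta gamma u v.
Let x := comp_x u.
Let y := comp_y u.
Let z := comp_z u.
Let V := l2norm (comp_x v) ^+ 2.
Let Y := devY u.
Let Z := devZ u.
Let Ex := l2norm (comp_x v - dirx f g x y z) ^+ 2.
Let Ey := l2norm (comp_y v - grad2 g x y) ^+ 2.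
Let Ez := l2norm (comp_z v - dirz f g x y z) ^+ 2.
Let G := l2norm (gradH f g x) ^+ 2.

Let a0 : 0 < alpha. Proof. by case: ha. Qed.
Let b0 : 0 < beta.
Proof. by rewrite mulr_gt0//; apply: lt_le_trans cbeta1. Qed.
Let g0 : 0 < gamma.
Proof. by rewrite mulr_gt0//; apply: lt_le_trans cgamma1. Qed.
Let V0 : 0 <= V. Proof. exact: sqr_ge0. Qed.
Let Y0 : 0 <= Y. Proof. exact: sqr_ge0. Qed.
Let Z0 : 0 <= Z. Proof. exact: sqr_ge0. Qed.
Let Ex0 : 0 <= Ex. Proof. exact: sqr_ge0. Qed.
Let Ey0 : 0 <= Ey. Proof. exact: sqr_ge0. Qed.
Let Ez0 : 0 <= Ez. Proof. exact: sqr_ge0. Qed.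
Let K10 : 0 <= K1. Proof. exact: cR0. Qed.

Let mixed_sq (a b c s t : R) : 0 <= a -> 0 <= b -> 0 <= s -> 0 <= t -> 0 <= c ->
  c <= a * s + b * t -> c ^+ 2 <= 2 * a ^+ 2 * s ^+ 2 + 2 * b ^+ 2 * t ^+ 2.
Proof.
move=> a1 b1 s1 t1 c1 h.
have h2 : c ^+ 2 <= (a * s + b * t) ^+ 2.
  by rewrite lerXn2r ?nnegrE// addr_ge0 ?mulr_ge0.
rewrite (le_trans h2)// -subr_ge0.
have -> : 2 * a ^+ 2 * s ^+ 2 + 2 * b ^+ 2 * t ^+ 2 - (a * s + b * t) ^+ 2 =
  (a * s - b * t) ^+ 2 by ring.
exact: sqr_ge0.
Qed.

(** The descent inequality for the smooth function [objective] along an inexact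
gradient whose error comes from the estimator and from y and z not being exact. *)
Lemma objective_step :
  objective f g (comp_x u') <= objective f g x - alpha / 2 * G -
    (alpha / 2 - CH * alpha ^+ 2) * V +
    alpha * (Ex + 2 * K1 ^+ 2 * Y + 2 * L1 ^+ 2 * Z).
Proof.
have h1 := quad_ub (objective_quad Lf0 Cf0 L10 L20 mu0 Af Ag) x (- alpha *: comp_x v).
have -> : comp_x u' = x + - alpha *: comp_x v by rewrite scaleNr.
rewrite (le_trans h1)// dotZr l2Z normrN (gtr0_norm a0) exprMn -/V.
have h2 : l2norm (gradH f g x - comp_x v) ^+ 2 = G - 2 * dot (gradH f g x) (comp_x v) + V.
  exact: l2sqB.
have h3 : l2norm (gradH f g x - comp_x v) ^+ 2 <=
    2 * (l2norm (gradH f g x - dirx f g x y z) ^+ 2 +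
         l2norm (dirx f g x y z - comp_x v) ^+ 2).
  have := l2sqD2 (gradH f g x - dirx f g x y z) (dirx f g x y z - comp_x v).
  by rewrite addrA subrK.
have h4 : l2norm (gradH f g x - dirx f g x y z) ^+ 2 <= 2 * K1 ^+ 2 * Y + 2 * L1 ^+ 2 * Z.
  rewrite l2C; apply: mixed_sq => //.
  exact: (dirx_err Lf0 L10 L20 mu0 Af Ag).
have h5 : l2norm (dirx f g x y z - comp_x v) ^+ 2 = Ex by rewrite l2C.
rewrite h5 h2 in h3.
have h6 : G - 2 * dot (gradH f g x) (comp_x v) + V <=
  2 * (2 * K1 ^+ 2 * Y + 2 * L1 ^+ 2 * Z + Ex) by lra.
have := ler_wpM2l (ltW a0) h6.
by move: (dot _ _) => dd; lra.
Qed.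

(** A contraction with noise from the estimator and with drift of the target ystar. *)
Lemma devY_step : devY u' <= (1 - beta * mu / 4) * Y + 6 / mu * beta * Ey +
  5 * Ly ^+ 2 / mu * (alpha ^+ 2 / beta) * V.
Proof.
have [_ _ [hb1 hb2] _] := ha.
have bm : 0 < beta * mu <= 1 by rewrite mulr_gt0.
set e := comp_y v - grad2 g x y.
have h1 : l2norm ((y - ystar g x) - beta *: grad2 g x y) ^+ 2 <= (1 - beta * mu) * Y.
  apply: (gradient_contraction (L := L1)) => //; first exact: ltW.
    have := lower_monotone L10 Ag x y (ystar g x).
    by rewrite (grad2_ystar L10 mu0 Ag) subr0.
  exact: (diry_err L10 mu0 Ag).
have h2 := tracking_noise (beta *: e) bm Y0 h1.
rewrite l2Z (gtr0_norm b0) exprMn in h2.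
have -> : devY u' = l2norm (((y - ystar g x) - beta *: grad2 g x y - beta *: e) +
    (ystar g x - ystar g (comp_x u'))) ^+ 2.
  congr (l2norm _ ^+ 2); rewrite /u' /= /e scalerBr opprB -/y -/x.
  move: (ystar g x) (ystar g _) (beta *: grad2 g x y) (beta *: comp_y v) => a b c d.
  by apply/matrixP => i j; rewrite !mxE; ring.
have q0 : 0 <= 3 / (beta * mu) * (beta ^+ 2 * l2norm e ^+ 2).
  by rewrite mulr_ge0 ?(mulr_ge0 (sqr_ge0 _))// ?sqr_ge0// divr_ge0// ltW// mulr_gt0.
have h3 := tracking_drift (ystar g x - ystar g (comp_x u')) bm Y0 q0 h2.
rewrite (le_trans h3)//.
have h4 : l2norm (ystar g x - ystar g (comp_x u')) ^+ 2 <= Ly ^+ 2 * (alpha ^+ 2 * V).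
  have e1 : x - comp_x u' = alpha *: comp_x v by rewrite /u' /= subKr.
  have := ystar_lip L10 mu0 Ag x (comp_x u').
  rewrite e1 l2Z (gtr0_norm a0) -!exprMn => h.
  by rewrite lerXn2r ?nnegrE//; apply: mulr_ge0; rewrite ?Ly0// mulr_ge0// ltW.
rewrite lerD//.
  rewrite lerD2l le_eqVlt; apply/orP; left; apply/eqP.
  by rewrite -/e /Ey -/e; field; rewrite !gt_eqF.
have c0 : 0 <= 5 / (beta * mu) by rewrite divr_ge0// ltW// mulr_gt0.
rewrite (le_trans (ler_wpM2l c0 h4))// le_eqVlt; apply/orP; left; apply/eqP.
by field; rewrite !gt_eqF.
Qed.

(** As for y, with the additional error due to the linear system being formed at y
in place of ystar; the projection does no harm since zstar lies in the ball. *)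
Lemma devZ_step : devZ u' <= (1 - gamma * mu / 4) * Z +
  12 / mu * gamma * (Ez + K1 ^+ 2 * Y) +
  5 * Lz ^+ 2 / mu * (alpha ^+ 2 / gamma) * V.
Proof.
have [_ _ _ [hb1 hb2]] := ha.
have bm : 0 < gamma * mu <= 1 by rewrite mulr_gt0.
set d := z - zstar f g x.
set w := hess22 g x y *m d.
set e := comp_z v - w.
have h1 : l2norm (d - gamma *: w) ^+ 2 <= (1 - gamma * mu) * Z.
  apply: (gradient_contraction (L := L1)) => //; first exact: ltW.
    by rewrite dotC; exact: (hess22_coercive L10 L20 Ag).
  exact: (hess22_bound L10 L20 (g_differentiable Ag) (gradg_lipschitz Ag)
            (hessg_lipschitz Ag)).
have h2 := tracking_noise (gamma *: e) bm Z0 h1.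
rewrite l2Z (gtr0_norm g0) exprMn in h2.
have he : l2norm e ^+ 2 <= 2 * (Ez + K1 ^+ 2 * Y).
  have -> : e = (comp_z v - dirz f g x y z) + (dirz f g x y z - w).
    by rewrite addrA subrK.
  rewrite (le_trans (l2sqD2 _ _))// ler_wpM2l// lerD2l.
  rewrite -exprMn lerXn2r ?nnegrE ?mulr_ge0//.
  exact: (dirz_err Lf0 L10 L20 mu0 Af Ag).
have Rz0 : 0 <= Cf / mu by exact: Rz0.
set q := 3 / (gamma * mu) * (gamma ^+ 2 * l2norm e ^+ 2) in h2.
have q0 : 0 <= q.
  by rewrite mulr_ge0 ?(mulr_ge0 (sqr_ge0 _))// ?sqr_ge0// divr_ge0// ltW// mulr_gt0.
have h2' : l2norm (comp_z u' - zstar f g x) ^+ 2 <= (1 - gamma * mu / 2) * Z + q.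
  rewrite (le_trans _ h2)// lerXn2r ?nnegrE//.
  rewrite (le_trans (proj_ball_closer Rz0 _ (zstar_bound L10 L20 mu0 Af Ag x)))//.
  rewrite le_eqVlt; apply/orP; left; apply/eqP; congr (l2norm _).
  rewrite /e /d scalerBr opprB -/z.
  move: (zstar f g x) (gamma *: w) (gamma *: comp_z v) => a b c.
  by apply/matrixP => i j; rewrite !mxE; ring.
have -> : devZ u' = l2norm ((comp_z u' - zstar f g x) +
    (zstar f g x - zstar f g (comp_x u'))) ^+ 2.
  by rewrite addrA subrK.
have h3 := tracking_drift (zstar f g x - zstar f g (comp_x u')) bm Z0 q0 h2'.
rewrite (le_trans h3)//.
have h4 : l2norm (zstar f g x - zstar f g (comp_x u')) ^+ 2 <= Lz ^+ 2 * (alpha ^+ 2 * V).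
  have e1 : x - comp_x u' = alpha *: comp_x v by rewrite /u' /= subKr.
  have := zstar_lip Lf0 Cf0 L10 L20 mu0 Af Ag x (comp_x u').
  rewrite e1 l2Z (gtr0_norm a0) -!exprMn => h.
  by rewrite lerXn2r ?nnegrE//; apply: mulr_ge0; rewrite ?Lz0// mulr_ge0// ltW.
rewrite lerD//.
  rewrite lerD2l.
  have c0 : 0 <= 6 / mu * gamma by rewrite mulr_ge0 ?divr_ge0// ltW.
  have -> : 2 * q = 6 / mu * gamma * l2norm e ^+ 2.
    by rewrite /q; field; rewrite !gt_eqF.
  rewrite (le_trans (ler_wpM2l c0 he))// le_eqVlt; apply/orP; left; apply/eqP.
  by field; rewrite gt_eqF.
have c0 : 0 <= 5 / (gamma * mu) by rewrite divr_ge0// ltW// mulr_gt0.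
rewrite (le_trans (ler_wpM2l c0 h4))// le_eqVlt; apply/orP; left; apply/eqP.
by field; rewrite !gt_eqF.
Qed.

(** The three one-step inequalities, added with the weights chosen above. *)
Lemma potential_step :
  potential u' + alpha / 2 * G + alpha / 8 * slack u v <=
  potential u + cnoise * alpha * errE u v.
Proof.
have [_ hH _ _] := ha.
have cb1 := cbeta1; have cg1 := cgamma1.
have cb0 : 0 < cbeta by apply: lt_le_trans cb1.
have cg0 : 0 < cgamma by apply: lt_le_trans cg1.
have wyn := wy0; have wzn := wz0.
have hY := ler_wpM2l (divr_ge0 wyn (ltW cb0)) devY_step.
have hZ := ler_wpM2l (divr_ge0 wzn (ltW cg0)) devZ_step.
have hO := objective_step.
have eY : wy / cbeta * ((1 - beta * mu / 4) * Y + 6 / mu * beta * Ey +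
    5 * Ly ^+ 2 / mu * (alpha ^+ 2 / beta) * V) =
  wy / cbeta * Y - alpha * (wy * mu / 4) * Y + alpha * (6 / mu * wy) * Ey +
  alpha * (5 * Ly ^+ 2 / mu * wy / cbeta ^+ 2) * V.
  by rewrite /beta; field; rewrite !gt_eqF.
have eZ : wz / cgamma * ((1 - gamma * mu / 4) * Z + 12 / mu * gamma * (Ez + K1 ^+ 2 * Y) +
    5 * Lz ^+ 2 / mu * (alpha ^+ 2 / gamma) * V) =
  wz / cgamma * Z - alpha * (wz * mu / 4) * Z + alpha * (12 / mu * wz) * Ez +
  alpha * (12 / mu * wz * K1 ^+ 2) * Y +
  alpha * (5 * Lz ^+ 2 / mu * wz / cgamma ^+ 2) * V.
  by rewrite /gamma; field; rewrite !gt_eqF.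
(* the reason for the shape of cbeta and cgamma *)
have sq_bound (A c : R) : 0 <= A -> c = 1 + 40 * A -> 5 * A / c ^+ 2 <= 8^-1.
  move=> A0 ec; have c1 : 1 <= c by rewrite ec lerDl mulr_ge0.
  rewrite ler_pdivrMr ?exprn_gt0//; last exact: lt_le_trans c1.
  nra.
have vY : 5 * Ly ^+ 2 / mu * wy / cbeta ^+ 2 <= 8^-1.
  have -> : 5 * Ly ^+ 2 / mu * wy / cbeta ^+ 2 = 5 * (Ly ^+ 2 / mu * wy) / cbeta ^+ 2.
    by field; rewrite !gt_eqF.
  apply: sq_bound; last by rewrite /cbeta; field; rewrite gt_eqF.
  by rewrite mulr_ge0// divr_ge0 ?sqr_ge0// ltW.
have vZ : 5 * Lz ^+ 2 / mu * wz / cgamma ^+ 2 <= 8^-1.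
  have -> : 5 * Lz ^+ 2 / mu * wz / cgamma ^+ 2 = 5 * (Lz ^+ 2 / mu * wz) / cgamma ^+ 2.
    by field; rewrite !gt_eqF.
  apply: sq_bound; last by rewrite /cgamma; field; rewrite gt_eqF.
  by rewrite mulr_ge0// divr_ge0 ?sqr_ge0// ltW.
have ewz : wz * mu / 4 = 2 * L1 ^+ 2 + 1 by rewrite /wz; field; rewrite gt_eqF.
have ewy : wy * mu / 4 = 2 * K1 ^+ 2 + 12 / mu * wz * K1 ^+ 2 + 1.
  by rewrite /wy; field; rewrite gt_eqF.
rewrite eY ewy in hY; rewrite eZ ewz in hZ.
have vY' := ler_wpM2r V0 (ler_wpM2l (ltW a0) vY).
have vZ' := ler_wpM2r V0 (ler_wpM2l (ltW a0) vZ).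
have vH := ler_wpM2r V0 (ler_wpM2l (ltW a0) hH).
have nEx : alpha * Ex <= cnoise * (alpha * Ex).
  by rewrite ler_peMl ?cnoise1// mulr_ge0// ltW.
have nEy : alpha * (6 / mu * wy) * Ey <= cnoise * (alpha * Ey).
  have -> : alpha * (6 / mu * wy) * Ey = 6 / mu * wy * (alpha * Ey) by ring.
  rewrite ler_wpM2r ?(mulr_ge0 (ltW a0))// /cnoise.
  have : 0 <= 12 / mu * wz by rewrite mulr_ge0// divr_ge0// ltW.
  by move: (12 / mu * wz) (6 / mu * wy) => s t; lra.
have nEz : alpha * (12 / mu * wz) * Ez <= cnoise * (alpha * Ez).
  have -> : alpha * (12 / mu * wz) * Ez = 12 / mu * wz * (alpha * Ez) by ring.
  rewrite ler_wpM2r ?(mulr_ge0 (ltW a0))// /cnoise.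
  have : 0 <= 6 / mu * wy by rewrite mulr_ge0// divr_ge0// ltW.
  by move: (12 / mu * wz) (6 / mu * wy) => s t; lra.
have aY : 0 <= alpha * Y by rewrite mulr_ge0// ltW.
have aZ : 0 <= alpha * Z by rewrite mulr_ge0// ltW.
have aV : 0 <= alpha * V by rewrite mulr_ge0// ltW.
rewrite /potential /slack /errE -/x -/y -/z -/Ex -/Ey -/Ez -/Y -/Z -/V.
move: hY hZ hO vY' vZ' vH nEx nEy nEz aY aZ aV.
move: (objective f g (comp_x u')) (objective f g x) (devY u') (devZ u') => O' O Y' Z'.
move: (5 * Ly ^+ 2 / mu * wy / cbeta ^+ 2) (5 * Lz ^+ 2 / mu * wz / cgamma ^+ 2) => k1 k2.
move: (wy / cbeta) (wz / cgamma) (12 / mu * wz * K1 ^+ 2) => w1 w2 w3.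
move: (alpha * (6 / mu * wy) * Ey) (alpha * (12 / mu * wz) * Ez) => n1 n2.
move: (K1 ^+ 2) (L1 ^+ 2) CH cnoise => K2 L12 C cn.
by lra.
Qed.

(** Each exact direction is bounded by the distances to ystar and zstar, except the one
for x, for which |v^x|^2 is part of [slack]. *)
Lemma dist2_step : dist2 u u' <= cmove * alpha ^+ 2 * (slack u v + errE u v).
Proof.
have hx : l2norm (comp_x u' - x) ^+ 2 = alpha ^+ 2 * V.
  by rewrite /u' /= addrC addKr l2N l2Z (gtr0_norm a0) exprMn.
have hy : l2norm (comp_y u' - y) ^+ 2 <= beta ^+ 2 * (2 * Ey + 2 * L1 ^+ 2 * Y).
  rewrite /u' /= -/y addrC addKr l2N l2Z (gtr0_norm b0) exprMn ler_wpM2l ?sqr_ge0//.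
  have -> : comp_y v = (comp_y v - grad2 g x y) + grad2 g x y by rewrite subrK.
  rewrite (le_trans (l2sqD2 _ _))// mulrDr lerD2l -mulrA ler_wpM2l//.
  rewrite -exprMn lerXn2r ?nnegrE ?mulr_ge0//; exact: (diry_err L10 mu0 Ag).
have Rz0 : 0 <= Cf / mu by exact: Rz0.
have hz' : l2norm (comp_z u' - z) ^+ 2 <=
    gamma ^+ 2 * (2 * Ez + (4 * K1 ^+ 2 * Y + 4 * L1 ^+ 2 * Z)).
  apply: (@le_trans _ _ (gamma ^+ 2 * l2norm (comp_z v) ^+ 2)).
    have hn : l2norm (comp_z u' - z) <= gamma * l2norm (comp_z v).
      rewrite (le_trans (proj_ball_closer Rz0 _ hz))//.
      by rewrite addrC addKr l2N l2Z (gtr0_norm g0).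
    by rewrite -exprMn lerXn2r ?nnegrE// mulr_ge0// ltW.
  rewrite ler_wpM2l ?sqr_ge0//.
  have -> : comp_z v = (comp_z v - dirz f g x y z) + dirz f g x y z by rewrite subrK.
  rewrite (le_trans (l2sqD2 _ _))// mulrDr lerD2l.
  have -> : 4 * K1 ^+ 2 * Y + 4 * L1 ^+ 2 * Z = 2 * (2 * K1 ^+ 2 * Y + 2 * L1 ^+ 2 * Z) by ring.
  rewrite ler_wpM2l//; apply: mixed_sq => //.
  rewrite -[dirz f g x y z](subrK (hess22 g x y *m (z - zstar f g x))).
  rewrite (le_trans (l2D _ _))// lerD//.
    exact: (dirz_err Lf0 L10 L20 mu0 Af Ag).
  exact: (hess22_bound L10 L20 (g_differentiable Ag) (gradg_lipschitz Ag)
            (hessg_lipschitz Ag)).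
have S0 : 0 <= slack u v + errE u v.
  by rewrite /slack /errE !addr_ge0// sqr_ge0.
have A0 : 0 <= alpha ^+ 2 by exact: sqr_ge0.
have L0 : 0 <= L1 ^+ 2 by exact: sqr_ge0.
have KK0 : 0 <= K1 ^+ 2 by exact: sqr_ge0.
rewrite /dist2 -/x -/y -/z hx (le_trans (lerD (lerD (lexx _) hy) hz'))//.
rewrite /beta /gamma !exprMn.
have VS : V <= slack u v + errE u v.
  by rewrite /slack /errE -!addrA lerDl !addr_ge0// sqr_ge0.
have [S eS] : exists S, S = slack u v + errE u v by exists (slack u v + errE u v).
rewrite -eS in S0 VS *.
have {eS}eSE : S = V + Y + Z + (Ex + Ey + Ez) by rewrite eS.
have -> : cmove * alpha ^+ 2 * S = alpha ^+ 2 * S +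
    cbeta ^+ 2 * ((2 + 2 * L1 ^+ 2) * (alpha ^+ 2 * S)) +
    cgamma ^+ 2 * ((2 + 4 * K1 ^+ 2 + 4 * L1 ^+ 2) * (alpha ^+ 2 * S)).
  by rewrite /cmove; ring.
apply: lerD; first apply: lerD.
- by rewrite ler_wpM2l.
- have -> : cbeta ^+ 2 * alpha ^+ 2 * (2 * Ey + 2 * L1 ^+ 2 * Y) =
    cbeta ^+ 2 * (2 * alpha ^+ 2 * Ey + 2 * alpha ^+ 2 * (L1 ^+ 2 * Y)) by ring.
  rewrite ler_wpM2l ?sqr_ge0// {}eSE {S S0 VS}.
  move: (alpha ^+ 2) (L1 ^+ 2) A0 L0 => A L A0 L0.
  have AY := mulr_ge0 A0 Y0; have AZ := mulr_ge0 A0 Z0.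
  have AV := mulr_ge0 A0 V0; have AE1 := mulr_ge0 A0 Ex0.
  have AE2 := mulr_ge0 A0 Ey0; have AE3 := mulr_ge0 A0 Ez0.
  have := mulr_ge0 L0 AY; have := mulr_ge0 L0 AZ; have := mulr_ge0 L0 AV.
  have := mulr_ge0 L0 AE1; have := mulr_ge0 L0 AE2; have := mulr_ge0 L0 AE3.
  lra.
- have -> : cgamma ^+ 2 * alpha ^+ 2 * (2 * Ez + (4 * K1 ^+ 2 * Y + 4 * L1 ^+ 2 * Z)) =
    cgamma ^+ 2 * (alpha ^+ 2 * (2 * Ez + (4 * K1 ^+ 2 * Y + 4 * L1 ^+ 2 * Z))) by ring.
  rewrite ler_wpM2l ?sqr_ge0// {}eSE {S S0 VS}.
  move: (alpha ^+ 2) (L1 ^+ 2) (K1 ^+ 2) A0 L0 KK0 => A L K A0 L0 KK0.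
  have AY := mulr_ge0 A0 Y0; have AZ := mulr_ge0 A0 Z0.
  have AV := mulr_ge0 A0 V0; have AE1 := mulr_ge0 A0 Ex0.
  have AE2 := mulr_ge0 A0 Ey0; have AE3 := mulr_ge0 A0 Ez0.
  have := mulr_ge0 L0 AY; have := mulr_ge0 L0 AZ; have := mulr_ge0 L0 AV.
  have := mulr_ge0 L0 AE1; have := mulr_ge0 L0 AE2; have := mulr_ge0 L0 AE3.
  have := mulr_ge0 KK0 AY; have := mulr_ge0 KK0 AZ; have := mulr_ge0 KK0 AV.
  have := mulr_ge0 KK0 AE1; have := mulr_ge0 KK0 AE2; have := mulr_ge0 KK0 AE3.
  lra.
Qed.

End one_step.
End descent.

Section two_batches.
Context {R : realType} {d d1 d2 : measure_display} {Omega : measurableType d}.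
Context {S1 : measurableType d1} {S2 : measurableType d2}.
Context (P : probability Omega R) {I : Type} (sys : I -> set (set Omega)).
Context (Q1 : probability S1 R) (Q2 : probability S2 R).
Hypothesis sys_sigma : forall i, sigma_algebra setT (sys i).
Hypothesis sys_meas : forall i, sys i `<=` measurable.
Hypothesis sys_ind : mutually_independent P sys.

Local Notation history := (history sys).

Section scaled.
Context {d'} {S : measurableType d'} (Q : probability S R).

(** Averaging [n] centred draws divides the variance by [n]. *)
Lemma scaled_batch D D' (idx : nat -> I) (X : nat -> Omega -> S) m
    (N : Omega -> S -> 'cV[R]_m) (q : Omega -> R) (M : Omega -> 'cV[R]_m) (n : nat) :
  (0 < n)%N -> D `<=` D' -> (forall j, ~ D' (idx j)) -> injective idx ->
  (forall j, is_draw P sys Q (idx j) (X j)) ->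
  vmeas (fun t : history D * S => N t.1 t.2) ->
  (forall w, has_mean_mx Q (N w) 0) ->
  (forall w, (\int[Q]_s (l2norm (N w s) ^+ 2)%:E <= (q w)%:E)%E) ->
  measurable_fun setT (q : history D -> R) ->
  vmeas (M : history D' -> _) ->
  (\int[P]_w (l2norm (M w + n%:R^-1 *: \sum_(j < n) N w (X j w)) ^+ 2)%:E <=
   \int[P]_w (l2norm (M w) ^+ 2)%:E + (n%:R^-1)%:E * \int[P]_w (q w)%:E)%E.
Proof.
move=> n0 DD' nD inj dX mN N0 Nq mq mM.
have n0' : 0 < n%:R :> R by rewrite ltr0n.
have q0 w : 0 <= q w by exact: fresh_bound_ge0 Nq w.
have mq' := measurable_history sys_meas mq.
pose c : R := n%:R^-1.
have c0 : 0 <= c ^+ 2 by exact: sqr_ge0.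
have mN' : vmeas (fun t : history D * S => c *: N t.1 t.2) by exact: vmeasZ.
have N0' w : has_mean_mx Q (fun s => c *: N w s) 0.
  move=> i j; have := has_mean_lin c 0 (N0 w i j) (has_mean_cst Q 0).
  rewrite !mxE !mulr0 addr0.
  by under eq_fun do rewrite addr0; under [X in _ -> has_mean _ X _]eq_fun do rewrite mxE.
have Nq' w : (\int[Q]_s (l2norm (c *: N w s) ^+ 2)%:E <= (c ^+ 2 * q w)%:E)%E.
  under eq_integral do rewrite l2Z exprMn real_normK ?num_real//.
  rewrite ge0_integralZl_fin//.
  - by rewrite [leRHS]EFinM; apply: lee_wpmul2l => //; rewrite lee_fin.
  - by move=> s; exact: sqr_ge0.
  - by apply: measurable_l2sq; exact: has_mean_vmeas (N0 w).
have mcq : measurable_fun setT ((fun w => c ^+ 2 * q w) : history D -> R).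
  exact: measurable_funM.
have := fresh_batch sys_sigma sys_meas sys_ind mN' N0' Nq' mcq n DD' nD inj dX mM.
rewrite ge0_integralZl_fin// muleA -EFinM.
have -> : n%:R * c ^+ 2 = c by rewrite /c; field; rewrite gt_eqF.
by under eq_integral do rewrite -scaler_sumr.
Qed.

End scaled.

(** The second batch is fresh with respect to the history enlarged by the first,
so the variances of the two batch means add up. *)
Lemma two_batches D (idx1 idx2 : nat -> I) (X1 : nat -> Omega -> S1)
    (X2 : nat -> Omega -> S2) m (N1 : Omega -> S1 -> 'cV[R]_m)
    (N2 : Omega -> S2 -> 'cV[R]_m) (q1 q2 : Omega -> R) (M : Omega -> 'cV[R]_m)
    (n : nat) :
  (0 < n)%N -> (forall j, ~ D (idx1 j)) -> (forall j, ~ D (idx2 j)) ->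
  injective idx1 -> injective idx2 -> (forall j j', idx1 j <> idx2 j') ->
  (forall j, is_draw P sys Q1 (idx1 j) (X1 j)) ->
  (forall j, is_draw P sys Q2 (idx2 j) (X2 j)) ->
  vmeas (fun t : history D * S1 => N1 t.1 t.2) ->
  vmeas (fun t : history D * S2 => N2 t.1 t.2) ->
  (forall w, has_mean_mx Q1 (N1 w) 0) -> (forall w, has_mean_mx Q2 (N2 w) 0) ->
  (forall w, (\int[Q1]_s (l2norm (N1 w s) ^+ 2)%:E <= (q1 w)%:E)%E) ->
  (forall w, (\int[Q2]_s (l2norm (N2 w s) ^+ 2)%:E <= (q2 w)%:E)%E) ->
  measurable_fun setT (q1 : history D -> R) ->
  measurable_fun setT (q2 : history D -> R) ->
  vmeas (M : history D -> _) ->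
  (\int[P]_w (l2norm (M w + n%:R^-1 *: (\sum_(j < n) N1 w (X1 j w)) +
                      n%:R^-1 *: (\sum_(j < n) N2 w (X2 j w))) ^+ 2)%:E <=
   \int[P]_w (l2norm (M w) ^+ 2)%:E + (n%:R^-1)%:E * \int[P]_w (q1 w)%:E +
   (n%:R^-1)%:E * \int[P]_w (q2 w)%:E)%E.
Proof.
move=> n0 nD1 nD2 inj1 inj2 d12 dX1 dX2 mN1 mN2 z1 z2 v1 v2 mq1 mq2 mM.
pose D2 := D `|` range idx1.
have DD2 : D `<=` D2 by move=> i Di; left.
have nD22 j : ~ D2 (idx2 j) by move=> [/nD2//|[j' _ /d12]].
have mM2 : vmeas (fun w : history D2 => M w + n%:R^-1 *: \sum_(j < n) N1 w (X1 j w)).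
  apply: vmeasD; first exact: vmeas_historyS mM.
  have iD2 j : D2 (idx1 j) by right; exists j.
  apply: (@vmeasZ _ _ (history D2)); exact: (vmeas_batch sys_sigma mN1 n DD2 iD2 dX1).
have h2 := scaled_batch n0 DD2 nD22 inj2 dX2 mN2 z2 v2 mq2 mM2.
have h1 := scaled_batch n0 (fun i Di => Di) nD1 inj1 dX1 mN1 z1 v1 mq1 mM.
by rewrite (le_trans h2)// leeD2r.
Qed.

End two_batches.

(** * One component of the variance-reduced estimator *)

Section estimator.
Context {R : realType} {dx dy : nat} {d d1 d2 : measure_display}.
Context {Omega : measurableType d} {S1 : measurableType d1} {S2 : measurableType d2}.
Context (P : probability Omega R) (Q1 : probability S1 R) (Q2 : probability S2 R).
Variables (r : randomness Omega S1 S2) (p : R).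
Hypothesis hs : sampling r P Q1 Q2 p.
Hypothesis p01 : 0 <= p <= 1.

Local Notation iterate := (iterate R dx dy).
Local Notation sys := (draw_events r).
Local Notation history := (history sys).

Definition draw_iter (i : draw) : nat :=
  match i with
  | Coin k => k | BigXi k _ => k | BigZeta k _ => k
  | SmallXi k _ => k | SmallZeta k _ => k
  end.

Definition past (k : nat) : set draw := [set i | (draw_iter i < k)%N].

Lemma pastS k : past k `<=` past k.+1.
Proof. by move=> i /= ik; rewrite /past /= ltnS ltnW. Qed.

Lemma draw_sigma i : sigma_algebra setT (sys i).
Proof. by case: i => *; exact/sigma_algebra_preimage/sigma_algebra_measurable. Qed.

Lemma draw_events_measurable i : sys i `<=` measurable.
Proof.
by case: i => * _ [B mB <-]; rewrite setTI -[X in measurable X]setTI; exact: measurable_funP.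
Qed.

Let sys_ind := draws_independent hs.

Lemma big_xi_draw k i : is_draw P sys Q1 (BigXi k i) (big_xi r k i).
Proof. by split=> A mA; [exists A => //; rewrite setTI|exact: big_xi_law hs _ _ _ mA]. Qed.

Lemma big_zeta_draw k i : is_draw P sys Q2 (BigZeta k i) (big_zeta r k i).
Proof. by split=> A mA; [exists A => //; rewrite setTI|exact: big_zeta_law hs _ _ _ mA]. Qed.

Lemma small_xi_draw k i : is_draw P sys Q1 (SmallXi k i) (small_xi r k i).
Proof. by split=> A mA; [exists A => //; rewrite setTI|exact: small_xi_law hs _ _ _ mA]. Qed.

Lemma small_zeta_draw k i : is_draw P sys Q2 (SmallZeta k i) (small_zeta r k i).
Proof. by split=> A mA; [exists A => //; rewrite setTI|exact: small_zeta_law hs _ _ _ mA]. Qed.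

Lemma coin_draw k : is_draw P sys (distribution P (coin r k)) (Coin k) (coin r k).
Proof. by split=> A mA; [exists A => //; rewrite setTI|]. Qed.

Definition imeas {d'} {T : measurableType d'} (U : T -> iterate) : Prop :=
  [/\ vmeas (fun t => comp_x (U t)), vmeas (fun t => comp_y (U t))
    & vmeas (fun t => comp_z (U t))].

Lemma imeas_comp {d'} {T : measurableType d'} {d''} {T' : measurableType d''}
    (h : T' -> T) (U : T -> iterate) :
  measurable_fun setT h -> imeas U -> imeas (fun t => U (h t)).
Proof.
move=> mh [mx my mz].
by split; [exact: (vmeas_comp mh mx)|exact: (vmeas_comp mh my)|exact: (vmeas_comp mh mz)].
Qed.

Lemma imeas_historyS D D' (U : Omega -> iterate) : D `<=` D' ->
  imeas (U : history D -> _) -> imeas (U : history D' -> _).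
Proof.
move=> DD' [mx my mz].
by split; [exact: (vmeas_historyS DD' mx)|exact: (vmeas_historyS DD' my)|exact: (vmeas_historyS DD' mz)].
Qed.

Lemma imeas_history D (U : Omega -> iterate) :
  imeas (U : history D -> _) -> imeas U.
Proof.
have H := @vmeas_history R d Omega draw sys draw_events_measurable D.
by move=> [mx my mz]; split; [exact: H mx|exact: H my|exact: H mz].
Qed.

Lemma measurable_dist2 {d'} {T : measurableType d'} (U U' : T -> iterate) :
  imeas U -> imeas U' -> measurable_fun setT (fun t => dist2 (U t) (U' t)).
Proof.
move=> [mx my mz] [mx' my' mz'].
apply: measurable_funD; first apply: measurable_funD;
by apply: measurable_l2sq; exact: vmeasB.
Qed.

(** What the variance analysis uses of a stochastic direction [h] with mean [m].  The
bounds are only required for z in the ball of radius [rad], since Hessian-vector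
products are bounded and Lipschitz only there; [l] bounds the squared difference of
centred values at two points. *)
Record oracle {d'} {S : measurableType d'} (Q : probability S R) {n}
    (h : iterate -> S -> 'cV[R]_n) (m : iterate -> 'cV[R]_n) (rad v l : R) : Prop :=
  Oracle {
  oracle_meas : forall d'' (T : measurableType d'') (U : T -> iterate) (X : T -> S),
    imeas U -> measurable_fun setT X -> vmeas (fun t => h (U t) (X t));
  oracle_meanmeas : forall d'' (T : measurableType d'') (U : T -> iterate),
    imeas U -> vmeas (fun t => m (U t));
  oracle_mean : forall u, has_mean_mx Q (h u) (m u);
  oracle_var : forall u, l2norm (comp_z u) <= rad ->
    (\int[Q]_s (l2norm (h u s - m u) ^+ 2)%:E <= v%:E)%E;
  oracle_lip : forall u u' s, l2norm (comp_z u) <= rad -> l2norm (comp_z u') <= rad ->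
    l2norm ((h u' s - h u s) - (m u' - m u)) ^+ 2 <= l * dist2 u u' }.

Definition bmean {S : Type} {n : nat} (N : nat) (X : nat -> Omega -> S)
    (h : S -> 'cV[R]_n) (w : Omega) : 'cV[R]_n :=
  N%:R^-1 *: \sum_(j < N) h (X j w).

Lemma bmeanB {S : Type} {n : nat} (N : nat) (X : nat -> Omega -> S)
    (h h' : S -> 'cV[R]_n) w :
  bmean N X (fun s => h s - h' s) w = bmean N X h w - bmean N X h' w.
Proof. by rewrite /bmean sumrB scalerBr. Qed.

Lemma bmean_cst {S : Type} {n : nat} (N : nat) (X : nat -> Omega -> S)
    (c : 'cV[R]_n) w : (0 < N)%N -> bmean N X (fun=> c) w = c.
Proof.
move=> N0; rewrite /bmean sumr_const card_ord -[c *+ N]scaler_nat scalerA mulVf ?scale1r//.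
by rewrite pnatr_eq0 -lt0n.
Qed.

Lemma has_mean_mxB {d'} {S : measurableType d'} (Q : probability S R) {n}
    (X Y : S -> 'cV[R]_n) m m' : has_mean_mx Q X m -> has_mean_mx Q Y m' ->
  has_mean_mx Q (fun s => X s - Y s) (m - m').
Proof.
move=> hX hY i j; have := has_mean_lin 1 (-1) (hX i j) (hY i j).
rewrite !mxE mul1r mulN1r.
by under eq_fun do rewrite mul1r mulN1r; under [X in _ -> has_mean _ X _]eq_fun do rewrite !mxE.
Qed.

Lemma has_mean_mx_cst {d'} {S : measurableType d'} (Q : probability S R) {n}
    (c : 'cV[R]_n) : has_mean_mx Q (fun=> c) c.
Proof. by move=> i j; exact: has_mean_cst. Qed.

Section step.
Context {n : nat} (h1 : iterate -> S1 -> 'cV[R]_n) (h2 : iterate -> S2 -> 'cV[R]_n).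
Variables (m1 m2 : iterate -> 'cV[R]_n) (rad v1 v2 l : R).
Hypothesis o1 : oracle Q1 h1 m1 rad v1 l.
Hypothesis o2 : oracle Q2 h2 m2 rad v2 l.
Hypothesis l0 : 0 <= l.
Variables (tau b k : nat) (U U' : Omega -> iterate) (v : Omega -> 'cV[R]_n).
Hypotheses (tau0 : (0 < tau)%N) (b0 : (0 < b)%N).
Hypothesis mU' : imeas (U' : history (past k) -> _).
Hypothesis bU' : forall w, l2norm (comp_z (U' w)) <= rad.

Let m u := m1 u + m2 u.

Definition big_est (w : Omega) : 'cV[R]_n :=
  bmean tau (fun i w => big_xi r k i w) (h1 (U' w)) w +
  bmean tau (fun i w => big_zeta r k i w) (h2 (U' w)) w.

Definition small_est (V : Omega -> iterate) (w : Omega) : 'cV[R]_n :=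
  bmean b (fun i w => small_xi r k i w) (h1 (V w)) w +
  bmean b (fun i w => small_zeta r k i w) (h2 (V w)) w.

Let notin_past i : draw_iter i = k -> ~ past k i.
Proof. by move=> e; rewrite /past /= e ltnn. Qed.

Let mpair1 : imeas (fun t : history (past k) * S1 => U' t.1).
Proof. exact: imeas_comp measurable_fst mU'. Qed.
Let mpair2 : imeas (fun t : history (past k) * S2 => U' t.1).
Proof. exact: imeas_comp measurable_fst mU'. Qed.

Let bmean_meas D d' (S : measurableType d') (Q : probability S R) (N : nat)
    (idx : nat -> draw) (X : nat -> Omega -> S) (h : iterate -> S -> 'cV[R]_n) h'
    rd w0 l' (V : Omega -> iterate) :
  oracle Q h h' rd w0 l' -> (forall j, D (idx j)) ->
  (forall j, is_draw P sys Q (idx j) (X j)) ->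
  imeas (V : history D -> _) -> vmeas (fun w : history D => bmean N X (h (V w)) w).
Proof.
move=> o Dj dX mV; apply: (@vmeasZ _ _ (history D)); apply: vmeas_sum => j.
exact: (oracle_meas o mV (draw_measurable draw_sigma (dX j) (Dj j))).
Qed.

Lemma big_est_meas D : past k `<=` D -> (forall j, D (BigXi k j)) ->
  (forall j, D (BigZeta k j)) -> vmeas (big_est : history D -> _).
Proof.
move=> pD D1 D2; have mUD' := imeas_historyS pD mU'.
apply: vmeasD.
  exact: (bmean_meas _ o1 D1 (big_xi_draw k) mUD').
exact: (bmean_meas _ o2 D2 (big_zeta_draw k) mUD').
Qed.

Lemma small_est_meas D V : imeas (V : history D -> _) -> (forall j, D (SmallXi k j)) ->
  (forall j, D (SmallZeta k j)) -> vmeas (small_est V : history D -> _).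
Proof.
move=> mV D1 D2; apply: vmeasD.
  exact: (bmean_meas _ o1 D1 (small_xi_draw k) mV).
exact: (bmean_meas _ o2 D2 (small_zeta_draw k) mV).
Qed.

(** The two batches of size [tau] are independent and unbiased. *)
Lemma big_est_var :
  (\int[P]_w (l2norm (big_est w - m (U' w)) ^+ 2)%:E <= ((v1 + v2) / tau%:R)%:E)%E.
Proof.
have nD1 j : ~ past k (BigXi k j) by exact: notin_past.
have nD2 j : ~ past k (BigZeta k j) by exact: notin_past.
have i1 : injective (BigXi k) by move=> i j [].
have i2 : injective (BigZeta k) by move=> i j [].
have i12 i j : BigXi k i <> BigZeta k j by [].
have N1 : vmeas (fun t : history (past k) * S1 => h1 (U' t.1) t.2 - m1 (U' t.1)).
  apply: vmeasB; first exact: (oracle_meas o1 mpair1 measurable_snd).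
  exact: (oracle_meanmeas o1 mpair1).
have N2 : vmeas (fun t : history (past k) * S2 => h2 (U' t.1) t.2 - m2 (U' t.1)).
  apply: vmeasB; first exact: (oracle_meas o2 mpair2 measurable_snd).
  exact: (oracle_meanmeas o2 mpair2).
have z1 w : has_mean_mx Q1 (fun s => h1 (U' w) s - m1 (U' w)) 0.
  rewrite -(subrr (m1 (U' w))).
  exact: has_mean_mxB (oracle_mean o1 (U' w)) (has_mean_mx_cst _ _).
have z2 w : has_mean_mx Q2 (fun s => h2 (U' w) s - m2 (U' w)) 0.
  rewrite -(subrr (m2 (U' w))).
  exact: has_mean_mxB (oracle_mean o2 (U' w)) (has_mean_mx_cst _ _).
have h := two_batches draw_sigma draw_events_measurable sys_ind tau0 nD1 nD2 i1 i2 i12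
  (big_xi_draw k) (big_zeta_draw k) N1 N2 z1 z2
  (fun w => oracle_var o1 (bU' w)) (fun w => oracle_var o2 (bU' w))
  (measurable_cst v1) (measurable_cst v2) (vmeas_cst 0).
have e w : big_est w - m (U' w) =
  0 + tau%:R^-1 *: (\sum_(j < tau) (h1 (U' w) (big_xi r k j w) - m1 (U' w))) +
  tau%:R^-1 *: (\sum_(j < tau) (h2 (U' w) (big_zeta r k j w) - m2 (U' w))).
  rewrite add0r -[X in _ = X + _]/(bmean tau (fun i w => big_xi r k i w) (fun s => h1 (U' w) s - m1 (U' w)) w).
  rewrite -[X in _ = _ + X]/(bmean tau (fun i w => big_zeta r k i w) (fun s => h2 (U' w) s - m2 (U' w)) w).
  by rewrite !bmeanB !bmean_cst// /big_est /m opprD addrACA.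
under eq_integral do rewrite e.
rewrite (le_trans h)// !integral_cst1 l2_0 expr0n /= add0e.
by rewrite -!EFinM -EFinD lee_fin -mulrDr mulrC.
Qed.

Hypothesis mU : imeas (U : history (past k) -> _).
Hypothesis mv : vmeas (v : history (past k) -> _).
Hypothesis bU : forall w, l2norm (comp_z (U w)) <= rad.

Let mU1 : imeas (fun t : history (past k) * S1 => U t.1).
Proof. exact: imeas_comp measurable_fst mU. Qed.
Let mU2 : imeas (fun t : history (past k) * S2 => U t.1).
Proof. exact: imeas_comp measurable_fst mU. Qed.

(** The correction minus the increment of the exact direction is a centred batch
mean given the past, and its variance is controlled by [oracle_lip]. *)
Lemma small_est_var :
  (\int[P]_w (l2norm (v w + small_est U' w - small_est U w - m (U' w)) ^+ 2)%:E <=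
   \int[P]_w (l2norm (v w - m (U w)) ^+ 2)%:E +
   (2 * l / b%:R)%:E * \int[P]_w (dist2 (U w) (U' w))%:E)%E.
Proof.
have nD1 j : ~ past k (SmallXi k j) by exact: notin_past.
have nD2 j : ~ past k (SmallZeta k j) by exact: notin_past.
have i1 : injective (SmallXi k) by move=> i j [].
have i2 : injective (SmallZeta k) by move=> i j [].
have i12 i j : SmallXi k i <> SmallZeta k j by [].
have N1 : vmeas (fun t : history (past k) * S1 =>
    (h1 (U' t.1) t.2 - h1 (U t.1) t.2) - (m1 (U' t.1) - m1 (U t.1))).
  apply: vmeasB; apply: vmeasB.
  - exact: (oracle_meas o1 mpair1 measurable_snd).
  - exact: (oracle_meas o1 mU1 measurable_snd).
  - exact: (oracle_meanmeas o1 mpair1).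
  - exact: (oracle_meanmeas o1 mU1).
have N2 : vmeas (fun t : history (past k) * S2 =>
    (h2 (U' t.1) t.2 - h2 (U t.1) t.2) - (m2 (U' t.1) - m2 (U t.1))).
  apply: vmeasB; apply: vmeasB.
  - exact: (oracle_meas o2 mpair2 measurable_snd).
  - exact: (oracle_meas o2 mU2 measurable_snd).
  - exact: (oracle_meanmeas o2 mpair2).
  - exact: (oracle_meanmeas o2 mU2).
have z1 w : has_mean_mx Q1 (fun s => (h1 (U' w) s - h1 (U w) s) - (m1 (U' w) - m1 (U w))) 0.
  rewrite -(subrr (m1 (U' w) - m1 (U w))); apply: has_mean_mxB; last exact: has_mean_mx_cst.
  exact: has_mean_mxB (oracle_mean o1 (U' w)) (oracle_mean o1 (U w)).
have z2 w : has_mean_mx Q2 (fun s => (h2 (U' w) s - h2 (U w) s) - (m2 (U' w) - m2 (U w))) 0.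
  rewrite -(subrr (m2 (U' w) - m2 (U w))); apply: has_mean_mxB; last exact: has_mean_mx_cst.
  exact: has_mean_mxB (oracle_mean o2 (U' w)) (oracle_mean o2 (U w)).
pose q w := l * dist2 (U w) (U' w).
have mq : measurable_fun setT (q : history (past k) -> R).
  by apply: measurable_funM => //; exact: measurable_dist2.
have b1 w : (\int[Q1]_s (l2norm ((h1 (U' w) s - h1 (U w) s) -
    (m1 (U' w) - m1 (U w))) ^+ 2)%:E <= (q w)%:E)%E.
  rewrite -(integral_cst1 Q1 (q w)); apply: integral_mono => s.
    by rewrite lee_fin sqr_ge0.
  by rewrite lee_fin; exact: (oracle_lip o1).
have b2 w : (\int[Q2]_s (l2norm ((h2 (U' w) s - h2 (U w) s) -
    (m2 (U' w) - m2 (U w))) ^+ 2)%:E <= (q w)%:E)%E.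
  rewrite -(integral_cst1 Q2 (q w)); apply: integral_mono => s.
    by rewrite lee_fin sqr_ge0.
  by rewrite lee_fin; exact: (oracle_lip o2).
have mM : vmeas ((fun w => v w - m (U w)) : history (past k) -> _).
  apply: vmeasB => //; apply: vmeasD; [exact: (oracle_meanmeas o1 mU)|exact: (oracle_meanmeas o2 mU)].
have h := two_batches draw_sigma draw_events_measurable sys_ind b0 nD1 nD2 i1 i2 i12
  (small_xi_draw k) (small_zeta_draw k) N1 N2 z1 z2 b1 b2 mq mq mM.
have e w : v w + small_est U' w - small_est U w - m (U' w) =
  v w - m (U w) +
  b%:R^-1 *: (\sum_(j < b) ((h1 (U' w) (small_xi r k j w) - h1 (U w) (small_xi r k j w)) -
     (m1 (U' w) - m1 (U w)))) +
  b%:R^-1 *: (\sum_(j < b) ((h2 (U' w) (small_zeta r k j w) - h2 (U w) (small_zeta r k j w)) -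
     (m2 (U' w) - m2 (U w)))).
  rewrite -[X in _ = _ + X + _]/(bmean b (fun i w => small_xi r k i w)
    (fun s => (h1 (U' w) s - h1 (U w) s) - (m1 (U' w) - m1 (U w))) w).
  rewrite -[X in _ = _ + X]/(bmean b (fun i w => small_zeta r k i w)
    (fun s => (h2 (U' w) s - h2 (U w) s) - (m2 (U' w) - m2 (U w))) w).
  rewrite (bmeanB b _ (fun s => h1 (U' w) s - h1 (U w) s)).
  rewrite (bmeanB b _ (fun s => h2 (U' w) s - h2 (U w) s)) !bmeanB !bmean_cst//.
  rewrite /small_est /m; move: (bmean _ _ (h1 (U' w)) w) (bmean _ _ (h1 (U w)) w).
  move: (bmean _ _ (h2 (U' w)) w) (bmean _ _ (h2 (U w)) w) => A B A' B'.
  move: (m1 (U' w)) (m1 (U w)) (m2 (U' w)) (m2 (U w)) (v w) => a a' c c' V.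
  by apply/matrixP => i j; rewrite !mxE; ring.
under eq_integral do rewrite e.
rewrite (le_trans h)// -addeA leeD2l//.
have d0 w : 0 <= dist2 (U w) (U' w) by rewrite !addr_ge0// sqr_ge0.
have md : measurable_fun setT (fun w => dist2 (U w) (U' w)).
  by apply: measurable_dist2; [exact: imeas_history mU|exact: imeas_history mU'].
rewrite ge0_integralZl_fin// muleA -EFinM.
have c0 : 0 <= b%:R^-1 * l by rewrite mulr_ge0// invr_ge0.
have -> : 2 * l / b%:R = b%:R^-1 * l + b%:R^-1 * l by ring.
by rewrite EFinD ge0_muleDl.
Qed.

(** The coin is independent of both branches: with probability [p] the error is
that of a fresh batch, and otherwise it is the old error plus that of the
correction. *)
Lemma estimator_step (sel : bool * bool * bool -> bool) :
  measurable_fun setT sel -> P (coin r k @^-1` [set c | sel c]) = p%:E ->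
  (\int[P]_w (l2norm ((if sel (coin r k w) then big_est w
       else v w + small_est U' w - small_est U w) - m (U' w)) ^+ 2)%:E <=
   p%:E * ((v1 + v2) / tau%:R)%:E + (1 - p)%:E *
   (\int[P]_w (l2norm (v w - m (U w)) ^+ 2)%:E +
    (2 * l / b%:R)%:E * \int[P]_w (dist2 (U w) (U' w))%:E))%E.
Proof.
move=> msel psel; have /andP[p0 p1] := p01.
(* the past and all the samples of iteration k, but not its coin *)
pose D : set draw := past k `|` (range (BigXi k) `|` range (BigZeta k) `|`
  (range (SmallXi k) `|` range (SmallZeta k))).
have pD : past k `<=` D by move=> i ?; left.
have nD : ~ D (Coin k).
  by move=> [/notin_past|[[[]|[]]|[[]|[]]]] //; exact.
have mUD := imeas_historyS pD mU.
have mUD' := imeas_historyS pD mU'.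
have mm (V : Omega -> iterate) : imeas (V : history D -> _) ->
    vmeas (fun w : history D => m (V w)).
  by move=> mV; apply: vmeasD; [exact: (oracle_meanmeas o1 mV)|exact: (oracle_meanmeas o2 mV)].
have mbig : vmeas (big_est : history D -> _).
  apply: (big_est_meas pD) => j; right; left; first by left; exists j.
  by right; exists j.
have msmall (V : Omega -> iterate) : imeas (V : history D -> _) ->
    vmeas (small_est V : history D -> _).
  move=> mV; apply: (small_est_meas mV) => j; right; right; first by left; exists j.
  by right; exists j.
have mA : measurable_fun setT ((fun w => l2norm (big_est w - m (U' w)) ^+ 2) : history D -> R).
  by apply: measurable_l2sq; apply: vmeasB => //; exact: mm.
have mB : measurable_fun setT ((fun w => l2norm (v w + small_est U' w - small_est U w - m (U' w)) ^+ 2)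
    : history D -> R).
  apply: measurable_l2sq; apply: vmeasB; last exact: mm.
  apply: vmeasB; last exact: msmall.
  by apply: vmeasD; [exact: (vmeas_historyS pD mv)|exact: msmall].
have := coin_split draw_sigma draw_events_measurable sys_ind nD (coin_draw k) msel psel p01 mA mB
  (fun w => sqr_ge0 _) (fun w => sqr_ge0 _).
under eq_integral do rewrite -(fun_if (fun x => l2norm (x - _) ^+ 2)).
move=> ->; apply: leeD; apply: lee_wpmul2l; rewrite ?lee_fin ?subr_ge0//.
- exact: big_est_var.
- exact: small_est_var.
Qed.

Lemma estimator_meas (sel : bool * bool * bool -> bool) : measurable_fun setT sel ->
  vmeas (fun w : history (past k.+1) => if sel (coin r k w) then big_est w
       else v w + small_est U' w - small_est U w).
Proof.
move=> msel; have pk := @pastS k.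
apply: vmeas_if.
- apply: measurableT_comp msel _; apply: (draw_measurable draw_sigma (coin_draw k)).
  exact: ltnSn.
- by apply: (big_est_meas pk) => j; exact: ltnSn.
- apply: vmeasB; first apply: vmeasD.
  + exact: vmeas_historyS pk _ _ mv.
  + by apply: (small_est_meas (imeas_historyS pk mU')) => j; exact: ltnSn.
  + by apply: (small_est_meas (imeas_historyS pk mU)) => j; exact: ltnSn.
Qed.

End step.
End estimator.

(** * The stochastic derivatives as oracles *)

Section oracle_instances.
Context {R : realType} {dx dy : nat} {d' : measure_display} {S : measurableType d'}.
Context (Q : probability S R).
Local Notation iterate := (iterate R dx dy).

Lemma has_mean_mulmx m n k (A : S -> 'M[R]_(m, n)) (M : 'M[R]_(m, n)) (c : 'M[R]_(n, k)) :
  has_mean_mx Q A M -> has_mean_mx Q (fun s => A s *m c) (M *m c).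
Proof.
move=> hA i j; rewrite mxE; under eq_fun do rewrite mxE.
apply: has_mean_sum => l.
have := has_mean_lin (c l j) 0 (hA i l) (has_mean_cst Q 0).
rewrite mulr0 addr0 mulrC.
by under eq_fun do rewrite addr0 mulrC.
Qed.

Lemma opnormB_entry m n (A B : 'M[R]_(m, n)) i j : `|A i j - B i j| <= opnorm (A - B).
Proof. by have := opnorm_entry (A - B) i j; rewrite !mxE. Qed.

(** The y-direction involves only one of the two sample sources; the zero oracle
fills the other slot. *)
Lemma oracle0 n (rad l : R) : 0 <= l ->
  oracle Q (fun (_ : iterate) _ => 0 : 'cV[R]_n) (fun=> 0) rad 0 l.
Proof.
move=> l0; split.
- by move=> *; exact: vmeas_cst.
- by move=> *; exact: vmeas_cst.
- by move=> u; exact: has_mean_mx_cst.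
- move=> u _; under eq_integral do rewrite subr0 l2_0 expr0n.
  by rewrite integral_cst1.
- move=> u u' s _ _; rewrite !subr0 l2_0 expr0n /=.
  by rewrite mulr_ge0// !addr_ge0// sqr_ge0.
Qed.

Lemma oracle_opp n (h : iterate -> S -> 'cV[R]_n) m rad v l :
  oracle Q h m rad v l ->
  oracle Q (fun u s => - h u s) (fun u => - m u) rad v l.
Proof.
move=> o; split.
- by move=> *; apply: vmeasN; exact: (oracle_meas o).
- by move=> *; apply: vmeasN; exact: (oracle_meanmeas o).
- move=> u; have := has_mean_mxB (has_mean_mx_cst Q 0) (oracle_mean o u).
  by rewrite sub0r; under eq_fun do rewrite sub0r.
- move=> u hu; have := oracle_var o hu.
  by under eq_integral do rewrite -l2N opprD.
- move=> u u' s hu hu'; have := oracle_lip o s hu hu'.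
  by rewrite -l2N !opprD.
Qed.

Lemma oracle_usub n1 n2 (h : iterate -> S -> 'cV[R]_(n1 + n2)) m rad v l :
  oracle Q h m rad v l ->
  oracle Q (fun u s => usubmx (h u s)) (fun u => usubmx (m u)) rad v l.
Proof.
move=> o; split.
- by move=> *; apply: vmeas_usub; exact: (oracle_meas o).
- by move=> *; apply: vmeas_usub; exact: (oracle_meanmeas o).
- move=> u i j; have := oracle_mean o u (lshift n2 i) j.
  by rewrite mxE; under [X in _ -> has_mean _ X _]eq_fun do rewrite mxE.
- move=> u hu; apply: le_trans (oracle_var o hu); apply: integral_mono => s.
    by rewrite lee_fin sqr_ge0.
  by rewrite lee_fin -linearB lerXn2r ?nnegrE ?l2_ge0// l2_usub.
- move=> u u' s hu hu'; apply: le_trans (oracle_lip o s hu hu').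
  by rewrite -!linearB lerXn2r ?nnegrE ?l2_ge0// l2_usub.
Qed.

Lemma oracle_dsub n1 n2 (h : iterate -> S -> 'cV[R]_(n1 + n2)) m rad v l :
  oracle Q h m rad v l ->
  oracle Q (fun u s => dsubmx (h u s)) (fun u => dsubmx (m u)) rad v l.
Proof.
move=> o; split.
- by move=> *; apply: vmeas_dsub; exact: (oracle_meas o).
- by move=> *; apply: vmeas_dsub; exact: (oracle_meanmeas o).
- move=> u i j; have := oracle_mean o u (rshift n1 i) j.
  by rewrite mxE; under [X in _ -> has_mean _ X _]eq_fun do rewrite mxE.
- move=> u hu; apply: le_trans (oracle_var o hu); apply: integral_mono => s.
    by rewrite lee_fin sqr_ge0.
  by rewrite lee_fin -linearB lerXn2r ?nnegrE ?l2_ge0// l2_dsub.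
- move=> u u' s hu hu'; apply: le_trans (oracle_lip o s hu hu').
  by rewrite -!linearB lerXn2r ?nnegrE ?l2_ge0// l2_dsub.
Qed.

Lemma oracle_weaken n (h : iterate -> S -> 'cV[R]_n) m rad v l l' :
  l <= l' -> oracle Q h m rad v l -> oracle Q h m rad v l'.
Proof.
move=> ll [? ? ? ? o]; split=> // u u' s hu hu'.
by rewrite (le_trans (o _ _ s hu hu'))// ler_wpM2r// !addr_ge0// sqr_ge0.
Qed.

Lemma l2sqB2 n (a b : 'cV[R]_n) c : l2norm a ^+ 2 <= c -> l2norm b ^+ 2 <= c ->
  l2norm (a - b) ^+ 2 <= 4 * c.
Proof.
move=> ha hb; rewrite (le_trans (l2sqD2 _ _))// l2N.
by move: (l2norm a ^+ 2) (l2norm b ^+ 2) ha hb => s t; lra.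
Qed.

Definition ixy (u : iterate) := col_mx (comp_x u) (comp_y u).

Lemma ixy_dist u u' : l2norm (ixy u' - ixy u) ^+ 2 <= dist2 u u'.
Proof.
by rewrite /ixy -col_mxB l2sq_col /dist2 lerDl sqr_ge0.
Qed.

Lemma vmeas_ixy d'' (T : measurableType d'') (U : T -> iterate) : imeas U ->
  vmeas (fun t => ixy (U t)).
Proof. by move=> [mx my _]; exact: vmeas_col. Qed.

Variables (Phi : S -> 'cV[R]_(dx + dy) -> R) (phi : 'cV[R]_(dx + dy) -> R).

(** The factor 4 comes from bounding the centred difference by the difference of
the samples and that of the means. *)
Lemma oracle_grad (L sigma rad : R) : 0 <= L ->
  (forall w, has_mean_mx Q (fun s => grad (Phi s) w) (grad phi w)) ->
  (forall s, lipschitz_vec L (grad (Phi s))) -> lipschitz_vec L (grad phi) ->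
  (forall w, ('E_Q[fun s => (l2norm (grad (Phi s) w - grad phi w) ^+ 2)%R] <=
     (sigma ^+ 2)%:E)%E) ->
  oracle Q (fun u s => grad (Phi s) (ixy u)) (fun u => grad phi (ixy u))
    rad (sigma ^+ 2) (4 * L ^+ 2).
Proof.
move=> L0 hm hL hl hv; split.
- move=> d'' T U X mU mX i.
  apply: (caratheodory (phi := fun w s => grad (Phi s) w i 0)) (vmeas_ixy mU) mX.
    by move=> w; exact: has_mean_measurable (hm w i 0).
  move=> s u; exists L => v _; apply: le_trans (hL s v u).
  by have := l2_coord (grad (Phi s) v - grad (Phi s) u) i; rewrite !mxE.
- by move=> d'' T U mU; exact: vmeas_lipschitz hl (vmeas_ixy mU).
- by move=> u; exact: hm.
- by move=> u _; have := hv (ixy u); rewrite unlock.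
- move=> u u' s _ _; rewrite -mulrA; apply: l2sqB2.
    rewrite (le_trans _ (ler_wpM2l (sqr_ge0 L) (ixy_dist u u')))//.
    by rewrite -exprMn lerXn2r ?nnegrE ?mulr_ge0 ?l2_ge0//; exact: hL.
  rewrite (le_trans _ (ler_wpM2l (sqr_ge0 L) (ixy_dist u u')))//.
  by rewrite -exprMn lerXn2r ?nnegrE ?mulr_ge0 ?l2_ge0//; exact: hl.
Qed.

(** One Hessian-vector product whose blocks are [hess12 h x y *m z] and
[hess22 h x y *m z]. *)
Definition hvp (h : 'cV[R]_(dx + dy) -> R) (u : iterate) : 'cV[R]_(dx + dy) :=
  hess h (ixy u) *m col_mx 0 (comp_z u).

(** The map (w, z) |-> hess h w (0, z) is bilinear: moving [w] costs
L' times |z| <= [rad], and moving [z] costs the bound on the Hessian. *)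
Lemma hvp_lip h (L L' rad : R) u u' : 0 <= L -> 0 <= L' ->
  twice_differentiable h -> lipschitz_vec L (grad h) -> lipschitz_mx L' (hess h) ->
  l2norm (comp_z u') <= rad ->
  l2norm (hvp h u' - hvp h u) ^+ 2 <= 2 * ((L' * rad) ^+ 2 + L ^+ 2) * dist2 u u'.
Proof.
move=> L0 L'0 dh hL hL' zr.
have -> : hvp h u' - hvp h u =
    (hess h (ixy u') - hess h (ixy u)) *m col_mx 0 (comp_z u') +
    hess h (ixy u) *m col_mx 0 (comp_z u' - comp_z u).
  rewrite -[X in col_mx X (comp_z u' - _)](subr0 0) col_mxB mulmxBr mulmxBl /hvp.
  by rewrite addrA subrK.
rewrite (le_trans (l2sqD2 _ _))// -mulrA ler_wpM2l//.
have r0 : 0 <= rad by rewrite (le_trans _ zr)// l2_ge0.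
have d1 : l2norm ((hess h (ixy u') - hess h (ixy u)) *m col_mx 0 (comp_z u')) ^+ 2 <=
    (L' * rad) ^+ 2 * l2norm (ixy u' - ixy u) ^+ 2.
  rewrite -exprMn lerXn2r ?nnegrE ?mulr_ge0 ?l2_ge0//.
  rewrite (le_trans (opnormP _ _))// l2_0col mulrAC.
  by apply: ler_pM; rewrite ?opnorm_ge0 ?l2_ge0//; exact: hL'.
have d2 : l2norm (hess h (ixy u) *m col_mx 0 (comp_z u' - comp_z u)) ^+ 2 <=
    L ^+ 2 * l2norm (comp_z u' - comp_z u) ^+ 2.
  rewrite -exprMn lerXn2r ?nnegrE ?mulr_ge0 ?l2_ge0//.
  by rewrite (le_trans (hess_bound _ _ L0 L'0 dh hL hL'))// l2_0col.
rewrite (le_trans (lerD d1 d2))// /ixy -col_mxB l2sq_col /dist2.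
have sx := sqr_ge0 (l2norm (comp_x u' - comp_x u)).
have sy := sqr_ge0 (l2norm (comp_y u' - comp_y u)).
have sz := sqr_ge0 (l2norm (comp_z u' - comp_z u)).
move: (l2norm (comp_x u' - comp_x u) ^+ 2) (l2norm (comp_y u' - comp_y u) ^+ 2)
  (l2norm (comp_z u' - comp_z u) ^+ 2) sx sy sz => A B C A0 B0 C0.
have := sqr_ge0 (L' * rad); have := sqr_ge0 L.
move: ((L' * rad) ^+ 2) (L ^+ 2) => s t t0 s0.
have := mulr_ge0 s0 C0; have := mulr_ge0 t0 A0; have := mulr_ge0 t0 B0; lra.
Qed.

(** The variance of the product is at most |z|^2 times that of the Hessian; the
radius is increased by 1 so that it may be divided by. *)
Lemma oracle_hvp (L L' sigma rad : R) : 0 <= L -> 0 <= L' -> 0 <= rad ->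
  (forall w, has_mean_mx Q (fun s => hess (Phi s) w) (hess phi w)) ->
  (forall s, twice_differentiable (Phi s)) -> twice_differentiable phi ->
  (forall s, lipschitz_vec L (grad (Phi s))) -> lipschitz_vec L (grad phi) ->
  (forall s, lipschitz_mx L' (hess (Phi s))) -> lipschitz_mx L' (hess phi) ->
  (forall w, ('E_Q[fun s => (opnorm (hess (Phi s) w - hess phi w) ^+ 2)%R] <=
     (sigma ^+ 2)%:E)%E) ->
  oracle Q (fun u s => hvp (Phi s) u) (fun u => hvp phi u)
    rad (((rad + 1) * sigma) ^+ 2) (8 * ((L' * rad) ^+ 2 + L ^+ 2)).
Proof.
move=> L0 L'0 r0 hm dP dp gP gp hP hp hv.
have mz d'' (T : measurableType d'') (U : T -> iterate) : imeas U ->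
    vmeas (fun t => col_mx (0 : 'cV[R]_dx) (comp_z (U t))).
  by move=> [_ _ muz]; apply: vmeas_col => //; exact: vmeas_cst.
have mmean u : has_mean_mx Q (fun s => hvp (Phi s) u) (hvp phi u).
  exact: has_mean_mulmx (hm (ixy u)).
split.
- move=> d'' T U X mU mX; apply: vmeas_mulmx (mz _ _ _ mU) => i j.
  apply: (caratheodory (phi := fun w s => hess (Phi s) w i j)) (vmeas_ixy mU) mX.
    by move=> w; exact: has_mean_measurable (hm w i j).
  move=> s u; exists L' => v _; apply: le_trans (hP s v u).
  exact: opnormB_entry.
- move=> d'' T U mU; apply: vmeas_mulmx (mz _ _ _ mU) => i j.
  apply: (measurable_loclip (phi := fun w => hess phi w i j)) (vmeas_ixy mU).
  move=> u; exists L' => v _; apply: le_trans (hp v u).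
  exact: opnormB_entry.
- exact: mmean.
- move=> u zr.
  have rp : 0 < rad + 1 by rewrite ltr_wpDl.
  have := hv (ixy u); rewrite unlock => hvu.
  have mN : measurable_fun setT (fun s => l2norm ((rad + 1)^-1 *: (hvp (Phi s) u - hvp phi u)) ^+ 2).
    apply/measurable_l2sq/vmeasZ/vmeasB; last exact: vmeas_cst.
    exact: has_mean_vmeas (mmean u).
  have e s : l2norm (hvp (Phi s) u - hvp phi u) ^+ 2 = (rad + 1) ^+ 2 *
      l2norm ((rad + 1)^-1 *: (hvp (Phi s) u - hvp phi u)) ^+ 2.
    rewrite l2Z ger0_norm ?invr_ge0 ?(ltW rp)// -exprMn mulrA mulfV ?mul1r//.
    by rewrite gt_eqF.
  under eq_integral do rewrite e.
  rewrite ge0_integralZl_fin ?sqr_ge0//; last by move=> s; exact: sqr_ge0.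
  rewrite exprMn [leRHS]EFinM; apply: lee_wpmul2l; first by rewrite lee_fin sqr_ge0.
  apply: le_trans hvu; apply: integral_mono => s.
    by rewrite lee_fin sqr_ge0.
  rewrite lee_fin lerXn2r ?nnegrE ?l2_ge0 ?opnorm_ge0//.
  rewrite l2Z ger0_norm ?invr_ge0 ?(ltW rp)// ler_pdivrMl// mulrC.
  rewrite /hvp -mulmxBl (le_trans (opnormP _ _))// l2_0col ler_wpM2l ?opnorm_ge0//.
  by rewrite (le_trans zr)// lerDl.
- move=> u u' s zu zu'.
  have -> : 8 * ((L' * rad) ^+ 2 + L ^+ 2) * dist2 u u' =
    4 * (2 * ((L' * rad) ^+ 2 + L ^+ 2) * dist2 u u') by ring.
  apply: l2sqB2.
    exact: (hvp_lip u L0 L'0 (dP s) (gP s) (hP s) zu').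
  exact: (hvp_lip u L0 L'0 dp gp hp zu').
Qed.

End oracle_instances.

(** * Estimation error along the iterations *)

Lemma adde3ACA {R : realType} (a1 a2 a3 b1 b2 b3 : \bar R) :
  ((a1 + b1) + (a2 + b2) + (a3 + b3) = (a1 + a2 + a3) + (b1 + b2 + b3))%E.
Proof. by rewrite (addeACA a1) (addeACA (a1 + a2)%E). Qed.

Lemma vmeas_ext {R : realType} d (T : measurableType d) n (f f' : T -> 'cV[R]_n) :
  (forall t, f t = f' t) -> vmeas f' -> vmeas f.
Proof. by move=> /funext ->. Qed.

Section spaba_estimates.
Context {R : realType} {dx dy : nat} {d d1 d2 : measure_display}.
Context {Omega : measurableType d} {S1 : measurableType d1} {S2 : measurableType d2}.
Context (P : probability Omega R) (Q1 : probability S1 R) (Q2 : probability S2 R).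
Variables (r : randomness Omega S1 S2) (p : R).
Hypothesis hs : sampling r P Q1 Q2 p.
Hypothesis p01 : 0 <= p <= 1.
Variables (f g : 'cV[R]_(dx + dy) -> R).
Variables (F : S1 -> 'cV[R]_(dx + dy) -> R) (G : S2 -> 'cV[R]_(dx + dy) -> R).
Variables (Lf Cf L1 L2 mu sf s1 s2 : R).
Hypotheses (Lf0 : 0 <= Lf) (Cf0 : 0 <= Cf) (L10 : 0 <= L1) (L20 : 0 <= L2).
Hypothesis (mu0 : 0 < mu).
Hypothesis A : bilevel_assumptions Q1 Q2 f g F G Lf Cf L1 L2 mu sf s1 s2.

Local Notation iterate := (iterate R dx dy).
Local Notation Rz := (Rz Cf mu).
Local Notation history := (history (draw_events r)).

Let Ao := bilevel_oracle A.
Let Af := bilevel_upper A.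
Let Ag := bilevel_lower A.
Let Av := bilevel_variance A.
Let Al := bilevel_lipschitz A.

(** A squared Lipschitz constant common to all the oracles. *)
Definition csmooth : R := 4 * Lf ^+ 2 + 8 * ((L2 * Rz) ^+ 2 + L1 ^+ 2).
Definition vhess : R := ((Rz + 1) * s2) ^+ 2.
(** The sum over x, y and z of the variances of a single sample. *)
Definition csigma : R := 2 * sf ^+ 2 + 2 * vhess + s1 ^+ 2.

Let sq0 (x : R) : 0 <= x ^+ 2. Proof. exact: sqr_ge0. Qed.

Lemma csmooth0 : 0 <= csmooth.
Proof. by rewrite addr_ge0 ?mulr_ge0 ?addr_ge0. Qed.

Let hx1 (u : iterate) s := usubmx (grad (F s) (ixy u)).
Let hx2 (u : iterate) s : 'cV[R]_dx := - usubmx (hvp (G s) u).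
Let hy1 (u : iterate) (s : S1) : 'cV[R]_dy := 0.
Let hy2 (u : iterate) s := dsubmx (grad (G s) (ixy u)).
Let hz1 (u : iterate) s : 'cV[R]_dy := - dsubmx (grad (F s) (ixy u)).
Let hz2 (u : iterate) s := dsubmx (hvp (G s) u).
Let mx1 (u : iterate) := usubmx (grad f (ixy u)).
Let mx2 (u : iterate) : 'cV[R]_dx := - usubmx (hvp g u).
Let my1 (u : iterate) : 'cV[R]_dy := 0.
Let my2 (u : iterate) := dsubmx (grad g (ixy u)).
Let mz1 (u : iterate) : 'cV[R]_dy := - dsubmx (grad f (ixy u)).
Let mz2 (u : iterate) := dsubmx (hvp g u).

Let oF : oracle Q1 (fun u s => grad (F s) (ixy u)) (fun u => grad f (ixy u)) Rz
  (sf ^+ 2) csmooth.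
Proof.
apply: (oracle_weaken (l := 4 * Lf ^+ 2)).
  by rewrite lerDl mulr_ge0// addr_ge0.
apply: oracle_grad => //; [exact: gradF_mean Ao|exact: gradF_lipschitz Al
  |exact: gradf_lipschitz Af|exact: gradF_variance Av].
Qed.

Let oG : oracle Q2 (fun u s => grad (G s) (ixy u)) (fun u => grad g (ixy u)) Rz
  (s1 ^+ 2) csmooth.
Proof.
apply: (oracle_weaken (l := 4 * L1 ^+ 2)).
  have := sq0 Lf; have := sq0 (L2 * Rz); have := sq0 L1; rewrite /csmooth.
  by move: (Lf ^+ 2) ((L2 * Rz) ^+ 2) (L1 ^+ 2) => a b c; lra.
apply: oracle_grad => //; [exact: gradG_mean Ao|exact: gradG_lipschitz Al
  |exact: gradg_lipschitz Ag|exact: gradG_variance Av].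
Qed.

Let oH : oracle Q2 (fun u s => hvp (G s) u) (fun u => hvp g u) Rz vhess csmooth.
Proof.
apply: (oracle_weaken (l := 8 * ((L2 * Rz) ^+ 2 + L1 ^+ 2))).
  by rewrite lerDr mulr_ge0.
apply: oracle_hvp => //; [exact: Rz0|exact: hessG_mean Ao|exact: G_differentiable Ao
  |exact: g_differentiable Ag|exact: gradG_lipschitz Al|exact: gradg_lipschitz Ag
  |exact: hessG_lipschitz Al|exact: hessg_lipschitz Ag|exact: hessG_variance Av].
Qed.

Let ox1 : oracle Q1 hx1 mx1 Rz (sf ^+ 2) csmooth. Proof. exact: oracle_usub. Qed.
Let ox2 : oracle Q2 hx2 mx2 Rz vhess csmooth.
Proof. by apply: oracle_opp; exact: oracle_usub. Qed.
Let oy1 : oracle Q1 hy1 my1 Rz 0 csmooth. Proof. exact/oracle0/csmooth0. Qed.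
Let oy2 : oracle Q2 hy2 my2 Rz (s1 ^+ 2) csmooth. Proof. exact: oracle_dsub. Qed.
Let oz1 : oracle Q1 hz1 mz1 Rz (sf ^+ 2) csmooth.
Proof. by apply: oracle_opp; exact: oracle_dsub. Qed.
Let oz2 : oracle Q2 hz2 mz2 Rz vhess csmooth. Proof. exact: oracle_dsub. Qed.

Lemma sample_mean_bmean (S : Type) n N (X : nat -> Omega -> S) (h : S -> 'cV[R]_n) w :
  sample_mean (mkseq (fun i => X i w) N) h = bmean N X h w.
Proof.
rewrite /sample_mean size_mkseq big_map; congr (_ *: _).
have -> : iota 0 N = index_iota 0 N by rewrite /index_iota subn0.
by rewrite big_mkord.
Qed.

Lemma bmeanN (S : Type) n N (X : nat -> Omega -> S) (h : S -> 'cV[R]_n) w :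
  bmean N X (fun s => - h s) w = - bmean N X h w.
Proof. by rewrite /bmean sumrN scalerN. Qed.

Lemma Dhat_x N (X : nat -> Omega -> S1) (Z : nat -> Omega -> S2) u w :
  comp_x (Dhat F G u (mkseq (fun i => X i w) N) (mkseq (fun i => Z i w) N)) =
  bmean N X (hx1 u) w + bmean N Z (hx2 u) w.
Proof.
case: u => x y z; rewrite /= !sample_mean_bmean /hx2 bmeanN; congr (_ - _ *: _).
by apply: eq_bigr => j _; exact: hess12E.
Qed.

Lemma Dhat_y N (X : nat -> Omega -> S1) (Z : nat -> Omega -> S2) u w : (0 < N)%N ->
  comp_y (Dhat F G u (mkseq (fun i => X i w) N) (mkseq (fun i => Z i w) N)) =
  bmean N X (hy1 u) w + bmean N Z (hy2 u) w.
Proof.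
by move=> N0; case: u => x y z; rewrite /= sample_mean_bmean bmean_cst// add0r.
Qed.

Lemma Dhat_z N (X : nat -> Omega -> S1) (Z : nat -> Omega -> S2) u w :
  comp_z (Dhat F G u (mkseq (fun i => X i w) N) (mkseq (fun i => Z i w) N)) =
  bmean N X (hz1 u) w + bmean N Z (hz2 u) w.
Proof.
case: u => x y z; rewrite /= !sample_mean_bmean /hz1 bmeanN addrC; congr (_ + _ *: _).
by apply: eq_bigr => j _; exact: hess22E.
Qed.

Lemma dirx_mean u : dirx f g (comp_x u) (comp_y u) (comp_z u) = mx1 u + mx2 u.
Proof. by rewrite /dirx hess12E. Qed.

Lemma dirz_mean u : dirz f g (comp_x u) (comp_y u) (comp_z u) = mz1 u + mz2 u.
Proof. by rewrite /dirz hess22E addrC. Qed.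

Lemma diry_mean u : grad2 g (comp_x u) (comp_y u) = my1 u + my2 u.
Proof. by rewrite add0r. Qed.

Variables (alpha beta gamma : R) (tau b : nat) (u0 : iterate).
Hypotheses (tau0 : (0 < tau)%N) (b0 : (0 < b)%N).
Hypothesis z0b : l2norm (comp_z u0) <= Rz.

Lemma big_Dhat_x k U w :
  comp_x (big_Dhat F G tau r k w (U w)) = big_est r hx1 hx2 tau k U w.
Proof. exact: (@Dhat_x tau (fun i w => big_xi r k i w) (fun i w => big_zeta r k i w) (U w) w). Qed.

Lemma small_Dhat_x k U w :
  comp_x (small_Dhat F G b r k w (U w)) = small_est r hx1 hx2 b k U w.
Proof. exact: (@Dhat_x b (fun i w => small_xi r k i w) (fun i w => small_zeta r k i w) (U w) w). Qed.

Lemma big_Dhat_y k U w :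
  comp_y (big_Dhat F G tau r k w (U w)) = big_est r hy1 hy2 tau k U w.
Proof. exact: (@Dhat_y tau (fun i w => big_xi r k i w) (fun i w => big_zeta r k i w) (U w) w tau0). Qed.

Lemma small_Dhat_y k U w :
  comp_y (small_Dhat F G b r k w (U w)) = small_est r hy1 hy2 b k U w.
Proof. exact: (@Dhat_y b (fun i w => small_xi r k i w) (fun i w => small_zeta r k i w) (U w) w b0). Qed.

Lemma big_Dhat_z k U w :
  comp_z (big_Dhat F G tau r k w (U w)) = big_est r hz1 hz2 tau k U w.
Proof. exact: (@Dhat_z tau (fun i w => big_xi r k i w) (fun i w => big_zeta r k i w) (U w) w). Qed.

Lemma small_Dhat_z k U w :
  comp_z (small_Dhat F G b r k w (U w)) = small_est r hz1 hz2 b k U w.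
Proof. exact: (@Dhat_z b (fun i w => small_xi r k i w) (fun i w => small_zeta r k i w) (U w) w). Qed.

Definition iter_u k w := (spaba F G (Cf / mu) alpha beta gamma tau b r u0 k w).1.
Definition iter_v k w := (spaba F G (Cf / mu) alpha beta gamma tau b r u0 k w).2.

Lemma iter_uS k w :
  iter_u k.+1 w = update (Cf / mu) alpha beta gamma (iter_u k w) (iter_v k w).
Proof. by rewrite /iter_u /iter_v /=; case: spaba. Qed.

Lemma iter_vS k w : iter_v k.+1 w =
  estimate F G tau b r k.+1 w (iter_u k w) (iter_v k w) (iter_u k.+1 w).
Proof. by rewrite /iter_u /iter_v /=; case: spaba. Qed.

Lemma iter_ball k w : l2norm (comp_z (iter_u k w)) <= Rz.
Proof.
case: k => [//|k]; rewrite iter_uS /=; apply: proj_ball_in; exact: Rz0.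
Qed.

Let sel_x (c : bool * bool * bool) := c.1.1.
Let sel_y (c : bool * bool * bool) := c.1.2.
Let sel_z (c : bool * bool * bool) := c.2.
Let msel_x : measurable_fun setT sel_x.
Proof. exact: measurableT_comp measurable_fst measurable_fst. Qed.
Let msel_y : measurable_fun setT sel_y.
Proof. exact: measurableT_comp measurable_snd measurable_fst. Qed.
Let msel_z : measurable_fun setT sel_z.
Proof. exact: measurable_snd. Qed.

Lemma iter_vS_x k w : comp_x (iter_v k.+1 w) =
  if sel_x (coin r k.+1 w) then big_est r hx1 hx2 tau k.+1 (iter_u k.+1) w
  else comp_x (iter_v k w) + small_est r hx1 hx2 b k.+1 (iter_u k.+1) w -
       small_est r hx1 hx2 b k.+1 (iter_u k) w.
Proof. by rewrite iter_vS -big_Dhat_x -!small_Dhat_x. Qed.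

Lemma iter_vS_y k w : comp_y (iter_v k.+1 w) =
  if sel_y (coin r k.+1 w) then big_est r hy1 hy2 tau k.+1 (iter_u k.+1) w
  else comp_y (iter_v k w) + small_est r hy1 hy2 b k.+1 (iter_u k.+1) w -
       small_est r hy1 hy2 b k.+1 (iter_u k) w.
Proof. by rewrite iter_vS -big_Dhat_y -!small_Dhat_y. Qed.

Lemma iter_vS_z k w : comp_z (iter_v k.+1 w) =
  if sel_z (coin r k.+1 w) then big_est r hz1 hz2 tau k.+1 (iter_u k.+1) w
  else comp_z (iter_v k w) + small_est r hz1 hz2 b k.+1 (iter_u k.+1) w -
       small_est r hz1 hz2 b k.+1 (iter_u k) w.
Proof. by rewrite iter_vS -big_Dhat_z -!small_Dhat_z. Qed.

Lemma iter_v0_x w : comp_x (iter_v 0 w) = big_est r hx1 hx2 tau 0 (iter_u 0) w.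
Proof. by rewrite -big_Dhat_x. Qed.
Lemma iter_v0_y w : comp_y (iter_v 0 w) = big_est r hy1 hy2 tau 0 (iter_u 0) w.
Proof. by rewrite -big_Dhat_y. Qed.
Lemma iter_v0_z w : comp_z (iter_v 0 w) = big_est r hz1 hz2 tau 0 (iter_u 0) w.
Proof. by rewrite -big_Dhat_z. Qed.

Let mu_0 D : imeas (iter_u 0 : history D -> _).
Proof. by split; exact: vmeas_cst. Qed.

Let muS k D : imeas (iter_u k : history D -> _) -> imeas (iter_v k : history D -> _) ->
  imeas (iter_u k.+1 : history D -> _).
Proof.
move=> [mx my mz] [nx ny nz].
have e : iter_u k.+1 = fun w => update (Cf / mu) alpha beta gamma (iter_u k w) (iter_v k w).
  by apply/funext => w; exact: iter_uS.
rewrite e; split => /=.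
- by apply: vmeasB => //; exact: vmeasZ.
- by apply: vmeasB => //; exact: vmeasZ.
- apply: vmeas_lipschitz (proj_ball_lip (Rz0 Cf0 mu0)) _.
  by apply: vmeasB => //; exact: vmeasZ.
Qed.

(** The point u_k is determined by the draws before iteration [k], and the estimator
v_k by those up to iteration [k]. *)
Lemma iter_meas k : imeas (iter_u k : history (past k) -> _) /\
  imeas (iter_u k : history (past k.+1) -> _) /\
  imeas (iter_v k : history (past k.+1) -> _).
Proof.
elim: k => [|k [_ [ihu ihv]]].
  split; [exact: mu_0|split; [exact: mu_0|split]].
  - apply: (@vmeas_ext _ _ (history (past 1)) _ _ _ iter_v0_x).
    by apply: (big_est_meas hs ox1 ox2 tau (mu_0 (past 0)) (@pastS 0)) => j; exact: ltnSn.
  - apply: (@vmeas_ext _ _ (history (past 1)) _ _ _ iter_v0_y).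
    by apply: (big_est_meas hs oy1 oy2 tau (mu_0 (past 0)) (@pastS 0)) => j; exact: ltnSn.
  - apply: (@vmeas_ext _ _ (history (past 1)) _ _ _ iter_v0_z).
    by apply: (big_est_meas hs oz1 oz2 tau (mu_0 (past 0)) (@pastS 0)) => j; exact: ltnSn.
have mS := muS ihu ihv; have [vx vy vz] := ihv.
split => //; split; first exact: imeas_historyS (@pastS k.+1) mS.
split.
- apply: (@vmeas_ext _ _ (history (past k.+2)) _ _ _ (iter_vS_x k)).
  exact: (estimator_meas hs ox1 ox2 tau b mS ihu vx msel_x).
- apply: (@vmeas_ext _ _ (history (past k.+2)) _ _ _ (iter_vS_y k)).
  exact: (estimator_meas hs oy1 oy2 tau b mS ihu vy msel_y).
- apply: (@vmeas_ext _ _ (history (past k.+2)) _ _ _ (iter_vS_z k)).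
  exact: (estimator_meas hs oz1 oz2 tau b mS ihu vz msel_z).
Qed.

Lemma iter_u_meas k : imeas (iter_u k).
Proof. by have [h _] := iter_meas k; exact: imeas_history h. Qed.

Lemma iter_v_meas k : imeas (iter_v k).
Proof. by have [_ [_ h]] := iter_meas k; exact: imeas_history h. Qed.

Lemma errE_split k : (\int[P]_w (errE f g (iter_u k w) (iter_v k w))%:E =
  \int[P]_w (l2norm (comp_x (iter_v k w) - (mx1 (iter_u k w) + mx2 (iter_u k w))) ^+ 2)%:E +
  \int[P]_w (l2norm (comp_y (iter_v k w) - (my1 (iter_u k w) + my2 (iter_u k w))) ^+ 2)%:E +
  \int[P]_w (l2norm (comp_z (iter_v k w) - (mz1 (iter_u k w) + mz2 (iter_u k w))) ^+ 2)%:E)%E.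
Proof.
have mU := iter_u_meas k; have [vx vy vz] := iter_v_meas k.
have mX : measurable_fun setT (fun w => l2norm (comp_x (iter_v k w) -
    (mx1 (iter_u k w) + mx2 (iter_u k w))) ^+ 2).
  apply/measurable_l2sq/vmeasB => //; apply: vmeasD.
    exact: (oracle_meanmeas ox1 mU).
  exact: (oracle_meanmeas ox2 mU).
have mY : measurable_fun setT (fun w => l2norm (comp_y (iter_v k w) -
    (my1 (iter_u k w) + my2 (iter_u k w))) ^+ 2).
  apply/measurable_l2sq/vmeasB => //; apply: vmeasD.
    exact: (oracle_meanmeas oy1 mU).
  exact: (oracle_meanmeas oy2 mU).
have mZ : measurable_fun setT (fun w => l2norm (comp_z (iter_v k w) -
    (mz1 (iter_u k w) + mz2 (iter_u k w))) ^+ 2).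
  apply/measurable_l2sq/vmeasB => //; apply: vmeasD.
    exact: (oracle_meanmeas oz1 mU).
  exact: (oracle_meanmeas oz2 mU).
under eq_integral do rewrite /errE dirx_mean diry_mean dirz_mean.
rewrite ge0_integralD_fin ?ge0_integralD_fin//.
- by move=> w; rewrite addr_ge0.
- exact: measurable_funD.
Qed.

Lemma errE_meas k : measurable_fun setT (fun w => errE f g (iter_u k w) (iter_v k w)).
Proof.
have mU := iter_u_meas k; have [vx vy vz] := iter_v_meas k.
under eq_fun do rewrite /errE dirx_mean diry_mean dirz_mean.
apply: measurable_funD; first apply: measurable_funD.
- apply/measurable_l2sq/vmeasB => //; apply: vmeasD.
    exact: (oracle_meanmeas ox1 mU).
  exact: (oracle_meanmeas ox2 mU).
- apply/measurable_l2sq/vmeasB => //; apply: vmeasD.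
    exact: (oracle_meanmeas oy1 mU).
  exact: (oracle_meanmeas oy2 mU).
- apply/measurable_l2sq/vmeasB => //; apply: vmeasD.
    exact: (oracle_meanmeas oz1 mU).
  exact: (oracle_meanmeas oz2 mU).
Qed.

Lemma errE_init : (\int[P]_w (errE f g (iter_u 0 w) (iter_v 0 w))%:E <=
  (csigma / tau%:R)%:E)%E.
Proof.
rewrite errE_split.
under eq_integral do rewrite iter_v0_x.
under [X in (_ + X + _)%E]eq_integral do rewrite iter_v0_y.
under [X in (_ + _ + X)%E]eq_integral do rewrite iter_v0_z.
have v0 : 0 <= vhess by exact: sq0.
have hx := big_est_var hs ox1 ox2 tau0 (mu_0 (past 0)) (iter_ball 0).
have hy := big_est_var hs oy1 oy2 tau0 (mu_0 (past 0)) (iter_ball 0).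
have hz := big_est_var hs oz1 oz2 tau0 (mu_0 (past 0)) (iter_ball 0).
rewrite (le_trans (leeD (leeD hx hy) hz))// -!EFinD lee_fin -!mulrDl ler_wpM2r//.
by rewrite /csigma; lra.
Qed.

(** The sum of [estimator_step] over the three components; they may share their
coin, as only sums of expectations are involved. *)
Lemma errE_rec k : (\int[P]_w (errE f g (iter_u k.+1 w) (iter_v k.+1 w))%:E <=
  p%:E * (csigma / tau%:R)%:E + (1 - p)%:E *
  (\int[P]_w (errE f g (iter_u k w) (iter_v k w))%:E +
   (6 * csmooth / b%:R)%:E * \int[P]_w (dist2 (iter_u k w) (iter_u k.+1 w))%:E))%E.
Proof.
rewrite [X in (X <= _)%E]errE_split.
rewrite [X in (_ <= _ + _ * (X + _))%E]errE_split.
under eq_integral do rewrite iter_vS_x.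
under [X in (_ + X + _ <= _)%E]eq_integral do rewrite iter_vS_y.
under [X in (_ + _ + X <= _)%E]eq_integral do rewrite iter_vS_z.
have [_ [mUk mVk]] := iter_meas k; have [mU' _] := iter_meas k.+1.
have [vx vy vz] := mVk.
have hx := estimator_step hs p01 ox1 ox2 csmooth0 tau0 b0 mU' (iter_ball k.+1)
  mUk vx (iter_ball k) msel_x (coin_x_law hs k.+1).
have hy := estimator_step hs p01 oy1 oy2 csmooth0 tau0 b0 mU' (iter_ball k.+1)
  mUk vy (iter_ball k) msel_y (coin_y_law hs k.+1).
have hz := estimator_step hs p01 oz1 oz2 csmooth0 tau0 b0 mU' (iter_ball k.+1)
  mUk vz (iter_ball k) msel_z (coin_z_law hs k.+1).
apply: (le_trans (leeD (leeD hx hy) hz)).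
have /andP[p0 p1] := p01.
set D := (\int[P]_w (dist2 _ _)%:E)%E.
set EX := (\int[P]_w (l2norm (comp_x _ - _) ^+ 2)%:E)%E.
set EY := (\int[P]_w (l2norm (comp_y _ - _) ^+ 2)%:E)%E.
set EZ := (\int[P]_w (l2norm (comp_z _ - _) ^+ 2)%:E)%E.
have D0 : (0 <= D)%E.
  by apply: integral_ge0 => w _; rewrite lee_fin !addr_ge0.
have EX0 : (0 <= EX)%E by apply: integral_ge0 => w _; rewrite lee_fin.
have EY0 : (0 <= EY)%E by apply: integral_ge0 => w _; rewrite lee_fin.
have EZ0 : (0 <= EZ)%E by apply: integral_ge0 => w _; rewrite lee_fin.
move: EX EY EZ D EX0 EY0 EZ0 D0 => EX EY EZ D EX0 EY0 EZ0 D0 {hx hy hz}.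
have e0 : 0 <= 2 * csmooth / b%:R by rewrite divr_ge0// mulr_ge0// csmooth0.
have q0 : (0 <= (1 - p)%:E)%E by rewrite lee_fin subr_ge0.
have eD0 : (0 <= (2 * csmooth / b%:R)%:E * D)%E by rewrite mule_ge0.
set eD := (_ * D)%E in eD0 *.
have X1 : (0 <= EX + eD)%E by exact: adde_ge0 EX0 eD0.
have Y1 : (0 <= EY + eD)%E by exact: adde_ge0 EY0 eD0.
have Z1 : (0 <= EZ + eD)%E by exact: adde_ge0 EZ0 eD0.
have XY1 : (0 <= EX + eD + (EY + eD))%E by exact: adde_ge0 X1 Y1.
rewrite adde3ACA -!EFinM -!EFinD -!ge0_muleDr//.
apply: leeD; first by rewrite lee_fin -!mulrDr ler_wpM2l// -!mulrDl ler_wpM2r//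
  /csigma; lra.
apply: lee_wpmul2l => //.
rewrite adde3ACA; apply: leeD => //.
have e1 : (0 <= (2 * csmooth / b%:R)%:E)%E by rewrite lee_fin.
have e2 : (0 <= (2 * csmooth / b%:R)%:E + (2 * csmooth / b%:R)%:E)%E by exact: adde_ge0.
rewrite /eD -!ge0_muleDl// -!EFinD.
apply: lee_wpmul2r => //; rewrite lee_fin le_eqVlt; apply/orP; left; apply/eqP.
by ring.
Qed.

End spaba_estimates.

(** * Telescoping in expectation *)

Section real_sequences.
Context {R : realType}.

(** With lam * p = (n + 1/8) * alpha, the reset of the error pays for the term
n * alpha * e of the potential and leaves alpha / 8 * e; the growth of the error is paid
by this remainder and by the slack alpha / 8 * s. *)
Lemma lyapunov_sum (psi gr s e : nat -> R) (alpha n p lam v c : R) (K : nat) :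
  (forall k, 0 <= psi k) -> (forall k, 0 <= e k) -> (forall k, 0 <= s k) ->
  0 <= lam -> 0 <= alpha ->
  (forall k, psi k.+1 + alpha / 2 * gr k + alpha / 8 * s k <= psi k + n * alpha * e k) ->
  (forall k, e k.+1 <= p * v + (1 - p) * (e k + c * (s k + e k))) ->
  lam * p = (n + 8^-1) * alpha -> lam * ((1 - p) * c) <= alpha / 8 ->
  alpha / 2 * (\sum_(k < K) gr k) <= psi 0 + lam * e 0 + K%:R * (lam * p * v).
Proof.
move=> psi0 e0 s0 lam0 a0 h1 h2 hl hc.
suff H : psi K + lam * e K + alpha / 2 * (\sum_(k < K) gr k) <=
    psi 0 + lam * e 0 + K%:R * (lam * p * v).
  apply: le_trans H; rewrite -[leLHS]add0r lerD2r addr_ge0//.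
  by rewrite mulr_ge0.
elim: K => [|K ih]; first by rewrite big_ord0 mulr0 mul0r.
rewrite big_ord_recr /= -[K.+1%:R]natr1.
have h3 := ler_wpM2l lam0 (h2 K).
have h4 := ler_wpM2r (addr_ge0 (s0 K) (e0 K)) hc.
have := h1 K; move: h3 h4 ih.
move: (psi K.+1) (e K.+1) (psi K) (e K) (s K) (gr K) (\sum_(i < K) gr i) => p1 e1 p2 e2 t g S.
have -> : lam * (p * v + (1 - p) * (e2 + c * (t + e2))) =
  lam * p * v + lam * e2 - lam * p * e2 + lam * ((1 - p) * c) * (t + e2) by ring.
by rewrite hl; lra.
Qed.

End real_sequences.

Section expected_descent.
Context {R : realType} {dx dy : nat} {d d1 d2 : measure_display}.
Context {Omega : measurableType d} {S1 : measurableType d1} {S2 : measurableType d2}.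
Context (P : probability Omega R) (Q1 : probability S1 R) (Q2 : probability S2 R).
Variables (r : randomness Omega S1 S2) (p : R).
Hypothesis hs : sampling r P Q1 Q2 p.
Hypothesis p01 : 0 < p <= 1.
Variables (f g : 'cV[R]_(dx + dy) -> R).
Variables (F : S1 -> 'cV[R]_(dx + dy) -> R) (G : S2 -> 'cV[R]_(dx + dy) -> R).
Variables (Lf Cf L1 L2 mu sf s1 s2 : R).
Hypotheses (Lf0 : 0 <= Lf) (Cf0 : 0 <= Cf) (L10 : 0 <= L1) (L20 : 0 <= L2).
Hypothesis (mu0 : 0 < mu).
Hypothesis A : bilevel_assumptions Q1 Q2 f g F G Lf Cf L1 L2 mu sf s1 s2.

Let Af := bilevel_upper A.
Let Ag := bilevel_lower A.
Let p01' : 0 <= p <= 1. Proof. by case/andP: p01 => /ltW -> ->. Qed.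

Local Notation iterate := (iterate R dx dy).
Local Notation Rz := (Rz Cf mu).
Local Notation cbeta := (cbeta Lf Cf L1 L2 mu).
Local Notation cgamma := (cgamma Lf Cf L1 L2 mu).
Local Notation cnoise := (cnoise Lf Cf L1 L2 mu).
Local Notation cmove := (cmove Lf Cf L1 L2 mu).
Local Notation wy := (wy Lf Cf L1 L2 mu).
Local Notation wz := (wz L1 mu).
Local Notation csmooth := (csmooth Lf Cf L1 L2 mu).
Local Notation csigma := (csigma Cf mu sf s1 s2).
Local Notation potential := (potential f g Lf Cf L1 L2 mu).

Variables (alpha : R) (tau b : nat) (u0 : iterate).
Hypotheses (tau0 : (0 < tau)%N) (b0 : (0 < b)%N).
Hypothesis z0b : l2norm (comp_z u0) <= Rz.
Hypothesis ha : step_cond Lf Cf L1 L2 mu alpha.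

Let a0 : 0 < alpha. Proof. by case: ha. Qed.

Local Notation u := (iter_u r F G Cf mu alpha (cbeta * alpha) (cgamma * alpha) tau b u0).
Local Notation v := (iter_v r F G Cf mu alpha (cbeta * alpha) (cgamma * alpha) tau b u0).

Let H := objective f g.
Let Hinf := inf (range H).

Lemma objective_ge_inf x : Hinf <= H x.
Proof. by apply: ge_inf; [exact: bilevel_bounded_below A|exists x]. Qed.

Let gap (w : iterate) := potential w - Hinf.

Let sq0 (x : R) : 0 <= x ^+ 2. Proof. exact: sqr_ge0. Qed.

(** The quantity that telescopes: the potential measured from the infimum of the
objective. *)
Lemma gap_ge0 w : 0 <= potential w - Hinf.
Proof.
rewrite subr_ge0 /potential -addrA (le_trans (objective_ge_inf (comp_x w)))//.
have c1 : 0 <= cbeta by apply: le_trans ler01 _; exact: cbeta1.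
have c2 : 0 <= cgamma by apply: le_trans ler01 _; exact: cgamma1.
rewrite lerDl; apply: addr_ge0; apply: mulr_ge0; rewrite ?sq0//; apply: divr_ge0 => //.
  exact: wy0.
exact: wz0.
Qed.

Lemma slack_ge0 w w' : 0 <= slack f g w w'.
Proof. by rewrite /slack !addr_ge0// sqr_ge0. Qed.

Lemma errE_ge0 w w' : 0 <= errE f g w w'.
Proof. by rewrite /errE !addr_ge0// sqr_ge0. Qed.

Let mU k : imeas (u k).
Proof. exact: (iter_u_meas hs Lf0 Cf0 L10 L20 mu0 A _ _ _ _ tau0 b0). Qed.
Let mV k : imeas (v k).
Proof. exact: (iter_v_meas hs Lf0 Cf0 L10 L20 mu0 A _ _ _ _ tau0 b0). Qed.

Let mYd k : measurable_fun setT (fun w => devY g (u k w)).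
Proof.
have [mx my mz] := mU k; apply: measurable_l2sq; apply: vmeasB => //.
exact: vmeas_lipschitz (ystar_lip L10 mu0 Ag) mx.
Qed.

Let mZd k : measurable_fun setT (fun w => devZ f g (u k w)).
Proof.
have [mx my mz] := mU k; apply: measurable_l2sq; apply: vmeasB => //.
exact: vmeas_lipschitz (zstar_lip Lf0 Cf0 L10 L20 mu0 Af Ag) mx.
Qed.

Let mgap k : measurable_fun setT (fun w => gap (u k w)).
Proof.
have [mx _ _] := mU k.
apply: measurable_funB => //; apply: measurable_funD; first apply: measurable_funD.
- exact: (measurable_loclip (objective_loclip Lf0 Cf0 L10 L20 mu0 Af Ag) mx).
- exact: measurable_funM.
- exact: measurable_funM.
Qed.

Let mslack k : measurable_fun setT (fun w => slack f g (u k w) (v k w)).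
Proof.
have [mx _ _] := mV k.
by apply: measurable_funD => //; apply: measurable_funD => //; exact: measurable_l2sq.
Qed.

Let mgrad k : measurable_fun setT (fun w => l2norm (gradH f g (comp_x (u k w))) ^+ 2).
Proof.
have [mx _ _] := mU k; have [L hL] := gradH_lip Lf0 Cf0 L10 L20 mu0 Af Ag.
exact: measurable_l2sq (vmeas_lipschitz hL mx).
Qed.

Let merr k : measurable_fun setT (fun w => errE f g (u k w) (v k w)).
Proof. exact: (errE_meas hs Lf0 Cf0 L10 L20 mu0 A _ _ _ _ tau0 b0). Qed.

Let EPsi k := (\int[P]_w (gap (u k w))%:E)%E.
Let EG k := (\int[P]_w (l2norm (gradH f g (comp_x (u k w))) ^+ 2)%:E)%E.
Let ES k := (\int[P]_w (slack f g (u k w) (v k w))%:E)%E.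
Let EE k := (\int[P]_w (errE f g (u k w) (v k w))%:E)%E.

Let EPsi0 k : (0 <= EPsi k)%E.
Proof. by apply: integral_ge0 => w _; rewrite lee_fin gap_ge0. Qed.
Let EG0 k : (0 <= EG k)%E.
Proof. by apply: integral_ge0 => w _; rewrite lee_fin. Qed.
Let ES0 k : (0 <= ES k)%E.
Proof. by apply: integral_ge0 => w _; rewrite lee_fin slack_ge0. Qed.
Let EE0 k : (0 <= EE k)%E.
Proof. by apply: integral_ge0 => w _; rewrite lee_fin errE_ge0. Qed.

Let na0 : 0 <= cnoise * alpha.
Proof.
by rewrite mulr_ge0 ?(ltW a0)//; apply: le_trans ler01 _; exact: cnoise1.
Qed.

Lemma expected_step k :
  (EPsi k.+1 + (alpha / 2)%:E * EG k + (alpha / 8)%:E * ES k <=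
   EPsi k + (cnoise * alpha)%:E * EE k)%E.
Proof.
have h2 : 0 <= alpha / 2 by rewrite divr_ge0// ltW.
have h8 : 0 <= alpha / 8 by rewrite divr_ge0// ltW.
have gp w : 0 <= gap (u k.+1 w) by exact: gap_ge0.
have gp' w : 0 <= gap (u k w) by exact: gap_ge0.
have t1 w : 0 <= alpha / 2 * l2norm (gradH f g (comp_x (u k w))) ^+ 2 by rewrite mulr_ge0.
have t2 w : 0 <= alpha / 8 * slack f g (u k w) (v k w) by rewrite mulr_ge0// slack_ge0.
have t3 w : 0 <= cnoise * alpha * errE f g (u k w) (v k w) by rewrite mulr_ge0// errE_ge0.
have e1 : (EPsi k.+1 + (alpha / 2)%:E * EG k + (alpha / 8)%:E * ES k =
  \int[P]_w (gap (u k.+1 w) + alpha / 2 * l2norm (gradH f g (comp_x (u k w))) ^+ 2 +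
     alpha / 8 * slack f g (u k w) (v k w))%:E)%E.
  rewrite /EPsi /EG /ES -(ge0_integralZl_fin P h2 (fun w => sq0 _) (mgrad k)).
  rewrite -(ge0_integralZl_fin P h8 (fun w => slack_ge0 _ _) (mslack k)).
  have m1 : measurable_fun setT
      (fun w => alpha / 2 * l2norm (gradH f g (comp_x (u k w))) ^+ 2).
    by apply: measurable_funM => //; exact: mgrad.
  have m2 : measurable_fun setT (fun w => alpha / 8 * slack f g (u k w) (v k w)).
    by apply: measurable_funM => //; exact: mslack.
  rewrite -(ge0_integralD_fin P gp t1 (mgap k.+1) m1).
  rewrite -(ge0_integralD_fin P (fun w => addr_ge0 (gp w) (t1 w)) t2 _ m2)//.
  exact: measurable_funD (mgap k.+1) m1.
have e2 : (EPsi k + (cnoise * alpha)%:E * EE k =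
  \int[P]_w (gap (u k w) + cnoise * alpha * errE f g (u k w) (v k w))%:E)%E.
  rewrite /EPsi /EE -(ge0_integralZl_fin P na0 (fun w => errE_ge0 _ _) (merr k)).
  have m3 : measurable_fun setT (fun w => cnoise * alpha * errE f g (u k w) (v k w)).
    by apply: measurable_funM => //; exact: merr.
  exact: (esym (ge0_integralD_fin P gp' t3 (mgap k) m3)).
rewrite e1 e2; apply: integral_mono => w; rewrite lee_fin.
  exact: addr_ge0 (addr_ge0 (gp w) (t1 w)) (t2 w).
rewrite /gap iter_uS.
have := potential_step Lf0 Cf0 L10 L20 mu0 Af Ag (u k w) (v k w) ha.
set X := potential (update _ _ _ _ _ _).
by move: (potential _) (l2norm _ ^+ 2) (slack _ _ _ _) (errE _ _ _ _) => a b' c e; lra.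
Qed.

Let cm := 6 * csmooth / b%:R * (cmove * alpha ^+ 2).

Let cm0 : 0 <= 6 * csmooth / b%:R.
Proof. by rewrite divr_ge0// mulr_ge0//; exact: csmooth0. Qed.

Let cmv0 : 0 <= cmove * alpha ^+ 2.
Proof. by rewrite mulr_ge0//; apply: le_trans ler01 _; exact: cmove1. Qed.

Lemma expected_error k :
  (EE k.+1 <= (p * (csigma / tau%:R))%:E + (1 - p)%:E * (EE k + cm%:E * (ES k + EE k)))%E.
Proof.
have := errE_rec hs p01' Lf0 Cf0 L10 L20 mu0 A alpha (cbeta * alpha) (cgamma * alpha)
  tau0 b0 z0b k.
rewrite -EFinM => h; apply: (le_trans h); rewrite leeD2l//.
have /andP[p0 p1] := p01'.
apply: lee_wpmul2l; first by rewrite lee_fin subr_ge0.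
apply: leeD2l; rewrite /cm (EFinM (6 * csmooth / b%:R)) -muleA; apply: lee_wpmul2l; first by rewrite lee_fin.
have e : (ES k + EE k = \int[P]_w (slack f g (u k w) (v k w) + errE f g (u k w) (v k w))%:E)%E.
  rewrite ge0_integralD_fin//; first by move=> w; exact: slack_ge0.
  by move=> w; exact: errE_ge0.
have se0 w : 0 <= slack f g (u k w) (v k w) + errE f g (u k w) (v k w).
  by rewrite addr_ge0 ?slack_ge0 ?errE_ge0.
rewrite e -ge0_integralZl_fin//; last exact: measurable_funD.
apply: integral_mono => w; first by rewrite lee_fin /dist2 !addr_ge0// sqr_ge0.
rewrite lee_fin iter_uS.
apply: (dist2_step Lf0 Cf0 L10 L20 mu0 Af Ag (v k w) ha).
exact: iter_ball.
Qed.

Let fin_of_scaled (t : R) (X : \bar R) : 0 < t -> (0 <= X)%E -> (t%:E * X < +oo)%E ->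
  X \is a fin_num.
Proof.
move=> t0 X0; rewrite ge0_fin_numE// => h; rewrite ltNge leye_eq; apply/negP => /eqP e.
by move: h; rewrite e gt0_muley ?ltxx// lte_fin.
Qed.

(** All the terms are nonnegative, so a finite right-hand side of [expected_step]
makes each term on the left finite; the recursion can then be carried out in the
reals. *)
Lemma expected_step_finite k : EPsi k \is a fin_num -> EE k \is a fin_num ->
  [/\ EPsi k.+1 \is a fin_num, EG k \is a fin_num & ES k \is a fin_num].
Proof.
move=> fp fe.
have h2 : (0 <= (alpha / 2)%:E * EG k)%E.
  by rewrite mule_ge0// lee_fin divr_ge0// ltW.
have h8 : (0 <= (alpha / 8)%:E * ES k)%E.
  by rewrite mule_ge0// lee_fin divr_ge0// ltW.
have rf : (EPsi k + (cnoise * alpha)%:E * EE k < +oo)%E.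
  by rewrite lte_add_pinfty ?ltey_eq ?fp// fin_numM.
have bound := le_lt_trans (expected_step k) rf.
split.
- rewrite (ge0_fin_numE (EPsi0 k.+1)); apply: le_lt_trans bound.
  by rewrite -addeA leeDl// adde_ge0.
- apply: (fin_of_scaled (t := alpha / 2)); [exact: divr_gt0|exact: EG0|].
  by apply: le_lt_trans bound; rewrite addeAC leeDr// adde_ge0.
- apply: (fin_of_scaled (t := alpha / 8)); [exact: divr_gt0|exact: ES0|].
  by apply: le_lt_trans bound; rewrite leeDr// adde_ge0.
Qed.

Lemma expectations_finite k : EPsi k \is a fin_num /\ EE k \is a fin_num.
Proof.
elim: k => [|k [ihp ihe]].
  split.
    have -> : EPsi 0 = (gap u0)%:E by exact: (integral_cst1 P (gap u0)).
    by [].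
  rewrite (ge0_fin_numE (EE0 0)); apply: le_lt_trans (ltry _).
  exact: (errE_init hs Lf0 Cf0 L10 L20 mu0 A _ _ _ tau0 b0 z0b).
have [fp _ fs] := expected_step_finite ihp ihe.
split; first exact: fp.
rewrite (ge0_fin_numE (EE0 k.+1)); apply: le_lt_trans (expected_error k) _.
rewrite -(fineK ihe) -(fineK fs).
by rewrite -!EFinD ltry.
Qed.

Lemma expected_gradient_sum lam K : 0 <= lam ->
  lam * p = (cnoise + 8^-1) * alpha -> lam * ((1 - p) * cm) <= alpha / 8 ->
  exists S, (\sum_(k < K) \int[P]_w (l2norm (gradH f g (comp_x (u k w))) ^+ 2)%:E)%E = S%:E /\
    alpha / 2 * S <= potential u0 - Hinf + lam * (csigma / tau%:R) +
      K%:R * (lam * p * (csigma / tau%:R)).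
Proof.
move=> lam0 hl hc.
have fin k := expectations_finite k.
have fgs k : EG k \is a fin_num /\ ES k \is a fin_num.
  by have [fp fe] := fin k; have [_ ? ?] := expected_step_finite fp fe.
exists (\sum_(k < K) fine (EG k)); split.
  by rewrite -sumEFin; apply: eq_bigr => k _; rewrite fineK//; case: (fgs k).
have e0 : fine (EPsi 0) = potential u0 - Hinf.
  by rewrite (_ : EPsi 0 = (gap u0)%:E)//; exact: (integral_cst1 P (gap u0)).
have e1 : fine (EE 0) <= csigma / tau%:R.
  have h := errE_init hs Lf0 Cf0 L10 L20 mu0 A alpha (cbeta * alpha) (cgamma * alpha) tau0 b0 z0b.
  by rewrite -lee_fin fineK//; case: (fin 0%N).
have H1 k : fine (EPsi k.+1) + alpha / 2 * fine (EG k) + alpha / 8 * fine (ES k) <=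
    fine (EPsi k) + cnoise * alpha * fine (EE k).
  have [fp fe] := fin k; have [fp' _] := fin k.+1; have [fg fs] := fgs k.
  have := expected_step k.
  rewrite -(fineK fp) -(fineK fe) -(fineK fp') -(fineK fg) -(fineK fs).
  by rewrite -!EFinM -!EFinD lee_fin.
have H2 k : fine (EE k.+1) <= p * (csigma / tau%:R) +
    (1 - p) * (fine (EE k) + cm * (fine (ES k) + fine (EE k))).
  have [fp fe] := fin k; have [_ fe'] := fin k.+1; have [fg fs] := fgs k.
  have := expected_error k.
  rewrite -(fineK fe) -(fineK fe') -(fineK fs).
  by rewrite -!EFinD lee_fin.
have := @lyapunov_sum R (fun k => fine (EPsi k)) (fun k => fine (EG k)) (fun k => fine (ES k))
  (fun k => fine (EE k)) alpha cnoise p lam (csigma / tau%:R) cm K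
  (fun k => fine_ge0 (EPsi0 k)) (fun k => fine_ge0 (EE0 k)) (fun k => fine_ge0 (ES0 k))
  lam0 (ltW a0) H1 H2 hl hc.
move=> h; apply: (le_trans h); rewrite e0 lerD2r lerD2l.
exact: ler_wpM2l.
Qed.

End expected_descent.

(** * Step sizes and batch sizes *)

Section schedule.
Context {R : realType}.

Definition refresh_rate (tau b : nat) : R := b%:R / (2 * tau%:R + b%:R).

Lemma refresh_rate_itv (tau b : nat) : (0 < b)%N -> 0 < refresh_rate tau b <= 1.
Proof.
move=> b0; have b0' : 0 < b%:R :> R by rewrite ltr0n.
have t0 : 0 <= tau%:R :> R by [].
by rewrite divr_gt0 ?ler_pdivrMr /=; lra.
Qed.

(** The quantity under the square root of the step size: alpha is of order
b / sqrt tau. *)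
Lemma refresh_ratio (tau b : nat) : (0 < b)%N ->
  (1 - refresh_rate tau b) / (refresh_rate tau b * b%:R) = 2 * tau%:R / b%:R ^+ 2.
Proof.
move=> b0; have b0' : 0 < b%:R :> R by rewrite ltr0n.
have t0 : 0 <= tau%:R :> R by [].
rewrite /refresh_rate; move: (b%:R) (tau%:R) b0' t0 => x t b0' t0.
by field; rewrite !gt_eqF//; lra.
Qed.

Lemma step_size_bounds (c q : R) : 0 < c -> 0 <= q ->
  let alpha := c / (1 + Num.sqrt q) in
  [/\ 0 < alpha, alpha <= c & q * alpha ^+ 2 <= c ^+ 2].
Proof.
move=> c0 q0 alpha; have s0 := sqrtr_ge0 q.
have a0 : 0 < alpha by rewrite divr_gt0// ltr_pwDl.
have e : alpha * (1 + Num.sqrt q) = c by rewrite divfK// gt_eqF// ltr_pwDl.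
split=> //; first by rewrite -[leRHS]e ler_peMr ?lerDl// ltW.
rewrite -[in leLHS](sqr_sqrtr q0) -exprMn lerXn2r ?nnegrE ?mulr_ge0 ?(ltW a0) ?(ltW c0)//.
by rewrite -[leRHS]e mulrDr mulr1 mulrC lerDr ltW.
Qed.

Lemma batch_size_bounds (eps ct : R) : 0 < eps <= 1 -> 0 < ct ->
  let tau := `|Num.ceil (ct / eps)|%N in
  [/\ (0 < tau)%N, ct / eps <= tau%:R & tau%:R <= (ct + 1) / eps].
Proof.
move=> /andP[e0 e1] c0 tau; have q0 : 0 < ct / eps by rewrite divr_gt0.
have h0 : 0 < Num.ceil (ct / eps) by rewrite ceil_gt0.
have te : tau%:R = (Num.ceil (ct / eps))%:~R :> R.
  by rewrite /tau natr_absz gtr0_norm.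
split.
- by rewrite absz_gt0 gt_eqF.
- by rewrite te ceil_ge.
- have := ceilB1_lt (ct / eps); rewrite intrB -te mulrDl mul1r.
  have : 1 <= eps^-1 by rewrite -[leLHS]invr1 lef_pV2 ?posrE.
  by lra.
Qed.

Lemma powR_neg_three_halves (eps : R) : 0 < eps ->
  eps `^ (- (3 / 2)) = (Num.sqrt eps ^+ 3)^-1.
Proof.
by move=> e0; rewrite powRN mulrC powRrM powR12_sqrt ?ltW// powR_mulrn// sqrtr_ge0.
Qed.

(** The error, weighted by [la * alpha / p], grows in one step by a multiple of
alpha * (alpha^2 (1 - p) / (p b)); the step size is chosen to make the parenthesis
at most c^2. *)
Lemma error_weight (la cl mv c p b alpha : R) : 0 <= la -> 0 <= cl -> 0 <= mv ->
  0 < c -> 0 < p -> 0 < b -> 0 < alpha -> c <= 1 -> 8 * (la * (6 * cl * mv)) * c <= 1 ->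
  (1 - p) / (p * b) * alpha ^+ 2 <= c ^+ 2 ->
  la * alpha / p * ((1 - p) * (6 * cl / b * (mv * alpha ^+ 2))) <= alpha / 8.
Proof.
move=> la0 cl0 mv0 c0 p0 b0 a0 c1 hc hq.
have -> : la * alpha / p * ((1 - p) * (6 * cl / b * (mv * alpha ^+ 2))) =
    alpha * (la * (6 * cl * mv) * ((1 - p) / (p * b) * alpha ^+ 2)).
  by field; rewrite !gt_eqF.
have k0 : 0 <= la * (6 * cl * mv) by rewrite !mulr_ge0.
apply: (ler_wpM2l (ltW a0)).
apply: (le_trans (ler_wpM2l k0 hq)).
have : la * (6 * cl * mv) * c ^+ 2 <= la * (6 * cl * mv) * c.
  by apply: ler_wpM2l => //; rewrite expr2 ler_piMr// ltW.
move: hc; move: (la * _) (c ^+ 2) => x y; lra.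
Qed.

(** Although the weight of the error is of order 1 / p, the first batch of size
[tau] compensates for it, as tau * p is at least b / 3. *)
Lemma initial_error (la v c alpha : R) (tau b : nat) : 0 <= la -> 0 <= v -> 0 < c ->
  (0 < tau)%N -> (0 < b)%N -> b%:R <= Num.sqrt (tau%:R : R) -> 0 < alpha -> alpha <= c ->
  la * alpha / refresh_rate tau b * (v / tau%:R) <= 3 * c * la * v.
Proof.
move=> la0 v0 c0 t0 b0 bt a0 ac.
have b1 : 1 <= b%:R :> R by rewrite (ler_nat R 1).
have t1 : 1 <= tau%:R :> R by rewrite (ler_nat R 1).
have bt' : b%:R <= tau%:R :> R.
  apply: (le_trans bt); rewrite -[leRHS](sqr_sqrtr (ler0n _ _)) expr2 ler_peMl//.
  exact: le_trans b1 bt.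
rewrite /refresh_rate; move: (b%:R) (tau%:R) b1 t1 bt' {bt} => x t x1 t1 xt.
have -> : la * alpha / (x / (2 * t + x)) * (v / t) = la * v * alpha * ((2 * t + x) / (x * t)).
  by field; rewrite !gt_eqF//; lra.
have -> : 3 * c * la * v = la * v * c * 3 by ring.
apply: ler_pM => //; [by rewrite !mulr_ge0// ltW|by rewrite divr_ge0//; nra| |].
  by apply: ler_wpM2l => //; rewrite mulr_ge0.
by rewrite ler_pdivrMr; nra.
Qed.

(** Half of [eps] pays for the initial value [phi] through [K], the other half for
the variance [v] of the batches. *)
Lemma average_gradient (eps alpha phi v la S K : R) :
  0 < eps -> 0 < alpha -> 0 < K ->
  4 * phi / (alpha * eps) <= K ->
  2 * la * v <= eps / 2 ->
  alpha / 2 * S <= phi + K * (la * alpha * v) -> K^-1 * S <= eps.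
Proof.
move=> e0 a0 K0 hK hv hS; rewrite ler_pdivrMl//.
have h : 4 * phi <= K * (alpha * eps) by rewrite -ler_pdivrMr// mulr_gt0.
have : alpha / 2 * S <= alpha / 2 * (K * eps); last by rewrite ler_pM2l ?divr_gt0.
apply: (le_trans hS).
have : K * alpha * (2 * la * v) <= K * alpha * (eps / 2).
  by apply: ler_wpM2l => //; rewrite mulr_ge0// ltW.
lra.
Qed.

(** With e = sqrt eps and s = sqrt tau <= T / e, an iteration costs O(b) samples and
K * b is O(s / eps), that is O(e^-3). *)
Lemma total_cost (eps c phi T : R) (tau b K : nat) :
  let alpha := c / (1 + Num.sqrt (2 * tau%:R / b%:R ^+ 2)) in
  0 < eps <= 1 -> 0 < c -> 0 <= phi -> 1 <= T -> (0 < b)%N -> (0 < tau)%N ->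
  b%:R <= Num.sqrt (tau%:R : R) -> tau%:R <= T / eps ->
  K%:R <= 4 * phi / (alpha * eps) + 1 ->
  3 * tau%:R + 3 * (K%:R * (refresh_rate tau b * tau%:R + (1 - refresh_rate tau b) * b%:R)) <=
  T * (15 / 2 + 54 * phi / c) * eps `^ (- (3 / 2)).
Proof.
move=> alpha /andP[e0 e1] c0 phi0 T1 b0 t0 bt tT hK.
have b0' : 0 < b%:R :> R by rewrite ltr0n.
have t0' : 0 < tau%:R :> R by rewrite ltr0n.
rewrite powR_neg_three_halves//.
set e := Num.sqrt eps; have ee : eps = e ^+ 2 by rewrite sqr_sqrtr// ltW.
have e0' : 0 < e by rewrite sqrtr_gt0.
have e1' : e <= 1 by rewrite -sqrtr1 ler_sqrt.
set s := Num.sqrt tau%:R in bt; have ss : tau%:R = s ^+ 2 by rewrite sqr_sqrtr.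
have s0 : 0 < s by rewrite sqrtr_gt0.
have sT : s <= T / e.
  rewrite -(@ler_pXn2r _ 2%N)// ?nnegrE ?divr_ge0 ?(ltW s0) ?(ltW e0') ?(le_trans ler01 T1)//.
  rewrite -ss (le_trans tT)// ee exprMn exprVn ler_wpM2r// ?invr_ge0 ?sqr_ge0//.
  by rewrite expr2 ler_peMl// (le_trans ler01 T1).
have s2 : Num.sqrt (2 * tau%:R / b%:R ^+ 2) <= 2 * s / b%:R.
  rewrite -[leRHS]ger0_norm ?divr_ge0 ?mulr_ge0 ?(ltW s0)// -sqrtr_sqr ler_wsqrtr//.
  rewrite exprMn exprVn ler_wpM2r ?invr_ge0 ?sqr_ge0// ss.
  by have := sqr_ge0 s; lra.
have ai : alpha^-1 <= (1 + 2 * s / b%:R) / c.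
  rewrite /alpha invf_div ler_wpM2r ?invr_ge0 ?(ltW c0)//.
  by rewrite lerD2l.
have Kb : K%:R * b%:R <= 12 * phi / c * s / eps + s.
  have h1 : 4 * phi / (alpha * eps) <= 4 * phi / eps * ((1 + 2 * s / b%:R) / c).
    rewrite invfM [alpha^-1 * _]mulrC mulrA; apply: ler_wpM2l ai.
    by rewrite divr_ge0 ?mulr_ge0 ?(ltW e0).
  have := ler_wpM2r (ltW b0') (le_trans hK (lerD h1 (lexx 1))).
  move=> h2; apply: (le_trans h2).
  have -> : (4 * phi / eps * ((1 + 2 * s / b%:R) / c) + 1) * b%:R =
     4 * phi / eps / c * (b%:R + 2 * s) + b%:R by field; rewrite !gt_eqF.
  apply: lerD => //.
  have -> : 12 * phi / c * s / eps = 4 * phi / eps / c * (3 * s) by field; rewrite !gt_eqF.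
  apply: ler_wpM2l; first by rewrite !divr_ge0 ?mulr_ge0 ?(ltW e0) ?(ltW c0).
  by lra.
have pb : refresh_rate tau b * tau%:R + (1 - refresh_rate tau b) * b%:R <= 3 / 2 * b%:R.
  have -> : refresh_rate tau b * tau%:R + (1 - refresh_rate tau b) * b%:R =
      b%:R * (3 * tau%:R / (2 * tau%:R + b%:R)).
    by rewrite /refresh_rate; field; rewrite gt_eqF//; lra.
  by rewrite mulrC ler_pM2r// ler_pdivrMr; lra.
have e3 : 0 < (e ^+ 3)^-1 by rewrite invr_gt0 exprn_gt0.
have h3 k : (k <= 3)%N -> (e ^+ k)^-1 <= (e ^+ 3)^-1.
  move=> k3; rewrite lef_pV2 ?posrE ?exprn_gt0//.
  by rewrite ler_wiXn2l// ltW.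
have h1 : K%:R * (refresh_rate tau b * tau%:R + (1 - refresh_rate tau b) * b%:R) <=
  3 / 2 * (12 * phi / c * s / eps + s).
  apply: (le_trans (ler_wpM2l (ler0n _ _) pb)).
  by rewrite mulrCA ler_pM2l.
have a1 : T / e ^+ 2 <= T / e ^+ 3.
  by apply: ler_wpM2l; [exact: le_trans T1|exact: h3].
have a2 : s <= T / e ^+ 3.
  by apply: (le_trans sT); apply: ler_wpM2l; [exact: le_trans T1|exact: (h3 1%N)].
have a3 : phi / c * s / eps <= phi / c * (T / e ^+ 3).
  rewrite -mulrA; apply: ler_wpM2l; first by rewrite divr_ge0// ltW.
  have -> : T / e ^+ 3 = T / e / eps by rewrite ee; field; rewrite gt_eqF.
  by rewrite ler_wpM2r// invr_ge0 ltW.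
move: h1 tT a1 a2 a3; rewrite -ee.
have -> : T * (15 / 2 + 54 * phi / c) / e ^+ 3 = 15 / 2 * (T / e ^+ 3) + 54 * (phi / c * (T / e ^+ 3)).
  by field; rewrite !gt_eqF.
have -> : 12 * phi / c * s / eps = 12 * (phi / c * s / eps) by ring.
move: (T / e ^+ 3) (phi / c * _) (phi / c * s / eps) (K%:R * _) (T / eps) => *.
lra.
Qed.

End schedule.

Section constants.
Context {R : realType}.
Variables (Lf Cf L1 L2 mu : R).
Hypotheses (Lf0 : 0 <= Lf) (Cf0 : 0 <= Cf) (L10 : 0 <= L1) (L20 : 0 <= L2).
Hypothesis (mu0 : 0 < mu).

Local Notation CH := (CH Lf Cf L1 L2 mu).
Local Notation cbeta := (cbeta Lf Cf L1 L2 mu).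
Local Notation cgamma := (cgamma Lf Cf L1 L2 mu).
Local Notation cnoise := (cnoise Lf Cf L1 L2 mu).
Local Notation cmove := (cmove Lf Cf L1 L2 mu).
Local Notation csmooth := (csmooth Lf Cf L1 L2 mu).

(** The reset of the error at rate p has to pay for [cnoise] in the potential and
for the 1/8 that the movement of the iterates costs. *)
Definition err_weight : R := cnoise + 8^-1.

(** The inverse of the sum of all the quantities that bound the step size from
above, so that each constraint holds separately. *)
Definition step_const : R :=
  (1 + 8 * CH + (cbeta + cgamma) * (L1 ^+ 2 / mu + mu) +
   8 * (err_weight * (6 * csmooth * cmove)))^-1.

Lemma err_weight_ge1 : 1 <= err_weight.
Proof. by have := cnoise1 Lf Cf L1 L2 mu0; rewrite /err_weight; lra. Qed.

Let h1 : 0 <= 8 * CH.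
Proof. by rewrite mulr_ge0//; exact: CH0. Qed.
Let cb0 : 0 <= cbeta. Proof. exact: le_trans ler01 (cbeta1 Lf Cf L1 L2 mu0). Qed.
Let cg0 : 0 <= cgamma. Proof. exact: le_trans ler01 (cgamma1 Lf Cf L1 L2 mu0). Qed.
Let l0 : 0 <= L1 ^+ 2 / mu. Proof. by rewrite divr_ge0 ?sqr_ge0// ltW. Qed.
Let h2 : 0 <= (cbeta + cgamma) * (L1 ^+ 2 / mu + mu).
Proof. by apply: mulr_ge0; apply: addr_ge0 => //; exact: ltW. Qed.
Let h3 : 0 <= 8 * (err_weight * (6 * csmooth * cmove)).
Proof.
apply: mulr_ge0 => //; apply: mulr_ge0; first exact: le_trans ler01 err_weight_ge1.
apply: mulr_ge0; last exact: le_trans ler01 (cmove1 Lf Cf L1 L2 mu).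
by apply: mulr_ge0 => //; exact: csmooth0.
Qed.

Lemma step_const_gt0 : 0 < step_const.
Proof.
by rewrite invr_gt0; do 2 (apply: ltr_wpDr => //); apply: ltr_wpDr.
Qed.

Lemma step_const_mul t : 0 <= t -> t <= step_const^-1 -> t * step_const <= 1.
Proof.
move=> t0 h; rewrite -[leRHS](mulVf (lt0r_neq0 step_const_gt0)).
by rewrite ler_wpM2r// ltW// step_const_gt0.
Qed.

Lemma step_const_le1 : step_const <= 1.
Proof.
rewrite -[step_const]mul1r; apply: step_const_mul => //.
rewrite invrK; move: h1 h2 h3; move: (8 * CH) (_ * (_ + mu)) (8 * _) => x y z; lra.
Qed.

Lemma step_const_drift : 8 * (err_weight * (6 * csmooth * cmove)) * step_const <= 1.
Proof.
apply: step_const_mul => //.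
rewrite invrK; move: h1 h2 h3; move: (8 * CH) (_ * (_ + mu)) (8 * _) => x y z; lra.
Qed.

Lemma step_const_cond alpha : 0 < alpha -> alpha <= step_const ->
  step_cond Lf Cf L1 L2 mu alpha.
Proof.
move=> a0 ac.
have key t : 0 <= t -> t <= step_const^-1 -> t * alpha <= 1.
  move=> t0 h; apply: le_trans (step_const_mul t0 h); exact: ler_wpM2l.
have kb : cbeta * (L1 ^+ 2 / mu + mu) * alpha <= 1.
  apply: key; first by rewrite mulr_ge0// addr_ge0// ltW.
  have : cbeta * (L1 ^+ 2 / mu + mu) <= (cbeta + cgamma) * (L1 ^+ 2 / mu + mu).
    by rewrite ler_wpM2r ?lerDl// addr_ge0// ltW.
  rewrite invrK; move: h1 h2 h3.
  move: (8 * CH) ((_ + _) * (_ + mu)) (8 * _) (_ * _) => x y z t; lra.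
have kg : cgamma * (L1 ^+ 2 / mu + mu) * alpha <= 1.
  apply: key; first by rewrite mulr_ge0// addr_ge0// ltW.
  have : cgamma * (L1 ^+ 2 / mu + mu) <= (cbeta + cgamma) * (L1 ^+ 2 / mu + mu).
    by rewrite ler_wpM2r ?lerDr// addr_ge0// ltW.
  rewrite invrK; move: h1 h2 h3.
  move: (8 * CH) ((_ + _) * (_ + mu)) (8 * _) (_ * _) => x y z t; lra.
have split_ct t : 0 <= t -> t * (L1 ^+ 2 / mu + mu) * alpha <= 1 ->
    t * alpha * L1 ^+ 2 <= mu /\ t * alpha * mu <= 1.
  move=> t0 ht; have ta : 0 <= t * alpha by rewrite mulr_ge0// ltW.
  have e1 : 0 <= t * alpha * (L1 ^+ 2 / mu) by rewrite mulr_ge0.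
  have e2 : 0 <= t * alpha * mu by rewrite mulr_ge0// ltW.
  have e3 : t * alpha * (L1 ^+ 2 / mu) + t * alpha * mu <= 1.
    by apply: le_trans ht; rewrite le_eqVlt; apply/orP; left; apply/eqP; ring.
  split; last by lra.
  rewrite -[leRHS]mul1r -ler_pdivrMr// -mulrA; lra.
split=> //; [|exact: split_ct|exact: split_ct].
have : 8 * CH * alpha <= 1.
  apply: key => //; rewrite invrK; move: h2 h3.
  move: (8 * CH) ((_ + _) * (_ + mu)) (8 * _) => x y z; lra.
by lra.
Qed.

End constants.

Section expected_cost.
Context {R : realType} {d d1 d2 : measure_display}.
Context {Omega : measurableType d} {S1 : measurableType d1} {S2 : measurableType d2}.
Context (P : probability Omega R) (Q1 : probability S1 R) (Q2 : probability S2 R).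
Variables (r : randomness Omega S1 S2) (p : R).
Hypothesis hs : sampling r P Q1 Q2 p.

Let charge (tau b : nat) k w : R :=
  (if (coin r k w).1.1 then tau%:R else b%:R) +
  (if (coin r k w).1.2 then tau%:R else b%:R) +
  (if (coin r k w).2 then tau%:R else b%:R).

Let charge0 tau b k w : 0 <= charge tau b k w.
Proof. by rewrite !addr_ge0//; case: ifP. Qed.

Let mcoin (e : bool * bool * bool -> bool) k : measurable_fun setT e ->
  measurable_fun setT (fun w => e (coin r k w)).
Proof. by move=> me; exact: measurableT_comp. Qed.

Let m1 : measurable_fun setT (fun c : bool * bool * bool => c.1.1).
Proof. exact: measurableT_comp measurable_fst measurable_fst. Qed.
Let m2 : measurable_fun setT (fun c : bool * bool * bool => c.1.2).
Proof. exact: measurableT_comp measurable_snd measurable_fst. Qed.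
Let m3 : measurable_fun setT (fun c : bool * bool * bool => c.2).
Proof. exact: measurable_snd. Qed.

Let mite (e : Omega -> bool) (x y : R) : measurable_fun setT e ->
  measurable_fun setT (fun w => if e w then x else y).
Proof. by move=> me; exact: measurable_fun_ifT. Qed.

Let mcharge tau b k : measurable_fun setT (charge tau b k).
Proof.
apply: measurable_funD; first apply: measurable_funD.
- exact/mite/(mcoin k m1).
- exact/mite/(mcoin k m2).
- exact/mite/(mcoin k m3).
Qed.

Let expected_charge tau b k :
  (\int[P]_w (charge tau b k w)%:E = (3 * (p * tau%:R + (1 - p) * b%:R))%:E)%E.
Proof.
have i0 (e : bool) : 0 <= (if e then tau%:R else b%:R) :> R by case: e.
rewrite /charge ge0_integralD_fin; last 4 first.
- by move=> w; apply: addr_ge0; exact: i0.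
- by move=> w; exact: i0.
- by apply: measurable_funD; [exact/mite/(mcoin k m1)|exact/mite/(mcoin k m2)].
- exact/mite/(mcoin k m3).
rewrite ge0_integralD_fin; last 4 first.
- by move=> w; exact: i0.
- by move=> w; exact: i0.
- exact/mite/(mcoin k m1).
- exact/mite/(mcoin k m2).
rewrite (integral_ite (mcoin k m1) (coin_x_law hs k))//.
rewrite (integral_ite (mcoin k m2) (coin_y_law hs k))//.
rewrite (integral_ite (mcoin k m3) (coin_z_law hs k))//.
by rewrite -!EFinD; congr (_%:E); ring.
Qed.

(** The batches of iteration 0 are drawn whatever the coins: charging them on top
of the coins gives an upper bound that treats all iterations alike. *)
Lemma expected_sample_cost tau b K :
  ('E_P[fun w => (\sum_(k < K) sample_cost tau b r k w)%N%:R] <=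
   (3 * tau%:R + 3 * (K%:R * (p * tau%:R + (1 - p) * b%:R)))%:E)%E.
Proof.
(* 3 * tau pays for the initial batches of the three estimators *)
pose total K w : R := 3 * tau%:R + \sum_(k < K) charge tau b k w.
have total0 n w : 0 <= total n w.
  by apply: addr_ge0; [rewrite mulr_ge0|apply: sumr_ge0 => k _; exact: charge0].
have mtotal n : measurable_fun setT (total n).
  by apply: measurable_funD => //; apply: measurable_sum => k; exact: mcharge.
have -> : (3 * tau%:R + 3 * (K%:R * (p * tau%:R + (1 - p) * b%:R)))%:E =
    (\int[P]_w (total K w)%:E)%E.
  elim: K => [|K ih].
    rewrite mul0r mulr0 addr0 -(integral_cst1 P (3 * tau%:R)).
    by apply: eq_integral => w _; rewrite /total big_ord0 addr0.
  have -> : (\int[P]_w (total K.+1 w)%:E = \int[P]_w (total K w + charge tau b K w)%:E)%E.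
    by apply: eq_integral => w _; rewrite /total big_ord_recr addrA.
  rewrite ge0_integralD_fin// -ih expected_charge -EFinD -[K.+1%:R]natr1.
  by congr (_%:E); ring.
rewrite unlock; apply: integral_mono => w; rewrite lee_fin// natr_sum.
have t0 : 0 <= 3 * tau%:R :> R by rewrite mulr_ge0.
have costE k c : ((if (k == 0)%N || c then tau else b)%:R : R) =
    if k == 0%N then tau%:R else if c then tau%:R else b%:R.
  by case: eqP; case: c.
have step k : (sample_cost tau b r k w)%:R <= (if k == 0%N then 3 * tau%:R else 0) +
    charge tau b k w.
  have := charge0 tau b k w; rewrite /sample_cost !natrD !costE /charge; case: eqP => _.
    by lra.
  by rewrite add0r.
rewrite /total; apply: le_trans (ler_sum _ (fun (k : 'I_K) _ => step k)) _.
rewrite big_split /= lerD2r.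
case: K => [|K]; first by rewrite big_ord0.
by rewrite big_ord_recl /= big1 ?addr0.
Qed.

End expected_cost.

(** * Sample complexity *)

Theorem corollaryG3 (R : realType) (Lf Cf L1 L2 mu sf s1 s2 : R)
    (hLf : 0 <= Lf) (hCf : 0 <= Cf) (hL1 : 0 <= L1) (hL2 : 0 <= L2) (hmu : 0 < mu)
    (hsf : 0 < sf) (hs1 : 0 < s1) (hs2 : 0 < s2) :
  exists (c c_beta c_gamma c_tau : R) (bound : R -> R -> R -> R),
    [/\ 0 < c, 0 < c_beta, 0 < c_gamma & 0 < c_tau] /\
    forall (dx dy : nat) (d d1 d2 : measure_display)
      (Omega : measurableType d) (S1 : measurableType d1) (S2 : measurableType d2)
      (P : probability Omega R) (Q1 : probability S1 R) (Q2 : probability S2 R)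
      (f g : 'cV[R]_(dx + dy) -> R)
      (F : S1 -> 'cV[R]_(dx + dy) -> R) (G : S2 -> 'cV[R]_(dx + dy) -> R)
      (x0 : 'cV[R]_dx) (y0 z0 : 'cV[R]_dy) (eps : R) (b : nat)
      (r : randomness Omega S1 S2),
    let H := objective f g in
    let tau := `|Num.ceil (c_tau / eps)|%N in
    let p : R := b%:R / (2 * tau%:R + b%:R) in
    let alpha := c / (1 + Num.sqrt ((1 - p) / (p * b%:R))) in
    let x := spaba_x F G (Cf / mu) alpha (c_beta * alpha) (c_gamma * alpha) tau b r
               (Iterate x0 y0 z0) in
    bilevel_assumptions Q1 Q2 f g F G Lf Cf L1 L2 mu sf s1 s2 ->
    l2norm z0 <= Cf / mu ->
    0 < eps <= 1 ->
    (0 < b)%N ->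
    b%:R <= Num.sqrt (tau%:R : R) ->
    sampling r P Q1 Q2 p ->
    exists K : nat,
      [/\ (0 < K)%N,
          ((K%:R^-1)%:E * \sum_(k < K) 'E_P[fun w => (l2norm (grad H (x k w)) ^+ 2)%R]
             <= eps%:E)%E
        & ('E_P[fun w => (\sum_(k < K) sample_cost tau b r k w)%N%:R]
             <= (bound (H x0 - inf (range H)) (l2norm (y0 - ystar g x0))
                   (l2norm (z0 - zstar f g x0)) * eps `^ (- (3 / 2)))%:E)%E].
Proof.
pose cb := cbeta Lf Cf L1 L2 mu; pose cg := cgamma Lf Cf L1 L2 mu.
pose la := err_weight Lf Cf L1 L2 mu; pose v := csigma Cf mu sf s1 s2.
pose c := step_const Lf Cf L1 L2 mu.
pose phi (D dY dZ : R) := D + wy Lf Cf L1 L2 mu / cb * dY ^+ 2 +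
  wz L1 mu / cg * dZ ^+ 2 + 3 * c * la * v.
(* tau <= T / eps, the ceiling being paid by 1 <= 1 / eps *)
pose T := 4 * la * v + 1.
have cb0 : 0 < cb by exact: lt_le_trans ltr01 (cbeta1 Lf Cf L1 L2 hmu).
have cg0 : 0 < cg by exact: lt_le_trans ltr01 (cgamma1 Lf Cf L1 L2 hmu).
have la1 : 1 <= la by exact: err_weight_ge1.
have la0 : 0 < la by exact: lt_le_trans la1.
have c0 : 0 < c by exact: step_const_gt0.
have c_le1 : c <= 1 by exact: step_const_le1.
have c_drift : 8 * (la * (6 * csmooth Lf Cf L1 L2 mu * cmove Lf Cf L1 L2 mu)) * c <= 1.
  by exact: step_const_drift.
have v0 : 0 < v.
  apply: ltr_wpDr; first exact: sqr_ge0.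
  by apply: ltr_wpDr; [rewrite mulr_ge0 ?sqr_ge0|rewrite mulr_gt0 ?exprn_gt0].
have ct0 : 0 < 4 * la * v by rewrite !mulr_gt0.
exists c, cb, cg, (4 * la * v), (fun D dY dZ => T * (15 / 2 + 54 * phi D dY dZ / c)).
split=> // dx dy d d1 d2 Omega S1 S2 P Q1 Q2 f g F G x0 y0 z0 eps b r H tau p alpha x.
move=> A z0b he b0 bt hs.
have /andP[e0 e1] := he.
have [tau0 tau_ge tau_le] : [/\ (0 < tau)%N, 4 * la * v / eps <= tau%:R & tau%:R <= T / eps].
  exact: batch_size_bounds.
have p01 : 0 < p <= 1 by exact: refresh_rate_itv.
have p0 : 0 < p by case/andP: p01.
have b0' : 0 < b%:R :> R by rewrite ltr0n.
have q0 : 0 <= (1 - p) / (p * b%:R).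
  by rewrite divr_ge0 ?mulr_ge0 ?(ltW p0)// subr_ge0; case/andP: p01.
have [a0 ac qa] : [/\ 0 < alpha, alpha <= c & (1 - p) / (p * b%:R) * alpha ^+ 2 <= c ^+ 2].
  exact: step_size_bounds.
have sc : step_cond Lf Cf L1 L2 mu alpha by exact: step_const_cond.
pose u0 := Iterate x0 y0 z0.
have gap0 := gap_ge0 (Q1 := Q1) hmu A u0.
set dY := l2norm (y0 - ystar g x0); set dZ := l2norm (z0 - zstar f g x0).
set D := H x0 - inf (range H).
have gapE : potential f g Lf Cf L1 L2 mu u0 - inf (range H) + 3 * c * la * v = phi D dY dZ.
  have aux (h a1 a2 t w : R) : h + a1 + a2 - t + w = h - t + a1 + a2 + w by ring.
  exact: aux.
have phi0 : 0 <= phi D dY dZ.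
  by rewrite -gapE addr_ge0// !mulr_ge0// ltW.
(* the least integer above 4 * phi / (alpha * eps), hence positive *)
pose K := (Num.truncn (4 * phi D dY dZ / (alpha * eps))).+1.
have hK0 : 0 <= 4 * phi D dY dZ / (alpha * eps).
  by apply: divr_ge0; apply: mulr_ge0 => //; apply: ltW.
exists K; split=> //.
- have lam0 : 0 <= la * alpha / p.
    by apply: divr_ge0; [apply: mulr_ge0|]; apply: ltW.
  have lp : la * alpha / p * p = la * alpha by rewrite divfK ?lt0r_neq0.
  have [S [eS hS]] := expected_gradient_sum (u0 := u0) hs p01 hLf hCf hL1 hL2 hmu A
    tau0 b0 z0b sc K lam0 lp (error_weight (ltW la0) (csmooth0 Cf L1 L2 mu hLf)
      (le_trans ler01 (cmove1 Lf Cf L1 L2 mu)) c0 p0 b0' a0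
      c_le1 c_drift qa).
  have -> : (\sum_(k < K) 'E_P[fun w => (l2norm (grad H (x k w)) ^+ 2)%R] = S%:E)%E.
    rewrite -eS; apply: eq_bigr => k _; rewrite unlock; apply: eq_integral => w _.
    by rewrite (grad_objective hLf hCf hL1 hL2 hmu (bilevel_upper A) (bilevel_lower A)).
  rewrite -EFinM lee_fin.
  apply: (average_gradient (phi := phi D dY dZ) (v := v / tau%:R) (la := la) e0 a0).
  + exact: ltr0Sn.
  + exact: ltW (truncnS_gt _).
  + rewrite mulrA ler_pdivrMr ?ltr0n//.
    by move: tau_ge; rewrite ler_pdivrMr//; lra.
  + apply: (le_trans hS); rewrite lp lerD2r -gapE lerD2l.
    exact: initial_error (ltW la0) (ltW v0) c0 tau0 b0 bt a0 ac.
- apply: (le_trans (expected_sample_cost hs tau b K)); rewrite lee_fin.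
  have aE : alpha = c / (1 + Num.sqrt (2 * tau%:R / b%:R ^+ 2)).
    by rewrite /alpha /p -(refresh_ratio tau b0).
  apply: total_cost => //.
  + by rewrite /T lerDr ltW.
  + by rewrite -aE /K -natr1 lerD2r truncn_le.
Qed.
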